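(* Let $g=\exp\Bigl(\sum_{\alpha,\beta=1}^N\sum_{j,k\in\mathbb Z}A^{(\alpha\beta)}_{jk}\psi^{*(\alpha)}_j\psi^{(\beta)}_k\Bigr)$ be a Clifford group element. For $\alpha,\beta\in\{1,\dots,N\}$ and $\mathbf s\in\mathbb Z^N$ put $$\tau_{\alpha\beta}(\mathbf s,\mathbf t,\bar{\mathbf t})=(-1)^{|\mathbf s|(|\mathbf s|-1)/2}\,\bigl\langle\mathbf s+[1]_\alpha-[1]_\beta\bigr|\,e^{J(\mathbf t)}\,g\,e^{-\bar J(\bar{\mathbf t})}\,\bigl|\mathbf s\bigr\rangle,\qquad |\mathbf s|=\sum_{\mu=1}^Ns_\mu.$$ Then $(\tau_{\alpha\beta})$ is a tau-function of the multi-component Toda lattice hierarchy, i.e. for all $\alpha,\beta$ and all $\mathbf s,\mathbf s'\in\mathbb Z^N$, $\mathbf t,\mathbf t',\bar{\mathbf t},\bar{\mathbf t}'$ it satisfies $$\sum_{\gamma=1}^N\epsilon_{\alpha\gamma}(\mathbf s)\epsilon^{-1}_{\beta\gamma}(\mathbf s')\oint_{C_\infty}z^{s_\gamma-s'_\gamma+\delta_{\alpha\gamma}+\delta_{\beta\gamma}-2}e^{\xi(\mathbf t_\gamma-\mathbf t'_\gamma,z)}\tau_{\alpha\gamma}(\mathbf s,\mathbf t-[z^{-1}]_\gamma,\bar{\mathbf t})\,\tau_{\gamma\beta}(\mathbf s',\mathbf t'+[z^{-1}]_\gamma,\bar{\mathbf t}')\,dz$$ $$=-\sum_{\gamma=1}^N\epsilon_{\alpha\gamma}\epsilon_{\beta\gamma}\,\epsilon_{\alpha\gamma}(\mathbf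 s)\epsilon_{0N}(\mathbf s)\epsilon^{-1}_{\beta\gamma}(\mathbf s')\epsilon^{-1}_{0N}(\mathbf s')\oint_{C_\infty}z^{s'_\gamma-s_\gamma-2}e^{\xi(\bar{\mathbf t}_\gamma-\bar{\mathbf t}'_\gamma,z)}\tau_{\alpha\gamma}(\mathbf s+[1]_\gamma,\mathbf t,\bar{\mathbf t}-[z^{-1}]_\gamma)\,\tau_{\gamma\beta}(\mathbf s'-[1]_\gamma,\mathbf t',\bar{\mathbf t}'+[z^{-1}]_\gamma)\,dz.$$
   Context: **Variables and signs.** Fix $N\ge1$. $\mathbf t=(t_{\alpha,k})$, $\bar{\mathbf t}=(\bar t_{\alpha,k})$, $1\le\alpha\le N$, $k\ge1$; $\mathbf t_\alpha=(t_{\alpha,k})_k$; $\xi(\mathbf t_\alpha,z)=\sum_{k\ge1}t_{\alpha,k}z^k$. $\mathbf t\pm[z^{-1}]_\gamma$ is $\mathbf t$ with $t_{\alpha,j}$ replaced by $t_{\alpha,j}\pm\delta_{\alpha\gamma}z^{-j}/j$ (same for $\bar{\mathbf t}$); $\mathbf s\pm[1]_\gamma$ is $\mathbf s$ with $s_\gamma$ replaced by $s_\gamma\pm1$. $\oint_{C_\infty}$ is the integral over a big circle around $\infty$ ($2\pi i$ times the coefficient of $z^{-1}$ of the formal integrand). $\epsilon_{\alpha\gamma}=1$ for $\alpha\le\gamma$, $\epsilon_{\alpha\gamma}=-1$ for $\alpha>\gamma$; $\epsilon_{\alpha\gamma}(\mathbf s)=\exp(-i\pi\sum_{\alpha<\mu\le\gamma}s_\mu)$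 for $\alpha\le\gamma$, $\epsilon_{\alpha\gamma}(\mathbf s)=-\exp(i\pi\sum_{\gamma<\mu\le\alpha}s_\mu)$ for $\alpha>\gamma$; $\epsilon_{0N}(\mathbf s)=\exp(-i\pi\sum_{\mu=1}^Ns_\mu)$. **Fermions.** The Clifford algebra $\mathcal A$ is generated by $\psi_j^{(\alpha)},\psi_j^{*(\alpha)}$ ($\alpha=1,\dots,N$, $j\in\mathbb Z$) with $[\psi^{(\alpha)}_j,\psi^{*(\beta)}_k]_+=\delta_{\alpha\beta}\delta_{jk}$, $[\psi^{(\alpha)}_j,\psi^{(\beta)}_k]_+=[\psi^{*(\alpha)}_j,\psi^{*(\beta)}_k]_+=0$. The Fock space $\mathcal F=\mathcal A|\mathbf 0\rangle$ and dual Fock space $\mathcal F^*=\langle\mathbf 0|\mathcal A$ are generated by vacua with $\psi_j^{(\alpha)}|\mathbf 0\rangle=0$ ($j<0$), $\psi_j^{*(\alpha)}|\mathbf 0\rangle=0$ ($j\ge0$), $\langle\mathbf 0|\psi_j^{(\alpha)}=0$ ($j\ge0$), $\langle\mathbf 0|\psi_j^{*(\alpha)}=0$ ($j<0$), and paired by $\langle\mathbf 0|\mathbf 0\rangle=1$. For $\mathbf s\in\mathbb Z^N$: $|\mathbf s\rangle=\Psi^{*(N)}_{s_N}\cdots\Psi^{*(2)}_{s_2}\Psi^{*(1)}_{s_1}|\mathbf 0\rangle$, $\langle\mathbf s|=\langle\mathbf 0|\Psi^{(1)}_{s_1}\Psi^{(2)}_{s_2}\cdots\Psi^{(N)}_{s_N}$,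 where $\Psi_s^{*(\alpha)}=\psi^{(\alpha)}_{s-1}\cdots\psi^{(\alpha)}_0$ for $s>0$, $1$ for $s=0$, $\psi^{*(\alpha)}_s\cdots\psi^{*(\alpha)}_{-1}$ for $s<0$; and $\Psi_s^{(\alpha)}=\psi^{*(\alpha)}_0\cdots\psi^{*(\alpha)}_{s-1}$ for $s>0$, $1$ for $s=0$, $\psi^{(\alpha)}_{-1}\cdots\psi^{(\alpha)}_s$ for $s<0$. **Currents.** For $k\ne0$, $J_k^{(\alpha)}=\sum_{j\in\mathbb Z}\psi_j^{(\alpha)}\psi^{*(\alpha)}_{j+k}$; $J(\mathbf t)=\sum_{\alpha}\sum_{k\ge1}t_{\alpha,k}J_k^{(\alpha)}$, $\bar J(\bar{\mathbf t})=\sum_\alpha\sum_{k\ge1}\bar t_{\alpha,k}J_{-k}^{(\alpha)}$. **Clifford group element.** $A^{(\alpha\beta)}_{jk}$ is an (in general infinite) complex matrix, assumed to be such that $g$ and all matrix elements of products of $g$ with fermionic operators and exponentials of currents used here are well defined (for instance, finitely many nonzero entries); functions of the times are treated as formal power series. *)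

(* Defs.v *)
From HB Require Import structures.
From mathcomp Require Import all_boot all_order all_algebra.
From mathcomp Require Import finmap multiset complex.
From mathcomp Require Import all_classical all_reals all_analysis.
From mathcomp Require Import summability.

Set Implicit Arguments.
Unset Strict Implicit.
Unset Printing Implicit Defensive.

Import Order.TTheory GRing.Theory Num.Theory numFieldNormedType.Exports.

Local Open Scope classical_set_scope.
Local Open Scope ring_scope.

#[global] Existing Instance totally_filter.

(* A monomial in variables indexed by V is a multiset over V. An element of
   [fser K V] is a formal series in the variables V and in z^{+-1}: its value
   at (m, n) is the coefficient of m * z^n. All sums below are sums of families
   that are finitely supported for each fixed coefficient when the operations
   are applied to the series of the hierarchy; [\sum_(i \in D)] is 0 on a family
   with infinite support. *)
Section FormalSeries.
Context {K : fieldType} {V : choiceType}.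

Definition fser := ({mset V}%mset * int)%type -> K.

Definition fmul (f g : fser) : fser := fun x =>
  \sum_(p \in [set p : ({mset V}%mset * int) * ({mset V}%mset * int) |
                (p.1.1 `+` p.2.1)%mset = x.1 /\ p.1.2 + p.2.2 = x.2])
    f p.1 * g p.2.

Definition fz (n : int) : fser := fun x => ((x.1 == mset0) && (x.2 == n))%:R.

Definition fvar (v : V) : fser :=
  fun x => ((x.1 == [mset v]%mset) && (x.2 == 0))%:R.

Definition fpow (f : fser) (n : nat) : fser := iter n (fmul f) (fz 0).

Definition fexp (f : fser) : fser :=
  fun x => \sum_(n \in [set: nat]) fpow f n x / n`!%:R.

Definition fmon {U : choiceType} (phi : U -> fser) (m : {mset U}%mset) : fser :=
  \big[fmul/fz 0]_(u <- finsupp m) fpow (phi u) (m u).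

(* substitution of phi and psi for the two groups of variables of a formal
   power series F *)
Definition fsubst {U : choiceType} (phi psi : U -> fser)
    (F : {mset U}%mset -> {mset U}%mset -> K) : fser :=
  fun x => \sum_(p \in [set: {mset U}%mset * {mset U}%mset])
    F p.1 p.2 * fmul (fmon phi p.1) (fmon psi p.2) x.

End FormalSeries.
Arguments fser : clear implicits.

(* exp(sum_u x_u L_u) w, for endomorphisms L_u of W and formal variables x_u, as
   a formal power series in x with coefficients in W. [actser] is the action of
   sum_u x_u L_u on such series. *)
Section ExpAction.
Context {K : fieldType} {W : lmodType K} {U : choiceType}.
Variable L : U -> W -> W.

Definition actser (F : {mset U}%mset -> W) : {mset U}%mset -> W := fun m =>
  \sum_(p \in [set p : U * {mset U}%mset | ([mset p.1] `+` p.2)%mset = m])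
    L p.1 (F p.2).

Definition expact (w : W) : {mset U}%mset -> W := fun m =>
  \sum_(n \in [set: nat])
    n`!%:R^-1 *: iter n actser (fun m' => if m' == mset0 then w else 0) m.

End ExpAction.

(* (alpha, k) is the index of the time t_{alpha,k+1}. *)
Definition tidx (N : nat) := ('I_N * nat)%type.

Definition shift {N : nat} (s : 'I_N -> int) (c : int) (g : 'I_N) : 'I_N -> int :=
  fun mu => s mu + (mu == g)%:R * c.

Section TodaHierarchy.
Context {R : realType} {N : nat}.
Implicit Types (a b g : 'I_N) (s : 'I_N -> int).

Definition expi (x : R) : R[i] := (cos x +i* sin x)%C.

Definition eps a g : R[i] := if (a <= g)%N then 1 else -1.

Definition eps_s a g s : R[i] :=
  if (a <= g)%N
  then expi (- (pi * (\sum_(mu < N | (a < mu <= g)%N) s mu)%:~R))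
  else - expi (pi * (\sum_(mu < N | (g < mu <= a)%N) s mu)%:~R).

Definition eps0N s : R[i] := expi (- (pi * (\sum_(mu < N) s mu)%:~R)).

(* The four groups of times t, tbar, t', tbar': in (p, b, i), p tells whether
   the time is primed and b whether it is barred. *)
Definition tvar := (bool * bool * tidx N)%type.

Definition times (p b : bool) : tidx N -> fser R[i] tvar :=
  fun i => fvar (p, b, i).

(* times + c [z^{-1}]_g *)
Definition times_shift (p b : bool) (c : R[i]) g : tidx N -> fser R[i] tvar :=
  fun i x => times p b i x
    + c * (i.1 == g)%:R / i.2.+1%:R * fz (- i.2.+1%:Z) x.

(* xi(t_g - t'_g, z), resp. xi(tbar_g - tbar'_g, z) *)
Definition xi_diff (b : bool) g : fser R[i] tvar := fun x =>
  \sum_(k \in [set: nat])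
    fmul (times false b (g, k) \- times true b (g, k)) (fz k.+1%:Z) x.

Definition oint (f : fser R[i] tvar) : {mset tvar}%mset -> R[i] :=
  fun m => (0 +i* (2 * pi))%C * f (m, -1).

Definition toda_tau
    (tau : 'I_N -> 'I_N -> ('I_N -> int) ->
           {mset tidx N}%mset -> {mset tidx N}%mset -> R[i]) : Prop :=
  forall a b s s' (m : {mset tvar}%mset),
  \sum_(g < N) eps_s a g s * (eps_s b g s')^-1 *
    oint (fmul (fz (s g - s' g + (a == g)%:R + (b == g)%:R - 2))
         (fmul (fexp (xi_diff false g))
         (fmul (fsubst (times_shift false false (-1) g) (times false true)
                       (tau a g s))
               (fsubst (times_shift true false 1 g) (times true true)
                       (tau g b s'))))) m
  = - \sum_(g < N) eps a g * eps b g * eps_s a g s * eps0N s *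
        (eps_s b g s')^-1 * (eps0N s')^-1 *
    oint (fmul (fz (s' g - s g - 2))
         (fmul (fexp (xi_diff true g))
         (fmul (fsubst (times false false) (times_shift false true (-1) g)
                       (tau a g (shift s 1 g)))
               (fsubst (times true false) (times_shift true true 1 g)
                       (tau g b (shift s' (-1) g)))))) m.

End TodaHierarchy.

(* The Clifford algebra with its Fock space (a left module) and dual Fock space
   (a right module). The relations determine the whole structure up to
   isomorphism. *)
Record clifford_fock (R : realType) (N : nat) := CliffordFock {
  clif : algType R[i];
  psi : 'I_N -> int -> clif;
  psis : 'I_N -> int -> clif;
  psi_psis : forall a b j k,
    psi a j * psis b k + psis b k * psi a j = ((a == b) && (j == k))%:R;
  psi_psi : forall a b j k, psi a j * psi b k + psi b k * psi a j = 0;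
  psis_psis : forall a b j k, psis a j * psis b k + psis b k * psis a j = 0;
  clif_gen : forall P : set clif,
    (forall a j, P (psi a j)) -> (forall a j, P (psis a j)) -> P 1 ->
    (forall c x y, P x -> P y -> P (c *: x + y)) ->
    (forall x y, P x -> P y -> P (x * y)) -> forall x, P x;

  fock : lmodType R[i];
  lact : clif -> fock -> fock;
  lact_linear : forall x, linear (lact x);
  lact_linearl : forall v, linear (lact^~ v);
  lact1 : forall v, lact 1 v = v;
  lactM : forall x y v, lact (x * y) v = lact x (lact y v);
  vac : fock;
  fock_gen : forall v, exists x, v = lact x vac;
  psi_vac : forall a j, j < 0 -> lact (psi a j) vac = 0;
  psis_vac : forall a j, 0 <= j -> lact (psis a j) vac = 0;

  dual : lmodType R[i];
  ract : dual -> clif -> dual;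
  ract_linear : forall u, linear (ract u);
  ract_linearl : forall x, linear (ract^~ x);
  ract1 : forall u, ract u 1 = u;
  ractM : forall x y u, ract u (x * y) = ract (ract u x) y;
  dvac : dual;
  dual_gen : forall u, exists x, u = ract dvac x;
  dvac_psi : forall a j, 0 <= j -> ract dvac (psi a j) = 0;
  dvac_psis : forall a j, j < 0 -> ract dvac (psis a j) = 0;

  pairing : dual -> fock -> R[i];
  pairing_linear : forall u, scalar (pairing u);
  pairing_linearl : forall v, scalar (pairing^~ v);
  pairing_act : forall u x v, pairing (ract u x) v = pairing u (lact x v);
  pairing_vac : pairing dvac vac = 1
}.

Section TauFunction.
Context {R : realType} {N : nat} (F : clifford_fock R N).
Implicit Types (a b : 'I_N) (s : 'I_N -> int) (u : dual F) (v : fock F).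

Local Notation psi := (psi F).
Local Notation psis := (psis F).

(* Psi^{*(a)}_n *)
Definition Psis a (n : int) : clif F :=
  match n with
  | Posz p => \prod_(i < p) psi a (p%:Z - 1 - i%:Z)
  | Negz p => \prod_(i < p.+1) psis a (n + i%:Z)
  end.

(* Psi^{(a)}_n *)
Definition Psi a (n : int) : clif F :=
  match n with
  | Posz p => \prod_(i < p) psis a i%:Z
  | Negz p => \prod_(i < p.+1) psi a (- 1 - i%:Z)
  end.

Definition ket s : fock F :=
  lact (\prod_(mu < N) Psis (rev_ord mu) (s (rev_ord mu))) (vac F).

Definition bra s : dual F := ract (dvac F) (\prod_(mu < N) Psi mu (s mu)).

(* The currents J_k^{(a)}, k <> 0, act on the Fock space and on the dual Fock
   space: on each vector only finitely many terms do not vanish. *)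
Definition Jl a (k : int) v : fock F :=
  \sum_(j \in [set: int]) lact (psi a j * psis a (j + k)) v.

Definition Jr a (k : int) u : dual F :=
  \sum_(j \in [set: int]) ract u (psi a j * psis a (j + k)).

(* <u| e^{J(t)} and e^{-Jbar(tbar)} |v> *)
Definition braJ u : {mset tidx N}%mset -> dual F :=
  expact (fun i u' => Jr i.1 i.2.+1%:Z u') u.

Definition Jket v : {mset tidx N}%mset -> fock F :=
  expact (fun i v' => - Jl i.1 (- i.2.+1%:Z) v') v.

Variable A : 'I_N -> 'I_N -> int -> int -> R[i].

Definition bilin (S : {fset ('I_N * int) * ('I_N * int)}) : clif F :=
  \sum_(p <- S) A p.1.1 p.2.1 p.1.2 p.2.2 *:
    (psis p.1.1 p.1.2 * psi p.2.1 p.2.2).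

(* <u| exp(X) |v> = sum_n <u| X^n |v> / n!; this converges for X = bilin S *)
Definition exp_mx (X : clif F) u v : R[i] :=
  limn (series (fun n : nat =>
    n`!%:R^-1 * pairing u (lact (X ^+ n) v) : R[i]^o)).

(* g is given by its matrix elements <u| g |v> between the dual Fock space and
   the Fock space, the (in general infinite) sum over j, k being the
   unconditional limit of the partial sums over finite sets of indices. *)
Definition g_mx u v : R[i] :=
  lim ((fun S => exp_mx (bilin S) u v : R[i]^o) @ totally).

Definition g_defined : Prop :=
  forall u v, cvg ((fun S => exp_mx (bilin S) u v : R[i]^o) @ totally).

(* tau_{ab}(s, t, tbar): the value at (m, m') is the coefficient of the monomial
   m in t and m' in tbar. *)
Definition tau a b s : {mset tidx N}%mset -> {mset tidx N}%mset -> R[i] :=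
  fun m m' =>
    let n := \sum_(mu < N) s mu in
    (-1) ^ (n * (n - 1) %/ 2)%Z *
    g_mx (braJ (bra (shift (shift s 1 a) (-1) b)) m) (Jket (ket s) m').

End TauFunction.

Lemma g_defined_fin (R : realType) (N : nat) (F : clifford_fock R N)
    (A : 'I_N -> 'I_N -> int -> int -> R[i])
    (S0 : {fset ('I_N * int) * ('I_N * int)}) :
  (forall a b j k, ((a, j), (b, k)) \notin S0 -> A a b j k = 0) ->
  g_defined F A.
Proof.
move=> A0 u v; apply/cvg_ex; exists (exp_mx (bilin F A S0) u v : R[i]^o).
apply: cvg_near_cst; exists S0 => // T /= S0T; congr (exp_mx _ u v).
apply/esym; rewrite /bilin; apply: big_fset_incl => // -[[a j] [b k]] _ h.
by rewrite /= A0 ?scale0r.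
Qed.

(* [clifford_fock] is inhabited: the Fock space is realized in the functions on
   finite sets of modes, those in which a state differs from the vacuum. *)
Module FockModel.
Section Model.
Context {R : realType} {N : nat}.

Local Notation mode := ('I_N * int)%type.
Local Notation C := R[i].
Local Notation Fn := ({fset mode} -> C^o).

Definition tog (i : mode) (E : {fset mode}) : {fset mode} :=
  (if i \in E then E `\ i else i |` E)%fset.

Definition sgnb (j i : mode) : C := if (choice.pickle j < choice.pickle i)%N then -1 else 1.

Definition sgn (i : mode) (E : {fset mode}) : C := \prod_(j <- E) sgnb j i.

(* creation (b = true) and annihilation (b = false) of i *)
Definition op (b : bool) (i : mode) (v : Fn) : Fn :=
  fun E => if (i \in E) == b then sgn i E * v (tog i E) else 0.

Lemma in_tog i j E : (j \in tog i E) = (j == i) (+) (j \in E).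
Proof.
rewrite /tog; case: ifP => iE; rewrite !inE; case: eqP => [->|_] //=.
- by rewrite iE.
- by rewrite iE.
Qed.

Lemma togK i E : tog i (tog i E) = E.
Proof. by apply/fsetP => j; rewrite !in_tog addbA addbb. Qed.

Lemma togC i j E : tog i (tog j E) = tog j (tog i E).
Proof. by apply/fsetP => k; rewrite !in_tog addbCA. Qed.

Lemma sgnb2 i j : sgnb j i * sgnb j i = 1.
Proof. by rewrite /sgnb; case: ifP; rewrite ?mulrNN mulr1. Qed.

Lemma sgn_tog i j E : sgn j (tog i E) = sgnb i j * sgn j E.
Proof.
rewrite /sgn /tog; case: ifP => iE; last by rewrite big_fsetU1 ?iE.
by rewrite [in RHS](big_fsetD1 i) //= mulrA sgnb2 mul1r.
Qed.

Lemma sgn2 i E : sgn i E * sgn i E = 1.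
Proof. by rewrite /sgn -big_split big1 //= => j _; exact: sgnb2. Qed.

Lemma sgnb_id i : sgnb i i = 1.
Proof. by rewrite /sgnb ltnn. Qed.

Lemma sgnbC i j : i != j -> sgnb i j + sgnb j i = 0.
Proof.
move=> ij; rewrite /sgnb; case: ltngtP => [||/(pcan_inj choice.pickleK)] //.
- by rewrite addNr.
- by rewrite addrN.
- by move=> e; rewrite e eqxx in ij.
Qed.

Lemma op_car b c i j v :
  op b i (op c j v) + op c j (op b i v) = ((i == j) && (b != c))%:R *: v.
Proof.
apply/funext => E; rewrite [LHS]/GRing.add /= [RHS]/GRing.scale /= /op !in_tog.
have [<-|ij] := eqVneq i j; last first.
  rewrite /= scale0r togC !sgn_tog.
  case: eqP => bE; case: eqP => cE; rewrite ?mulr0 ?addr0 //.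
  set w := v _; transitivity ((sgnb i j + sgnb j i) * (sgn i E * sgn j E * w)).
    rewrite mulrDl; congr (_ + _); first by rewrite !mulrA (mulrC (sgn i E)).
    by rewrite !mulrA (mulrC (sgn j E)) -!mulrA (mulrCA (sgn j E)).
  by rewrite sgnbC // mul0r.
rewrite togK !sgn_tog sgnb_id mul1r /=.
case: (i \in E) b c => [] [] [];
  by rewrite /= ?scale0r ?scale1r ?mulr0 ?addr0 ?add0r // mulrA sgn2 mul1r.
Qed.

Lemma op_linear b i : linear (op b i).
Proof.
move=> k u v; apply/funext => E.
rewrite /op [RHS]/GRing.add /= [in RHS]/GRing.scale /=.
case: ifP => _; last by rewrite scaler0 addr0.
by rewrite [X in _ * X]/GRing.add /= [in LHS]/GRing.scale /= mulrDr scalerAr.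
Qed.

Inductive gen : (Fn -> Fn) -> Prop :=
| gen_op b i : gen (op b i)
| gen_id : gen id
| gen_lin k f g : gen f -> gen g -> gen (k *: f + g)
| gen_comp f g : gen f -> gen g -> gen (f \o g).

Lemma gen_linear f : gen f -> linear f.
Proof.
elim=> [b i|//|k f1 f2 _ h1 _ h2|f1 f2 _ h1 _ h2] a u v.
- exact: op_linear.
- have E w : (k *: f1 + f2) w = k *: f1 w + f2 w by [].
  rewrite !E h1 h2 !scalerDr !scalerA (mulrC k) -!addrA; congr (_ + _).
  by rewrite addrCA.
- by rewrite /= h2 h1.
Qed.

Definition genp : {pred Fn -> Fn} := fun f => `[< gen f >].

Lemma genp_submod : submod_closed genp.
Proof.
split=> [|k f g /asboolP hf /asboolP hg]; apply/asboolP; last exact: gen_lin.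
have -> : 0 = (-1) *: id + id :> (Fn -> Fn) by rewrite scaleN1r addNr.
by apply: gen_lin; exact: gen_id.
Qed.
HB.instance Definition _ := GRing.isSubmodClosed.Build C (Fn -> Fn) genp genp_submod.

Record alg := Alg { alg_val :> Fn -> Fn; alg_valP : alg_val \in genp }.
HB.instance Definition _ := [isSub for alg_val].
HB.instance Definition _ := [Choice of alg by <:].
HB.instance Definition _ := [SubChoice_isSubLmodule of alg by <:].

Lemma algP (x : alg) : gen x. Proof. exact/asboolP/alg_valP. Qed.
Lemma algE (x y : alg) : (forall v, x v = y v) -> x = y.
Proof. by move=> e; apply: val_inj; apply/funext. Qed.
Lemma alg_linear (x : alg) : linear x. Proof. exact/gen_linear/algP. Qed.

Definition mk f (h : gen f) : alg := Alg (asboolT h).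

Definition aone : alg := mk gen_id.
Definition amul (x y : alg) : alg := mk (gen_comp (algP x) (algP y)).

Lemma alg_lin k (x y : alg) v : (k *: x + y : alg) v = k *: x v + y v.
Proof. by []. Qed.
Lemma algD (x y : alg) v : (x + y : alg) v = x v + y v.
Proof. by []. Qed.
Lemma amulA : associative amul. Proof. by move=> x y z; apply: algE. Qed.
Lemma amul1l : left_id aone amul. Proof. by move=> x; apply: algE. Qed.
Lemma amul1r : right_id aone amul. Proof. by move=> x; apply: algE. Qed.
Lemma amulDl : left_distributive amul +%R.
Proof. by move=> x y z; apply: algE. Qed.
Lemma amulDr : right_distributive amul +%R.
Proof.
move=> x y z; apply: algE => v.
change (x (y v + z v) = x (y v) + x (z v)).
by have := alg_linear x 1 (y v) (z v); rewrite !scale1r.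
Qed.

Definition evac : Fn := fun E => (E == fset0)%:R.

Lemma aone_neq0 : aone != 0.
Proof.
apply/eqP => /(congr1 (fun x : alg => x evac fset0)).
by rewrite /= /evac eqxx => /eqP; rewrite oner_eq0.
Qed.

HB.instance Definition _ := GRing.Zmodule_isNzRing.Build alg
  amulA amul1l amul1r amulDl amulDr aone_neq0.

Lemma algM (x y : alg) v : (x * y) v = x (y v). Proof. by []. Qed.
Lemma scaleAl (k : C) (x y : alg) : k *: (x * y) = (k *: x) * y.
Proof. exact: algE. Qed.
HB.instance Definition _ := GRing.Lmodule_isLalgebra.Build C alg scaleAl.
Lemma alg0 (x : alg) : x 0 = 0.
Proof. by have := alg_linear x (-1) 0 0; rewrite !scaleN1r !addNr. Qed.
Lemma scaleAr (k : C) (x y : alg) : k *: (x * y) = x * (k *: y).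
Proof.
apply: algE => v.
by have := alg_linear x k (y v) 0; rewrite alg0 !addr0 => e; exact: esym e.
Qed.
HB.instance Definition _ := GRing.Lalgebra_isAlgebra.Build C alg scaleAr.

Definition fockp : {pred Fn} := fun v => `[< exists x : alg, v = x evac >].
Lemma fockp_submod : submod_closed fockp.
Proof.
split=> [|k f g /asboolP[x ->] /asboolP[y ->]]; apply/asboolP.
  by exists 0.
by exists (k *: x + y).
Qed.
HB.instance Definition _ := GRing.isSubmodClosed.Build C Fn fockp fockp_submod.
Record fockT := Fock { fock_val :> Fn; fock_valP : fock_val \in fockp }.
HB.instance Definition _ := [isSub for fock_val].
HB.instance Definition _ := [Choice of fockT by <:].
HB.instance Definition _ := [SubChoice_isSubLmodule of fockT by <:].

Lemma lactP (x : alg) (v : fockT) : x v \in fockp.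
Proof.
by have /asboolP[y ->] := fock_valP v; apply/asboolP; exists (x * y).
Qed.
Definition lact (x : alg) (v : fockT) : fockT := Fock (lactP x v).

Local Notation Dn := (Fn -> C^o).
Definition dualp : {pred Dn} :=
  fun u => `[< exists x : alg, u = fun v => x v fset0 >].
Lemma dualp_submod : submod_closed dualp.
Proof.
split=> [|k f g /asboolP[x ->] /asboolP[y ->]]; apply/asboolP.
  by exists 0.
by exists (k *: x + y).
Qed.
HB.instance Definition _ := GRing.isSubmodClosed.Build C Dn dualp dualp_submod.
Record dualT := Dual { dual_val :> Dn; dual_valP : dual_val \in dualp }.
HB.instance Definition _ := [isSub for dual_val].
HB.instance Definition _ := [Choice of dualT by <:].
HB.instance Definition _ := [SubChoice_isSubLmodule of dualT by <:].

Lemma dual_linear (u : dualT) : scalar u.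
Proof.
by have /asboolP[x ->] := dual_valP u; move=> k v w; rewrite alg_linear.
Qed.

Lemma ractP (u : dualT) (x : alg) : (fun v => u (x v)) \in dualp.
Proof.
by have /asboolP[y ->] := dual_valP u; apply/asboolP; exists (y * x).
Qed.
Definition ract (u : dualT) (x : alg) : dualT := Dual (ractP u x).

Lemma vacP : evac \in fockp. Proof. by apply/asboolP; exists 1. Qed.
Lemma dvacP : (fun v : Fn => v fset0 : C^o) \in dualp.
Proof. by apply/asboolP; exists 1. Qed.

Definition mpsi a (j : int) : alg := mk (gen_op (0 <= j) (a, j)).
Definition mpsis a (j : int) : alg := mk (gen_op (j < 0) (a, j)).

Lemma mk_car b c i j :
  mk (gen_op b i) * mk (gen_op c j) + mk (gen_op c j) * mk (gen_op b i) =
  ((i == j) && (b != c))%:R.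
Proof.
apply: algE => v; rewrite algD !algM /= op_car.
by case: (_ && _); rewrite ?scale1r ?scale0r.
Qed.

Lemma fockE (x y : fockT) : (x = y :> Fn) -> x = y.
Proof. exact: val_inj. Qed.
Lemma dualE (x y : dualT) : (x = y :> Dn) -> x = y.
Proof. exact: val_inj. Qed.

Lemma op_vac i : op false i evac = 0.
Proof.
apply/funext => E; rewrite /op; case: eqP => //= iE.
rewrite /evac; case: eqP => [e|_]; last by rewrite mulr0.
by have := in_tog i i E; rewrite e inE eqxx iE.
Qed.

Lemma model : clifford_fock R N.
Proof.
pose vac := Fock vacP; pose dvac := Dual dvacP.
unshelve refine (@CliffordFock R N alg mpsi mpsis _ _ _ _ fockT lact _ _ _ _ vac
  _ _ _ dualT ract _ _ _ _ dvac _ _ _ (fun u v => u (val v)) _ _ _ _).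
- move=> a b j k; rewrite mk_car xpair_eqE; congr (_%:R).
  congr nat_of_bool; case: (eqVneq a b) => //= _.
  by case: eqVneq => //= <-; rewrite leNgt; case: (_ < _).
- move=> a b j k; rewrite mk_car xpair_eqE.
  case: (eqVneq j k) => [->|]; last by rewrite andbF.
  by rewrite eqxx andbF.
- move=> a b j k; rewrite mk_car xpair_eqE.
  case: (eqVneq j k) => [->|]; last by rewrite andbF.
  by rewrite eqxx andbF.
- move=> P Pp Ps P1 Pl Pm x.
  suff H f : gen f -> forall h : gen f, P (mk h).
    have -> : x = mk (algP x) by exact: algE.
    by apply: H; exact: algP.
  elim=> [b [a j]||k f1 f2 h1 IH1 h2 IH2|f1 f2 h1 IH1 h2 IH2] h.
  + have [e|e] := eqVneq b (0 <= j).
      have -> : mk h = mpsi a j by apply: algE => v; rewrite /= e.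
      exact: Pp.
    have -> : mk h = mpsis a j; last exact: Ps.
    apply: algE => v /=; congr (op _ _ _).
    by move: e; rewrite leNgt; case: b {h}; case: (j < 0).
  + have -> : mk h = 1 by exact: algE.
    exact: P1.
  + have -> : mk h = k *: mk h1 + mk h2 by exact: algE.
    exact: Pl.
  + have -> : mk h = mk h1 * mk h2 by exact: algE.
    exact: Pm.
- by move=> x k u v; apply: fockE; exact: (alg_linear x k (val u) (val v)).
- by move=> v k x y; apply: fockE.
- by move=> v; apply: fockE.
- by move=> x y v; apply: fockE.
- by move=> v; have /asboolP[x e] := fock_valP v; exists x; apply: fockE.
- move=> a j j0; apply: fockE => /=.
  by rewrite leNgt j0 op_vac.
- move=> a j j0; apply: fockE => /=.
  by rewrite ltNge j0 op_vac.
- move=> u k x y; apply: dualE; apply/funext => v.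
  change (u (k *: x v + y v) = k * u (x v) + u (y v)).
  exact: (dual_linear u k (x v) (y v)).
- by move=> x k u v; apply: dualE.
- by move=> u; apply: dualE.
- by move=> x y u; apply: dualE.
- by move=> u; have /asboolP[x e] := dual_valP u; exists x; apply: dualE.
- by move=> a j j0; apply: dualE; apply/funext => v; rewrite /= /op j0 inE.
- by move=> a j j0; apply: dualE; apply/funext => v; rewrite /= /op j0 inE.
- by move=> u k v w; exact: (dual_linear u k (val v) (val w)).
- by move=> v k u w.
- by move=> u x v.
- by rewrite /= /evac eqxx.
Qed.

End Model.
End FockModel.

Lemma clifford_fock_exists (R : realType) (N : nat) :
  inhabited (clifford_fock R N).
Proof. by constructor; exact: FockModel.model. Qed.

(* Main.v *)
(* Both sides are coefficients of bilinear expressions in the fermionic fields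
   [psi_g(z)], [psi_g^*(z)]: the left one has them on the left of [g], between
   [<s + 1_a| e^J] and [<s' - 1_b| e^J'], the right one on the right of [g]. For
   zero times they agree because [sum psi (x) psi^*] commutes with [g (x) g],
   which follows from its commutation with [X (x) 1 + 1 (x) X], the Cauchy product
   of exponential series, and a limit over finite sets of entries of [A].
   Differentiating in a time inserts a current in both expressions alike, the
   terms from commuting it with the two fields and from [e^xi] cancelling; so the
   identity for all coefficients follows by induction on the monomial. Finally
   [psi_g(z)] applied to [<s|], resp. [|s>], is up to sign the shift of the times
   by [z^-1] for a neighbouring state (bosonization); both satisfy Newton's
   recursion in the powers of [z], so no explicit vertex operator is needed. *)

Require Import Defs.
From HB Require Import structures.
From mathcomp Require Import all_boot all_order all_algebra.
From mathcomp Require Import finmap multiset complex.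
From mathcomp Require Import all_classical all_reals all_analysis.
From mathcomp Require Import summability zify ring lra.

Set Implicit Arguments.
Unset Strict Implicit.
Unset Printing Implicit Defensive.

Import Order.TTheory GRing.Theory Num.Theory.

Local Open Scope classical_set_scope.
Local Open Scope ring_scope.

(** Only matrix elements of [g] exist, as limits over finite sets of entries, so nothing is phrased
    as an operator identity for [g]. The sum over modes must be finite before the limit is taken:
    for a finite set of entries the commutation needs a window containing all its modes, but the
    four vectors kill all but a fixed range of products, so one window independent of the set is
    enough. Currents are never moved across [g]; they act on dual vectors and on vectors separately.
    Hence the induction on the monomial concerns arbitrary vectors, while a field becomes a shift of
    times only at the charged states, where it has a definite leading mode. Derivatives appear as
    Euler operators, which multiply a coefficient by an exponent; in characteristic zero they
    determine a coefficient with nonzero exponent from smaller ones. At integral charges the phases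
    are signs, and those depending on the summation index cancel against the signs of fermionic
    reordering. The minus sign of the right side comes from the quadratic sign in front of tau. *)

Lemma mset_indD (U : choiceType) (P : {mset U}%mset -> Prop) :
  P mset0 -> (forall u m, P m -> P ([mset u] `+` m)%mset) -> forall m, P m.
Proof.
move=> P0 PD m; rewrite -(seq_mset_id m).
elim: (EnumMset.f m) => [|u s IH]; last by rewrite mset_cons; exact: PD.
by rewrite (_ : seq_mset [::] = mset0) //; apply/msetP => x; rewrite mset_seqE mset0E.
Qed.

(** * The ring of series bounded above in z *)

Section BoundedSeries.
Context {K : fieldType} {V : choiceType}.
Implicit Types (f g h : fser K V) (m : {mset V}%mset) (n k : int).

(* A condition under which the products of [fmul] are finite and associative; it
   allows unbounded negative powers of [z], as [xi_diff] and the shifts require. *)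
Definition zbounded : {pred fser K V} := fun f =>
  `[< forall m, exists B : int, forall m1 n,
        (m1 `<=` m)%mset -> B < n -> f (m1, n) = 0 >].

Lemma zbounded_zmod : zmod_closed zbounded.
Proof.
split=> [|f g /asboolP hf /asboolP hg]; apply/asboolP => m; first by exists 0.
have [B1 h1] := hf m; have [B2 h2] := hg m.
exists (Num.max B1 B2) => m1 n mm; rewrite gt_max => /andP[n1 n2].
by change (f (m1, n) - g (m1, n) = 0); rewrite h1 // h2 // subr0.
Qed.
HB.instance Definition _ := GRing.isZmodClosed.Build (fser K V) zbounded zbounded_zmod.

Record bser := Bser { bser_val :> ({mset V}%mset * int)%type -> K; bser_valP : bser_val \in zbounded }.
HB.instance Definition _ := [isSub for bser_val].
HB.instance Definition _ := [Choice of bser by <:].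
HB.instance Definition _ := [SubChoice_isSubZmodule of bser by <:].

Lemma finite_msubset m : finite_set [set m1 | (m1 `<=` m)%mset].
Proof.
elim/mset_indD: m => [|u m IH].
  by apply: (sub_finite_set _ (finite_set1 mset0)) => m1 /=; rewrite msubset0 => /eqP.
apply: (@sub_finite_set _ _ ([set m1 | (m1 `<=` m)%mset] `|`
   (msetD [mset u]%mset) @` [set m1 | (m1 `<=` m)%mset])); last first.
  by rewrite finite_setU; split=> //; exact: finite_image.
move=> m1 /= /msubsetP h; have [um|um] := boolP (u \in m1).
  right; exists (m1 `\ u)%mset; last exact: msetB1K.
  apply/msubsetP => x; have := h x; rewrite msetB1E mset1DE; lia.
left; apply/msubsetP => x; have := h x; rewrite mset1DE; have [->|_] := eqVneq x u.
  by rewrite (mset_eq0P um).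
by rewrite add0n.
Qed.

Definition box m (lo hi : int) : {fset {mset V}%mset * int} :=
  fset_set [set p : {mset V}%mset * int | (p.1 `<=` m)%mset /\ lo <= p.2 <= hi].

Lemma in_box m lo hi p : (p \in box m lo hi) = (p.1 `<=` m)%mset && (lo <= p.2 <= hi).
Proof.
rewrite /box in_fset_set; last first.
  have : finite_set [set n : int | lo <= n <= hi].
    apply: (@sub_finite_set _ _ ((fun i : nat => lo + i%:Z) @` `I_(`|hi - lo|.+1))).
      move=> n /= /andP[h1 h2]; exists `|n - lo|%N; last by lia.
      rewrite ltnS; lia.
    exact/finite_image/finite_II.
  move/(finite_setX (finite_msubset m)); apply: sub_finite_set.
  by move=> [a b].
by apply/idP/andP => [/set_mem//|?]; exact: mem_set.
Qed.

Definition exadd (b c : {mset V}%mset * int) := ((b.1 `+` c.1)%mset, b.2 + c.2).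

Lemma exaddC : commutative exadd.
Proof. by move=> b c; rewrite /exadd msetDC addrC. Qed.

Lemma exaddA : associative exadd.
Proof. by move=> b c d; rewrite /exadd /= msetDA addrA. Qed.

(** With an indicator over a square in place of the condition on pairs, sums can be exchanged and
    compared on a common set; [S] only has to catch the factors of nonzero products. *)
Lemma fmulE (S : {fset {mset V}%mset * int}) f g x :
  (forall b c, exadd b c = x -> f b != 0 -> g c != 0 -> b \in S /\ c \in S) ->
  fmul f g x = \sum_(b <- S) \sum_(c <- S) (exadd b c == x)%:R * (f b * g c).
Proof.
move=> hS; rewrite /fmul fsbig_mkcond.
rewrite (fsbigE [seq (b, c) | b <- S, c <- S]) //; first last.
- move=> [b c] _; rewrite /patch; case: ifPn => // /set_mem /= [e1 e2].
  have [->|fb] := eqVneq (f b) 0; first by rewrite mul0r.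
  have [->|gc] := eqVneq (g c) 0; first by rewrite mulr0.
  have /hS/(_ fb gc)[bS cS] : exadd b c = x by case: x e1 e2 {hS} => ? ? /= <- <-.
  by rewrite allpairs_f.
- by apply: allpairs_uniq => // -[? ?] [? ?] _ _ [-> ->].
under eq_bigl do rewrite in_setT.
rewrite big_allpairs; apply: eq_bigr => b _; apply: eq_bigr => c _.
rewrite /patch; case: ifPn => [/set_mem/=[e1 e2]|/negP h].
  by rewrite /exadd e1 e2 -surjective_pairing eqxx mul1r.
case: eqP => [e|_]; last by rewrite mul0r.
by case: h; rewrite -e; exact: mem_set.
Qed.

Lemma bserP (f : bser) m : exists B : int, forall m1 n,
  (m1 `<=` m)%mset -> B < n -> f (m1, n) = 0.
Proof. by have /asboolP := bser_valP f. Qed.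

Lemma msubDl m1 m2 m : (m1 `+` m2 = m)%mset -> (m1 `<=` m)%mset /\ (m2 `<=` m)%mset.
Proof. by move=> <-; split; apply/msubsetP => x; rewrite msetE2; lia. Qed.

Lemma fmul_zbounded (f g : bser) : fmul f g \in zbounded.
Proof.
apply/asboolP => m; have [B1 h1] := bserP f m; have [B2 h2] := bserP g m.
exists (B1 + B2) => m1 n mm Bn; rewrite /fmul fsbig1 // => -[[b1 b2] [c1 c2]] /= [e1 e2].
have [bm cm] := msubDl e1; have [Bb|Bb] := ltP B1 b2.
  by rewrite h1 ?mul0r //; exact: msubset_trans mm.
rewrite h2 ?mulr0 //; first exact: msubset_trans mm.
by rewrite -e2 in Bn; lia.
Qed.
Definition bmul (f g : bser) : bser := Bser (fmul_zbounded f g).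

Lemma zbounded1 f x0 : (forall x, x != x0 -> f x = 0) -> f \in zbounded.
Proof.
move=> hf; apply/asboolP => m; exists x0.2 => m1 n _ hn.
by apply: hf; apply: contraTneq hn => <-; rewrite ltxx.
Qed.

Lemma fz_zbounded k : (fz k : fser K V) \in zbounded.
Proof.
by apply: (@zbounded1 _ (mset0, k)) => -[m n]; rewrite /fz /= xpair_eqE => /negPf ->.
Qed.
Definition bz k : bser := Bser (fz_zbounded k).

Lemma fvar_zbounded v : (fvar v : fser K V) \in zbounded.
Proof.
by apply: (@zbounded1 _ ([mset v]%mset, 0)) => -[m n]; rewrite /fvar /= xpair_eqE => /negPf ->.
Qed.
Definition bvar v : bser := Bser (fvar_zbounded v).

Lemma bser_eqP (f g : bser) : (forall x, f x = g x) -> f = g.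
Proof. by move=> e; apply: val_inj; apply/funext. Qed.

Lemma bmulC : commutative bmul.
Proof.
move=> f g; apply: bser_eqP => x /=; rewrite /fmul.
rewrite (reindex_fsbig (fun p => (p.2, p.1)) [set p : ({mset V}%mset * int) * ({mset V}%mset * int) |
                (p.1.1 `+` p.2.1)%mset = x.1 /\ p.1.2 + p.2.2 = x.2]).
  by apply: eq_fsbigr => p _; rewrite mulrC.
split=> [[b c] /= [<- <-]|[b c] [b' c'] _ _ [-> ->]//|[b c] /= [e1 e2]].
  by rewrite msetDC addrC.
by exists (c, b) => //=; rewrite -e1 -e2 msetDC addrC.
Qed.

(** Three degrees at most [B] with sum at least [- B] are each at least [- 3 * B], and the inner
    exponent [exadd c d] has degree between [- 2 * B] and [2 * B]. One box therefore serves all the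
    sums, and the formula treats the three factors alike. *)
Lemma fmul_tripleE (f g h : bser) x (B : int) : 0 <= B -> `|x.2| <= B ->
  (forall m n, (m `<=` x.1)%mset -> f (m, n) != 0 -> n <= B) ->
  (forall m n, (m `<=` x.1)%mset -> g (m, n) != 0 -> n <= B) ->
  (forall m n, (m `<=` x.1)%mset -> h (m, n) != 0 -> n <= B) ->
  let S := box x.1 (- 3 * B) (3 * B) in
  fmul f (fmul g h) x = \sum_(b <- S) \sum_(c <- S) \sum_(d <- S)
    (exadd b (exadd c d) == x)%:R * (f b * g c * h d).
Proof.
move=> B0 xB hf hg hh S; have gh a n : (a `<=` x.1)%mset -> fmul g h (a, n) != 0 -> n <= 2 * B.
  move=> am; apply: contra_neqT; rewrite -ltNge => an.
  rewrite /fmul fsbig1 // => -[[c1 c2] [d1 d2]] /= [e1 e2].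
  have [cm dm] := msubDl e1; have cx := msubset_trans cm am; have dx := msubset_trans dm am.
  have [->|/(hg _ _ cx) c2B] := eqVneq (g (c1, c2)) 0; first by rewrite mul0r.
  have [->|/(hh _ _ dx) d2B] := eqVneq (h (d1, d2)) 0; first by rewrite mulr0.
  by exfalso; lia.
rewrite (@fmulE S); last first.
  move=> [b1 b2] [a1 a2]; rewrite {}/S; case: x xB hf hg hh gh => x1 x2 /= xB hf hg hh gh [e1 e2] fb ga.
  have [bm am] := msubDl e1; have := hf _ _ bm fb; have := gh _ _ am ga.
  rewrite !in_box /= bm am /=; lia.
apply: eq_bigr => b _.
transitivity (\sum_(a <- S) \sum_(c <- S) \sum_(d <- S)
    (exadd b a == x)%:R * ((exadd c d == a)%:R * (f b * g c * h d))).
  apply: eq_bigr => a _.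
  have [e|_] := eqVneq (exadd b a) x; last first.
    by rewrite mul0r big1 // => c _; rewrite big1 // => d _; rewrite mul0r.
  rewrite mul1r; have [->|fb] := eqVneq (f b) 0.
    by rewrite mul0r big1 // => c _; rewrite big1 // => d _; rewrite !mul0r !mulr0.
  rewrite (@fmulE S).
    rewrite mulr_sumr; apply: eq_bigr => c _; rewrite mulr_sumr; apply: eq_bigr => d _.
    by rewrite mul1r mulrCA !mulrA.
  rewrite {}/S; case: x b a e fb xB hf hg hh gh => x1 x2 [b1 b2] [a1 a2] [e1 e2] fb xB hf hg hh gh.
  move=> [c1 c2] [d1 d2] [e1' e2'] gc hd; have [bm am] := msubDl e1.
  have [cm dm] := msubDl e1'; have cx := msubset_trans cm am; have dx := msubset_trans dm am.
  have := hf _ _ bm fb; have := hg _ _ cx gc; have := hh _ _ dx hd.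
  rewrite !in_box /= cx dx /=; move: xB e2 e2' => /=; lia.
rewrite exchange_big; apply: eq_bigr => c _; rewrite exchange_big; apply: eq_bigr => d _ /=.
have [cdS|cdS] := boolP (exadd c d \in S).
  rewrite (big_fsetD1 _ cdS) /= eqxx mul1r big1_fset ?addr0 // => a.
  by rewrite in_fsetD1 eq_sym => /andP[/negPf-> _] _; rewrite mul0r mulr0.
transitivity (0 : K).
  apply: big1_seq => a /= aS; have [e|_] := eqVneq (exadd c d) a; last by rewrite mul0r mulr0.
  by rewrite e aS in cdS.
apply/esym; have [e|_] := eqVneq (exadd b _) x; last by rewrite mul0r.
have [->|fb] := eqVneq (f b) 0; first by rewrite !mul0r mulr0.
have [->|gc] := eqVneq (g c) 0; first by rewrite mulr0 !mul0r mulr0.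
have [->|hd] := eqVneq (h d) 0; first by rewrite !mulr0.
case/negP: cdS; rewrite {}/S; case: x b c d e fb gc hd xB hf hg hh gh.
move=> x1 x2 [b1 b2] [c1 c2] [d1 d2] [e1 e2] fb gc hd xB hf hg hh gh.
have [bm cdm] := msubDl e1; have [cm dm] := msubDl (erefl (c1 `+` d1)%mset).
have cx := msubset_trans cm cdm; have dx := msubset_trans dm cdm.
have := hf _ _ bm fb; have := hg _ _ cx gc; have := hh _ _ dx hd.
rewrite !in_box /= cdm /=; move: xB e2 => /=; lia.
Qed.

Lemma bmulA : associative bmul.
Proof.
(* Commutativity brings the right side to [bmul h (bmul f g)], so that both sides have the nesting
   of [fmul_tripleE]. *)
move=> f g h; rewrite [RHS]bmulC; apply: bser_eqP => x /=.
have [B1 h1] := bserP f x.1; have [B2 h2] := bserP g x.1; have [B3 h3] := bserP h x.1.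
pose B := `|B1| + `|B2| + `|B3| + `|x.2|.
have hf b n : (b `<=` x.1)%mset -> f (b, n) != 0 -> n <= B.
  by move=> bm; apply: contra_neqT; rewrite -ltNge => ?; apply: h1 => //; lia.
have hg b n : (b `<=` x.1)%mset -> g (b, n) != 0 -> n <= B.
  by move=> bm; apply: contra_neqT; rewrite -ltNge => ?; apply: h2 => //; lia.
have hh b n : (b `<=` x.1)%mset -> h (b, n) != 0 -> n <= B.
  by move=> bm; apply: contra_neqT; rewrite -ltNge => ?; apply: h3 => //; lia.
have B0 : 0 <= B by rewrite /B; lia.
have xB : `|x.2| <= B by rewrite /B; lia.
rewrite (fmul_tripleE B0 xB hf hg hh) (fmul_tripleE B0 xB hh hf hg).
rewrite [RHS]exchange_big; apply: eq_bigr => b _.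
rewrite [RHS]exchange_big; apply: eq_bigr => c _; apply: eq_bigr => d _.
by rewrite [exadd d _]exaddC exaddA; congr (_ * _); ring.
Qed.

Lemma fmul_box (f g : bser) x : exists B0 : int, forall B, B0 <= B ->
  fmul f g x = \sum_(b <- box x.1 (- B) B) \sum_(c <- box x.1 (- B) B)
    (exadd b c == x)%:R * (f b * g c).
Proof.
have [B1 h1] := bserP f x.1; have [B2 h2] := bserP g x.1.
exists (`|B1| + `|B2| + `|x.2|) => B hB; apply: fmulE.
case: x h1 h2 hB => x1 x2 /= h1 h2 hB [b1 b2] [c1 c2] [e1 e2] fb gc.
have [bm cm] := msubDl e1; rewrite !in_box /= bm cm /=.
have : b2 <= B1 by rewrite leNgt; apply: contra_neqN fb; exact: h1.
have : c2 <= B2 by rewrite leNgt; apply: contra_neqN gc; exact: h2.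
lia.
Qed.

Lemma bserD (f g : bser) x : (f + g) x = f x + g x. Proof. by []. Qed.
Lemma bserN (f : bser) x : (- f) x = - f x. Proof. by []. Qed.

Lemma bmulDl : left_distributive bmul +%R.
Proof.
move=> f g h; apply: bser_eqP => x; rewrite bserD /=.
have [B1 h1] := fmul_box f h x; have [B2 h2] := fmul_box g h x.
have [B3 h3] := fmul_box (f + g) h x; pose B := `|B1| + `|B2| + `|B3|.
rewrite (h1 B) 1?(h2 B) 1?(h3 B) /B; try lia.
rewrite -big_split; apply: eq_bigr => b _; rewrite -big_split; apply: eq_bigr => c _ /=.
by rewrite -mulrDr -mulrDl.
Qed.

Lemma fmul_fz k f x : fmul (fz k) f x = f (x.1, x.2 - k).
Proof.
case: x => m n; rewrite /fmul fsbig_mkcond.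
rewrite (fsbigTE [fset ((mset0, k), (m, n - k))]%fset) /=; last first.
  move=> [[b1 b2] [c1 c2]]; rewrite in_fset1 /= /patch; case: ifPn => // /set_mem /= [<- <-].
  rewrite /fz /= !xpair_eqE; have [->|_] := eqVneq b1 mset0; last by rewrite mul0r.
  have [->|_] := eqVneq b2 k; last by rewrite mul0r.
  by rewrite addrAC subrr add0r mset0D !eqxx.
rewrite big_seq_fset1 /patch mem_set /=; last by rewrite mset0D addrC subrK.
by rewrite /fz /= !eqxx mul1r.
Qed.

Lemma fmul_fvar v f x :
  fmul (fvar v) f x = if v \in x.1 then f ((x.1 `\ v)%mset, x.2) else 0.
Proof.
case: x => m n; rewrite /fmul fsbig_mkcond /=; case: ifPn => vm.
  rewrite (fsbigTE [fset (([mset v]%mset, 0), ((m `\ v)%mset, n))]%fset) /=; last first.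
    move=> [[b1 b2] [c1 c2]]; rewrite in_fset1 /= /patch; case: ifPn => // /set_mem /= [<- <-].
    rewrite /fvar /= !xpair_eqE; have [->|_] := eqVneq b1 _; last by rewrite mul0r.
    have [->|_] := eqVneq b2 0; last by rewrite mul0r.
    by rewrite add0r msetD1K !eqxx.
  rewrite big_seq_fset1 /patch mem_set /=; last by rewrite add0r msetB1K.
  by rewrite /fvar /= !eqxx mul1r.
rewrite fsbig1 // => -[[b1 b2] [c1 c2]] _; rewrite /patch; case: ifPn => // /set_mem /= [e _].
rewrite /fvar /=; have [b1E|_] := eqVneq b1 _; last by rewrite mul0r.
by rewrite -e b1E in_mset1D eqxx in vm.
Qed.

Lemma bmul1l : left_id (bz 0) bmul.
Proof. by move=> f; apply: bser_eqP => -[m n]; rewrite /= fmul_fz subr0. Qed.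

HB.instance Definition _ := GRing.Zmodule_isComPzRing.Build bser bmulA bmulC bmul1l bmulDl.

Lemma fvar_z (v : V) m n : n != 0 -> fvar v (m, n) = 0 :> K.
Proof. by rewrite /fvar /= => /negPf->; rewrite andbF. Qed.

Lemma fvar_m (v : V) m n : m != [mset v]%mset -> fvar v (m, n) = 0 :> K.
Proof. by rewrite /fvar /= => /negPf->. Qed.

Lemma fz_z k m n : n != k -> fz k (m, n) = 0 :> K.
Proof. by rewrite /fz /= => /negPf->; rewrite andbF. Qed.

Lemma fz_m k m n : m != mset0 -> fz k (m, n) = 0 :> K.
Proof. by rewrite /fz /= => /negPf->. Qed.

Lemma fzxx k : fz k (mset0 : {mset V}%mset, k) = 1 :> K.
Proof. by rewrite /fz /= !eqxx. Qed.

Lemma mset1_neq0 (v : V) : [mset v]%mset != mset0 :> {mset V}%mset.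
Proof. by apply/negP => /eqP/msetP/(_ v); rewrite mset0E msetnxx. Qed.

Lemma bser0E x : (0 : bser) x = 0. Proof. by []. Qed.
Lemma bser1E : (1 : bser) = bz 0. Proof. by []. Qed.
Lemma bsermulE (f g : bser) : f * g = fmul f g :> fser K V. Proof. by []. Qed.
Lemma bz_val k x : bz k x = fz k x. Proof. by []. Qed.
Lemma bvar_val v x : bvar v x = fvar v x. Proof. by []. Qed.
Lemma bserMnE (f : bser) (j : nat) x : (f *+ j) x = f x *+ j.
Proof. by elim: j => // j IH; rewrite !mulrS bserD IH. Qed.
Lemma bser_sumE (I : Type) (r : seq I) P (F : I -> bser) x :
  (\sum_(i <- r | P i) F i) x = \sum_(i <- r | P i) F i x.
Proof. by elim/big_rec2: _ => // i y1 y2 _ <-. Qed.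

Lemma bzE k (f : bser) x : (bz k * f) x = f (x.1, x.2 - k).
Proof. exact: fmul_fz. Qed.
Lemma bvarE v (f : bser) x :
  (bvar v * f) x = if v \in x.1 then f ((x.1 `\ v)%mset, x.2) else 0.
Proof. exact: fmul_fvar. Qed.

Lemma bzD k l : bz (k + l) = bz k * bz l.
Proof.
by apply: bser_eqP => -[m n]; rewrite bzE /= /fz /= subr_eq addrC.
Qed.

Lemma fmul_cfz c k f x : fmul (fun y => c * fz k y) f x = c * f (x.1, x.2 - k).
Proof.
rewrite -fmul_fz /fmul mulr_fsumr; apply: eq_fsbigr => p _; by rewrite mulrA.
Qed.

Lemma cfz_zbounded c k : (fun x => c * fz k x : K) \in zbounded.
Proof.
apply: (@zbounded1 _ (mset0, k)) => -[m n].
by rewrite /fz /= xpair_eqE => /negPf ->; rewrite mulr0.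
Qed.
Definition bcz c k : bser := Bser (cfz_zbounded c k).

Lemma bcz_val c k x : bcz c k x = c * fz k x. Proof. by []. Qed.

Lemma bczE c k (f : bser) x : (bcz c k * f) x = c * f (x.1, x.2 - k).
Proof. exact: fmul_cfz. Qed.

Section Derivation.
Variable w : {mset V}%mset * int -> K.

Lemma der_zbounded (f : bser) : (fun x => w x * f x) \in zbounded.
Proof.
apply/asboolP => m; have [B h] := bserP f m; exists B => m1 n mm Bn.
by rewrite h ?mulr0.
Qed.
(** For [w] an exponent this is an Euler operator, [v d/dv] or [z d/dz]. Unlike a partial derivative
    it does not move monomials, and additivity of [w] makes it a derivation. *)
Definition der (f : bser) : bser := Bser (der_zbounded f).

Lemma derE (f : bser) x : der f x = w x * f x. Proof. by []. Qed.

Hypothesis wD : forall b c, w (exadd b c) = w b + w c.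

Lemma derM (f g : bser) : der (f * g) = der f * g + f * der g.
Proof.
apply: bser_eqP => x; rewrite bserD derE /=.
have [B1 h1] := fmul_box (der f) g x; have [B2 h2] := fmul_box f (der g) x.
have [B3 h3] := fmul_box f g x; pose B := `|B1| + `|B2| + `|B3|.
rewrite (h1 B) 1?(h2 B) 1?(h3 B) /B; try lia.
rewrite mulr_sumr -big_split; apply: eq_bigr => b _.
rewrite mulr_sumr -big_split; apply: eq_bigr => c _ /=.
have [<-|_] := eqVneq (exadd b c) x; last by rewrite !mul0r mulr0 addr0.
by rewrite wD; ring.
Qed.

Lemma der1 : der 1 = 0.
Proof.
apply: bser_eqP => -[m n]; rewrite derE bser1E bser0E /= /fz /=.
have [->|] := eqVneq m mset0; last by rewrite mulr0.
have [->|] := eqVneq n 0; last by rewrite mulr0.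
by have := wD (mset0, 0) (mset0, 0); rewrite /exadd msetD0 addr0 => /esym/(canRL (addrK _)); rewrite subrr mulr1.
Qed.

End Derivation.

Definition homog (w : {mset V}%mset * int -> int) (d : int) (f : bser) :=
  forall x, f x != 0 -> w x = d.

Lemma homogM w d1 d2 (f g : bser) : (forall b c, w (exadd b c) = w b + w c) ->
  homog w d1 f -> homog w d2 g -> homog w (d1 + d2) (f * g).
Proof.
move=> wD hf hg x; apply: contra_neq_eq => /eqP xd; rewrite bsermulE /fmul fsbig1 //.
move=> [b c] [/= e1 e2]; have [->|/hf fb] := eqVneq (f b) 0; first by rewrite mul0r.
have [->|/hg gc] := eqVneq (g c) 0; first by rewrite mulr0.
by case: xd; rewrite -fb -gc -wD /exadd e1 e2 -surjective_pairing.
Qed.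

End BoundedSeries.

Lemma perm_msetD1 (U : choiceType) u (p : {mset U}%mset) :
  perm_eq ([mset u] `+` p)%mset (u :: EnumMset.f p).
Proof. by rewrite -{1}(seq_mset_id p) -mset_cons; exact: perm_eq_seq_mset. Qed.

Lemma size_msetD1 (U : choiceType) u (p : {mset U}%mset) :
  size ([mset u] `+` p)%mset = (size p).+1.
Proof. by rewrite (perm_size (perm_msetD1 u p)). Qed.

(** * Monomials in a family of series *)

Section Monomials.
Context {K : fieldType} {U V : choiceType}.
Variable phi : U -> @bser K V.

Definition bmon (p : {mset U}%mset) : bser := \prod_(u <- finsupp p) phi u ^+ p u.

Lemma fpowE (f : @bser K V) n : fpow f n = f ^+ n :> fser K V.
Proof. by elim: n => // n IH; rewrite /fpow /= -/(fpow f n) IH exprS. Qed.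

Lemma fmonE p : fmon phi p = bmon p :> fser K V.
Proof.
rewrite /fmon /bmon; elim: (finsupp p : seq U) => [|u s IH]; rewrite ?big_nil // !big_cons IH.
by rewrite fpowE.
Qed.

Lemma bmon_enum p : bmon p = \prod_(u <- p) phi u.
Proof. by rewrite big_mset. Qed.

Lemma bmon0 : bmon mset0 = 1.
Proof. by rewrite bmon_enum enum_mset0 big_nil. Qed.

Lemma bmonD1 u p : bmon ([mset u] `+` p)%mset = phi u * bmon p.
Proof. by rewrite !bmon_enum (perm_big _ (perm_msetD1 u p)) big_cons. Qed.

(** The list [s] only has to contain the variables of [p] that the derivation does not kill. Later
    instances use one variable, none, or the times of a single component. *)
Lemma der_bmon (w : {mset V}%mset * int -> K) (s : seq U) (p : {mset U}%mset) :
  (forall b c, w (exadd b c) = w b + w c) -> uniq s ->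
  (forall u, u \in p -> u \notin s -> der w (phi u) = 0) ->
  der w (bmon p) = \sum_(u <- s) (der w (phi u) * bmon (p `\ u)%mset) *+ p u.
Proof.
move=> wD us; elim/mset_indD: p => [|u p IH] hs.
  by rewrite bmon0 der1 // big1 // => u _; rewrite mset0E.
rewrite bmonD1 derM // IH => [|v vp vs]; last by apply: hs; rewrite // in_mset1D vp orbT.
have -> : \sum_(v <- s) (der w (phi v) * bmon (([mset u] `+` p) `\ v)%mset) *+ ([mset u] `+` p)%mset v =
  \sum_(v <- s) (der w (phi v) * bmon p) *+ (v == u) +
  \sum_(v <- s) phi u * ((der w (phi v) * bmon (p `\ v)%mset) *+ p v).
  rewrite -big_split; apply: eq_bigr => v _ /=; rewrite mset1DE mulrnDr; congr (_ + _).
    by have [->|] := eqVneq v u; rewrite ?mulr0n // msetD1K.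
  have [vp|vp] := boolP (v \in p); last by rewrite (mset_eq0P vp) !mulr0n mulr0.
  by rewrite -msetDBA ?msub1set // bmonD1 mulrCA mulrnAr.
rewrite mulr_sumr; congr (_ + _); have [us'|us'] := boolP (u \in s).
  rewrite (big_rem u) //= eqxx mulr1n big1_seq ?addr0 // => v /andP[_].
  by rewrite mem_rem_uniq // inE => /andP[/negPf-> _]; rewrite mulr0n.
rewrite hs ?in_mset1D ?eqxx // mul0r big1_seq // => v /= vs.
by rewrite (_ : v == u = false) ?mulr0n //; apply: contraNF us' => /eqP <-.
Qed.

Lemma homog_bmon w (k : U -> nat) (p : {mset U}%mset) : (forall b c, w (exadd b c) = w b + w c) ->
  (forall u, homog w (k u) (phi u)) -> homog w (\sum_(u <- p) k u)%N%:Z (bmon p).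
Proof.
move=> wD hk; elim/mset_indD: p => [|u p IH].
  rewrite bmon0 enum_mset0 big_nil => -[m n]; rewrite bser1E /= /fz /=.
  have [->|_] := eqVneq m mset0; last by rewrite eqxx.
  have [->|_] := eqVneq n 0; last by rewrite eqxx.
  by move=> _; have := wD (mset0, 0) (mset0, 0); rewrite /exadd msetD0 addr0 /=; lia.
by rewrite bmonD1 (perm_big _ (perm_msetD1 u p)) big_cons PoszD; exact: homogM.
Qed.

End Monomials.

Arguments bser_val : simpl never.

(** * Weighted degree of monomials *)

Section Weight.
Context {U : choiceType}.
Implicit Types (kap : U -> nat) (p q : {mset U}%mset).

Definition mweight kap p : nat := (\sum_(u <- p) kap u)%N.

Lemma mweight0 kap : mweight kap mset0 = 0%N.
Proof. by rewrite /mweight enum_mset0 big_nil. Qed.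

Lemma mweightD1 kap u p : mweight kap ([mset u] `+` p)%mset = (kap u + mweight kap p)%N.
Proof. by rewrite /mweight (perm_big _ (perm_msetD1 u p)) big_cons. Qed.

Lemma mweightD kap p q : mweight kap (p `+` q)%mset = (mweight kap p + mweight kap q)%N.
Proof.
elim/mset_indD: p => [|u p IH]; first by rewrite mset0D mweight0.
by rewrite -msetDA !mweightD1 IH addnA.
Qed.

Lemma mweight_sub kap p q : (p `<=` q)%mset -> (mweight kap p <= mweight kap q)%N.
Proof. by move=> pq; rewrite -(msetBDKC pq) mweightD leq_addr. Qed.

Lemma mem_mweight kap u p : u \in p -> (kap u <= mweight kap p)%N.
Proof. by move=> up; rewrite -(msetB1K up) mweightD1 leq_addr. Qed.

Lemma mweight_eq0 kap p : (forall u, 0 < kap u)%N -> mweight kap p = 0%N -> p = mset0.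
Proof.
move=> k0; have [->//|[u up]] := mset_0Vmem p; rewrite -(msetB1K up) mweightD1.
by have := k0 u; case: (kap u).
Qed.

Lemma finite_mweight kap D : (forall u, 0 < kap u)%N ->
  finite_set [set u | (kap u <= D)%N] -> finite_set [set p | (mweight kap p <= D)%N].
Proof.
move=> k0 fU; have [n nD] := ubnP D.
(* [D] stays fixed while [j] grows, so every step extends by letters of one finite alphabet, those
   of weight at most [D]; a letter raises the weight by at least one. *)
suff H j : finite_set [set p | (mweight kap p <= D)%N /\ (mweight kap p < j)%N].
  by apply: sub_finite_set (H D.+1) => p /= pD; rewrite ltnS.
elim: j => [|j IH]; first by apply: sub_finite_set (finite_set0 _) => p [].
apply: (@sub_finite_set _ _ ([set mset0] `|` [set ([mset x.1] `+` x.2)%mset | x in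
   [set u | (kap u <= D)%N] `*` [set p | (mweight kap p <= D)%N /\ (mweight kap p < j)%N]])).
  move=> p /= [pD pj]; have [->|[u up]] := mset_0Vmem p; first by left.
  right; exists (u, (p `\ u)%mset); last exact: msetB1K.
  have := mem_mweight kap up; have := k0 u.
  by move: pD pj; rewrite -{1 2 3}(msetB1K up) mweightD1 /=; lia.
rewrite finite_setU; split; first exact: finite_set1.
by apply: finite_image; apply: finite_setX.
Qed.

End Weight.

(** * Substitution of shifted times *)

Section Substitution.
Context {K : numFieldType} {N : nat}.
Local Notation V := (@tvar N).
Local Notation U := (tidx N).
Local Notation bs := (@bser K V).
Local Notation ser2 := ({mset U}%mset -> {mset U}%mset -> K).

(* The shift of the times [(p, b, _)] by [c [z^{-1}]_g]; [c = 0] is no shift. *)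
Definition tshift p b (c : K) g (u : U) : bs :=
  bvar (p, b, u) + bcz (c * (u.1 == g)%:R / u.2.+1%:R) (- u.2.+1%:Z).

(** The grading with [t_{a,k}] of degree [k] and [z] of degree [-1]. The shifted time
    [t_{a,k} + c z^-k / k] and the series [xi] are homogeneous for it, which is why infinite
    substitutions have finite coefficients. *)
Definition wexp (x : {mset V}%mset * int) : int :=
  (mweight (fun v : V => v.2.2.+1) x.1)%:Z - x.2.

Lemma wexpD b c : wexp (exadd b c) = wexp b + wexp c.
Proof. by rewrite /wexp /exadd /= mweightD PoszD opprD addrACA. Qed.

Lemma tshiftE p b c g u x : tshift p b c g u x =
  fvar (p, b, u) x + c * (u.1 == g)%:R / u.2.+1%:R * fz (- u.2.+1%:Z) x.
Proof. by []. Qed.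

Lemma homog_tshift p b c g u : homog wexp u.2.+1 (tshift p b c g u).
Proof.
move=> [m n]; rewrite tshiftE /wexp /=.
have [->|m1] := eqVneq m [mset (p, b, u)]%mset.
  rewrite fz_m ?mset1_neq0 // mulr0 addr0.
  have [->|n0] := eqVneq n 0; last by rewrite fvar_z // eqxx.
  by rewrite -[X in mweight _ X]msetD0 mweightD1 mweight0 addn0 subr0.
rewrite fvar_m // add0r; have [->|m0] := eqVneq m mset0; last first.
  by rewrite fz_m // mulr0 eqxx.
have [->|n0] := eqVneq n (- u.2.+1%:Z); last by rewrite fz_z // mulr0 eqxx.
by rewrite mweight0 sub0r opprK.
Qed.

Definition npos (f : bs) := forall x, 0 < x.2 -> f x = 0.

Lemma nposM f g : npos f -> npos g -> npos (f * g).
Proof.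
move=> hf hg [m n] /= n0; rewrite bsermulE /fmul fsbig1 // => -[[b1 b2] [c1 c2]] /= [_ e].
have [b0|b0] := ltP 0 b2; first by rewrite hf ?mul0r.
by rewrite hg ?mulr0 //=; lia.
Qed.

Lemma npos1 : npos 1.
Proof. by move=> [m n] n0; rewrite bser1E bz_val fz_z // gt_eqF. Qed.

Lemma npos_tshift p b c g u : npos (tshift p b c g u).
Proof.
move=> [m n] n0; rewrite tshiftE; rewrite /= in n0; rewrite fvar_z; last by rewrite gt_eqF.
rewrite fz_z ?mulr0 ?addr0 //; apply/negP => /eqP e.
by rewrite e oppr_gt0 in n0.
Qed.

Section OneSubstitution.
Variables (p : bool) (c1 c2 : K) (g : 'I_N).

Definition ph (b : bool) := tshift p b (if b then c2 else c1) g.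
Definition mono q1 q2 : bs := bmon (ph false) q1 * bmon (ph true) q2.

Definition sbst (F : ser2) : fser K V :=
  fsubst (fun u => bser_val (ph false u)) (fun u => bser_val (ph true u)) F.

Lemma sbstE F x : sbst F x = \sum_(q \in [set: {mset U}%mset * {mset U}%mset])
  F q.1 q.2 * mono q.1 q.2 x.
Proof.
rewrite /sbst /fsubst; apply: eq_fsbigr => q _.
by rewrite !fmonE.
Qed.

Definition wt (q : {mset U}%mset) := mweight (fun u : U => u.2.+1) q.

Lemma homog_mono q1 q2 : homog wexp (wt q1 + wt q2)%N (mono q1 q2).
Proof.
rewrite PoszD; apply: homogM; first exact: wexpD.
- by apply: homog_bmon; [exact: wexpD|move=> u; exact: homog_tshift].
- by apply: homog_bmon; [exact: wexpD|move=> u; exact: homog_tshift].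
Qed.

Lemma npos_bmon b q : npos (bmon (ph b) q).
Proof.
elim/mset_indD: q => [|u q IH]; first by rewrite bmon0; exact: npos1.
by rewrite bmonD1; apply: nposM => //; exact: npos_tshift.
Qed.

Lemma sbst_npos F x : 0 < x.2 -> sbst F x = 0.
Proof.
move=> x0; rewrite sbstE fsbig1 // => q _.
by rewrite (nposM (npos_bmon false _) (npos_bmon true _)) ?mulr0.
Qed.

Lemma finite_wt D : finite_set [set q : {mset U}%mset * {mset U}%mset | (wt q.1 + wt q.2 <= D)%N].
Proof.
have fU : finite_set [set q : {mset U}%mset | (wt q <= D)%N].
  apply: finite_mweight => //.
  apply: (@sub_finite_set _ _ ([set: 'I_N] `*` `I_D)) => [[a k]//=|].
  by apply: finite_setX => //; exact: finite_II.
by apply: sub_finite_set (finite_setX fU fU) => -[q1 q2] /=; lia.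
Qed.

(** By homogeneity only the [q] of weight exactly [wexp x] contribute. A bound instead of equality
    lets several series be summed over one finite set. *)
Lemma sbst_fin F x D : wexp x <= D%:Z ->
  sbst F x = \sum_(q \in [set q : {mset U}%mset * {mset U}%mset | (wt q.1 + wt q.2 <= D)%N])
  F q.1 q.2 * mono q.1 q.2 x.
Proof.
move=> xD; rewrite sbstE; apply/esym/fsbig_widen => //.
move=> q [_ /= h] /=. have [->|/homog_mono] := eqVneq (mono q.1 q.2 x) 0; first by rewrite mulr0.
by move=> e; case: h; rewrite -lez_nat -e.
Qed.

Lemma sbstD F G x : sbst (fun m1 m2 => F m1 m2 + G m1 m2) x = sbst F x + sbst G x.
Proof.
rewrite !(@sbst_fin _ x `|wexp x|); try lia.
rewrite -fsbig_split //=; last exact: finite_wt.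
by apply: eq_fsbigr => q _; rewrite mulrDl.
Qed.

Lemma sbstZ a F x : sbst (fun m1 m2 => a * F m1 m2) x = a * sbst F x.
Proof. by rewrite !sbstE mulr_fsumr; apply: eq_fsbigr => q _; rewrite mulrA. Qed.

Lemma sbst_const F : sbst F (mset0, 0) = F mset0 mset0.
Proof.
rewrite sbstE (fsbigTE [fset (mset0, mset0)]%fset) => [|[q1 q2]]; last first.
  rewrite in_fset1 xpair_eqE; have [->|/homog_mono] := eqVneq (mono q1 q2 (mset0, 0)) 0.
    by rewrite mulr0.
  rewrite /wexp /= mweight0 subrr => /esym/eqP; rewrite eqz_nat addn_eq0 => /andP[/eqP h1 /eqP h2].
  have k0 (u : U) : (0 < u.2.+1)%N by [].
  by rewrite (mweight_eq0 k0 h1) (mweight_eq0 k0 h2) !eqxx.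
by rewrite big_seq_fset1 /mono !bmon0 mulr1 bser1E bz_val fzxx mulr1.
Qed.

(** The formal partial derivative in the time [u], barred or not according to [b], on
    coefficients. *)
Definition dser (b : bool) (u : U) (F : ser2) : ser2 := fun m1 m2 =>
  if b then (m2 u).+1%:R * F m1 ([mset u] `+` m2)%mset
  else (m1 u).+1%:R * F ([mset u] `+` m1)%mset m2.

Definition msub1 (b : bool) (u : U) (q : {mset U}%mset * {mset U}%mset) :=
  if b then (q.1, (q.2 `\ u)%mset) else ((q.1 `\ u)%mset, q.2).

Definition mult (b : bool) (u : U) (q : {mset U}%mset * {mset U}%mset) : nat :=
  if b then q.2 u else q.1 u.

Definition madd1 (b : bool) (u : U) (q : {mset U}%mset * {mset U}%mset) :=
  if b then (q.1, ([mset u] `+` q.2)%mset) else (([mset u] `+` q.1)%mset, q.2).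

Lemma madd1K b u : cancel (madd1 b u) (msub1 b u).
Proof. by case: b => -[q1 q2]; rewrite /msub1 /madd1 /= msetD1K. Qed.

Lemma msub1K b u q : (0 < mult b u q)%N -> madd1 b u (msub1 b u q) = q.
Proof.
by case: b q => -[q1 q2]; rewrite /mult /msub1 /madd1 /= mset_gt0 => h; rewrite msetB1K.
Qed.

Lemma sum_dser b u F x :
  \sum_(q \in [set: {mset U}%mset * {mset U}%mset])
    (mult b u q)%:R * F q.1 q.2 * mono (msub1 b u q).1 (msub1 b u q).2 x
  = sbst (dser b u F) x.
Proof.
rewrite sbstE -(@fsbig_widen _ _ _ _ (range (madd1 b u))) //; last first.
  move=> q [_ /= nq]; suff -> : mult b u q = 0%N by rewrite !mul0r.
  apply/eqP/negPn/negP; rewrite -lt0n => h; case: nq; exists (msub1 b u q) => //.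
  exact: msub1K.
rewrite fsbig_image; last by move=> q q' _ _ /(can_inj (madd1K b u)).
apply: eq_fsbigr => q _; rewrite madd1K; congr (_ * _).
by rewrite /mult /madd1 /dser; case: b => /=; rewrite mset1DE eqxx.
Qed.

Definition vexp (v : V) (x : {mset V}%mset * int) : K := (x.1 v)%:R.

Lemma vexpD v b c : vexp v (exadd b c) = vexp v b + vexp v c.
Proof. by rewrite /vexp /exadd /= msetE2 natrD. Qed.

Lemma der_bvar v v' : der (vexp v) (bvar v') = if v == v' then bvar v else 0 :> bs.
Proof.
apply: bser_eqP => -[m n]; rewrite derE /vexp bvar_val.
have [->|mv] := eqVneq m [mset v']%mset; last first.
  by rewrite fvar_m // mulr0; case: eqP => // e; rewrite e bvar_val fvar_m.
by rewrite msetnE; case: eqVneq => [->|_]; rewrite ?mul0r // mul1r.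
Qed.

Lemma der_bcz_vexp v c k : der (vexp v) (bcz c k) = 0 :> bs.
Proof.
apply: bser_eqP => -[m n]; rewrite derE /vexp bcz_val /=.
have [->|m0] := eqVneq m mset0; first by rewrite mset0E mul0r.
by rewrite fz_m // !mulr0.
Qed.

Lemma derD (w : {mset V}%mset * int -> K) (f f' : bs) : der w (f + f') = der w f + der w f'.
Proof. by apply: bser_eqP => x; rewrite bserD !derE bserD mulrDr. Qed.

Lemma der_ph v b u : der (vexp v) (ph b u) = if v == (p, b, u) then bvar v else 0.
Proof. by rewrite /ph derD der_bcz_vexp addr0 der_bvar. Qed.

Lemma der_mono v q1 q2 : der (vexp v) (mono q1 q2) =
  if v.1.1 == p then (bvar v * mono (msub1 v.1.2 v.2 (q1, q2)).1 (msub1 v.1.2 v.2 (q1, q2)).2)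
                     *+ mult v.1.2 v.2 (q1, q2)
  else 0.
Proof.
case: v => -[p' b'] u'; rewrite /mono derM; last exact: vexpD.
have E b q : der (vexp (p', b', u')) (bmon (ph b) q) =
    if (p' == p) && (b' == b) then (bvar (p', b', u') * bmon (ph b) (q `\ u')%mset) *+ q u' else 0.
  have [/andP[/eqP-> /eqP->]|pb] := ifPn.
    rewrite (@der_bmon _ _ _ _ _ [:: u']) //; first by rewrite big_seq1 der_ph eqxx.
      exact: vexpD.
    move=> u _; rewrite inE der_ph => uu'; case: eqP => // -[e].
    by rewrite e eqxx in uu'.
  rewrite (@der_bmon _ _ _ _ _ [::]) //; first by rewrite big_nil.
    exact: vexpD.
  move=> u _ _; rewrite der_ph; case: eqP => // -[e1 e2 _].
  by rewrite e1 e2 !eqxx in pb.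
rewrite !E /msub1 /mult /=; case: (p' == p) => /=; last by rewrite mul0r mulr0 addr0.
case: b' {E} => /=; last by rewrite mulr0 addr0 mulrnAl mulrA.
by rewrite mul0r add0r mulrnAr mulrCA.
Qed.

(** The chain rule for the Euler operator of [v]. The shift does not involve the times, so the only
    substituted series that depends on [v] is the one for [v] itself, provided [v] belongs to the
    class [p]. *)
Lemma sbst_dvar F (v : V) (x : {mset V}%mset * int) : v \in x.1 ->
  (x.1 v)%:R * sbst F x = if v.1.1 == p then sbst (dser v.1.2 v.2 F) ((x.1 `\ v)%mset, x.2) else 0.
Proof.
move=> vx; rewrite sbstE mulr_fsumr.
transitivity (\sum_(q \in [set: {mset U}%mset * {mset U}%mset])
   F q.1 q.2 * der (vexp v) (mono q.1 q.2) x).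
  by apply: eq_fsbigr => q _; rewrite derE mulrCA.
case: eqP => vp; last first.
  by rewrite fsbig1 // => q _; rewrite der_mono; case: eqP => // _; rewrite mulr0.
rewrite -sum_dser; apply: eq_fsbigr => q _; rewrite der_mono vp eqxx bserMnE bvarE vx.
by rewrite -surjective_pairing -[in LHS]mulr_natl mulrA (mulrC (F _ _)).
Qed.

Definition zexp (x : {mset V}%mset * int) : K := x.2%:~R.

Lemma zexpD b c : zexp (exadd b c) = zexp b + zexp c.
Proof. by rewrite /zexp /exadd /= intrD. Qed.

Lemma der_zexp_ph b u : der zexp (ph b u) =
  bcz (- (if b then c2 else c1) * (u.1 == g)%:R) (- u.2.+1%:Z).
Proof.
rewrite /ph derD; have -> : der zexp (bvar (p, b, u)) = 0 :> bs.
  apply: bser_eqP => -[m n]; rewrite derE /zexp bvar_val /=.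
  have [->|n0] := eqVneq n 0; first by rewrite mul0r.
  by rewrite fvar_z // mulr0.
rewrite add0r; apply: bser_eqP => -[m n]; rewrite derE !bcz_val /zexp /=.
have [->|n0] := eqVneq n (- u.2.+1%:Z); last by rewrite fz_z // !mulr0.
rewrite mulrA; congr (_ * _); rewrite mulrNz -pmulrn mulrC mulrN divfK ?pnatr_eq0 //.
by rewrite mulNr.
Qed.

Definition coef (b : bool) := if b then c2 else c1.

Lemma der_zexp_bmon D b (q : {mset U}%mset) : (wt q <= D)%N ->
  der zexp (bmon (ph b) q) =
  \sum_(k < D) (bcz (- coef b) (- k.+1%:Z) * bmon (ph b) (q `\ (g, k : nat))%mset) *+ q (g, k : nat).
Proof.
move=> qD; rewrite (@der_bmon _ _ _ _ _ [seq (g, k) | k <- iota 0 D]); first last.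
- move=> u /(mem_mweight (fun u : U => u.2.+1)) uq us; rewrite der_zexp_ph.
  case: u uq us => a k /= uq us; have [e|_] := eqVneq a g; last first.
    by apply: bser_eqP => y; rewrite bcz_val mulr0 mul0r.
  case/negP: us; apply/mapP; exists k; last by rewrite e.
  by rewrite mem_iota /=; apply: leq_trans uq qD.
- by rewrite map_inj_uniq ?iota_uniq // => k k' [].
- exact: zexpD.
rewrite big_map -[X in iota 0 X]subn0 -/(index_iota 0 D) big_mkord.
by apply: eq_bigr => k _; rewrite der_zexp_ph eqxx mulr1.
Qed.

Lemma der_zexp_bmon0 b (q : {mset U}%mset) : coef b = 0 -> der zexp (bmon (ph b) q) = 0.
Proof.
move=> c0; rewrite (@der_bmon _ _ _ _ _ [::]) ?big_nil //; first exact: zexpD.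
move=> u _ _; rewrite der_zexp_ph -/(coef b) c0 oppr0 mul0r.
by apply: bser_eqP => y; rewrite bcz_val mul0r.
Qed.

Lemma zexp_mono b D q x : coef (~~ b) = 0 -> (wt q.1 + wt q.2 <= D)%N ->
  x.2%:~R * mono q.1 q.2 x =
  \sum_(k < D) - coef b * ((mult b (g, k : nat) q)%:R *
     mono (msub1 b (g, k : nat) q).1 (msub1 b (g, k : nat) q).2 (x.1, x.2 + k.+1%:Z)).
Proof.
case: q => q1 q2 c0 /= qD; have q1D := leq_trans (leq_addr _ _) qD.
have q2D := leq_trans (leq_addl _ _) qD.
rewrite -[LHS](derE zexp) /mono derM; last exact: zexpD.
case: b c0 => /= c0.
  rewrite (@der_zexp_bmon0 false _ c0) mul0r add0r (der_zexp_bmon _ q2D) mulr_sumr bser_sumE.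
  apply: eq_bigr => k _; rewrite /mult /msub1 /= mulrnAr bserMnE mulrCA bczE opprK.
  by rewrite -[LHS]mulr_natl mulrCA.
rewrite (@der_zexp_bmon0 true _ c0) mulr0 addr0 (der_zexp_bmon _ q1D) mulr_suml bser_sumE.
apply: eq_bigr => k _; rewrite /mult /msub1 /= (mulrnAl (bcz _ _ * _)) bserMnE -mulrA bczE opprK.
by rewrite -[LHS]mulr_natl mulrCA.
Qed.

(** [z d/dz] takes the shift [c z^-k / k] to [- c z^-k], so the denominators disappear and the chain
    rule gives plain time derivatives. Those of index beyond [D] exceed the available weight. *)
Lemma sbst_zexp b D F x : coef (~~ b) = 0 -> wexp x <= D%:Z ->
  x.2%:~R * sbst F x =
  - coef b * \sum_(k < D) sbst (dser b (g, k : nat) F) (x.1, x.2 + k.+1%:Z).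
Proof.
move=> c0 xD; rewrite (sbst_fin _ xD) mulr_fsumr.
under eq_fsbigr => q /set_mem /= qD.
  rewrite mulrCA (zexp_mono _ c0 qD) mulr_sumr.
  over.
rewrite fsbig_finite /=; last exact: finite_wt.
rewrite exchange_big mulr_sumr; apply: eq_bigr => k _ /=.
rewrite -sum_dser mulr_fsumr -fsbig_finite /=; last exact: finite_wt.
rewrite -[RHS](@fsbig_widen _ _ _ _ [set q | (wt q.1 + wt q.2 <= D)%N] setT) //.
  by apply: eq_fsbigr => q _; ring.
move=> q [_ /= h] /=; have [->|mq0] := eqVneq (mult b (g, k : nat) q) 0%N.
  by rewrite !mul0r mulr0.
set q' := msub1 _ _ _; have [->|/homog_mono e] := eqVneq (mono q'.1 q'.2 (x.1, x.2 + k.+1%:Z)) 0.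
  by rewrite !mulr0.
have qE : madd1 b (g, k : nat) q' = q by apply: msub1K; rewrite lt0n.
have wq : (wt q.1 + wt q.2 = k.+1 + (wt q'.1 + wt q'.2))%N.
  rewrite -qE /madd1 /wt; case: (b) => /=; rewrite mweightD1 /=.
    by rewrite addnCA.
  by rewrite addnA.
have xk : wexp (x.1, x.2 + k.+1%:Z) = wexp x - k.+1%:Z by rewrite /wexp /= opprD addrA.
by case: h; rewrite wq -lez_nat PoszD -e xk addrC subrK.
Qed.

(** For coefficient [1] this is Newton's relation [j h_j = sum_k p_k h_(j-k)]: the shift of times is
    [exp (sum_k z^-k d_k / k)], whose coefficients are the complete symmetric functions when the
    time derivatives [d_k] are taken as power sums. *)
Lemma sbst_vertex b F (j : nat) m : coef (~~ b) = 0 ->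
  j%:R * sbst F (m, - j%:Z) =
  coef b * \sum_(k < j) sbst (dser b (g, k : nat) F) (m, - (j - k.+1)%N%:Z).
Proof.
move=> c0; pose D := (j + `|wexp (m, - j%:Z)|)%N.
have xD : wexp (m, - j%:Z) <= D%:Z by rewrite /D; lia.
have := sbst_zexp F c0 xD; rewrite /= mulrNz mulNr mulNr => /oppr_inj.
rewrite -pmulrn => ->; congr (_ * _).
rewrite -(big_mkord xpredT (fun k => sbst (dser b (g, k) F) (m, - j%:Z + k.+1%:Z))).
rewrite -(big_mkord xpredT (fun k => sbst (dser b (g, k) F) (m, - (j - k.+1)%N%:Z))).
rewrite (big_cat_nat (n := j)) //=; last by rewrite leq_addr.
(* For [k >= j] the exponent [- j + k + 1] is positive, and a substituted series has no positive
   powers of [z]. *)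
have -> : \sum_(j <= k < D) sbst (dser b (g, k) F) (m, - j%:Z + k.+1%:Z) = 0.
  rewrite big_nat; apply: big1 => k /andP[jk _]; rewrite sbst_npos //=; lia.
rewrite addr0 !big_nat; apply: eq_bigr => k /andP[_ kj]; congr (sbst _ (_, _)).
lia.
Qed.

End OneSubstitution.
End Substitution.

(** * The factor [e^xi] *)

Section ExpXi.
Context {K : numFieldType} {N : nat}.
Local Notation V := (@tvar N).
Local Notation bs := (@bser K V).

Lemma derX (w : {mset V}%mset * int -> K) (f : bs) n :
  (forall b c, w (exadd b c) = w b + w c) ->
  der w (f ^+ n) = (f ^+ n.-1 * der w f) *+ n.
Proof.
move=> wD; elim: n => [|n IH]; first by rewrite expr0 der1.
rewrite exprS derM // IH mulrnAr mulrA -exprS mulrSr /=.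
case: n {IH} => [|n] /=; first by rewrite mulr0n add0r addr0 expr0 mul1r mulr1.
by rewrite addrC mulrC.
Qed.

Lemma derB (w : {mset V}%mset * int -> K) (f f' : bs) : der w (f - f') = der w f - der w f'.
Proof. by apply: bser_eqP => x; rewrite bserD bserN !derE bserD bserN mulrBr. Qed.

Definition wzero (f : fser K V) := forall x, f x != 0 -> wexp x = 0.

(** Weight zero makes the power of [z] equal to the weight of the monomial, which gives the required
    upper bound. *)
Lemma wzero_zbounded f : wzero f -> f \in zbounded.
Proof.
move=> hf; apply/asboolP => m; exists (mweight (fun v : V => v.2.2.+1) m)%:Z => m1 n mm hn.
apply/eqP/negPn/negP => /hf; rewrite /wexp /=.
have := mweight_sub (fun v : V => v.2.2.+1) mm; lia.
Qed.

Variables (b : bool) (g : 'I_N).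

Definition xi_term (k : nat) : bs := bvar (false, b, (g, k)) - bvar (true, b, (g, k)).

Definition xi_ser : fser K V := fun x =>
  \sum_(k \in [set: nat]) fmul ((fvar (false, b, (g, k)) : fser K V)
    \- (fvar (true, b, (g, k)) : fser K V)) (fz k.+1%:Z) x.

Lemma xi_serE x : xi_ser x = \sum_(k \in [set: nat]) xi_term k (x.1, x.2 - k.+1%:Z).
Proof.
apply: eq_fsbigr => k _; transitivity ((xi_term k * bz k.+1%:Z) x); first by [].
by rewrite mulrC bzE.
Qed.

Lemma xi_term_neq0 k x : xi_term k x != 0 ->
  x.2 = 0 /\ exists p, x.1 = [mset (p, b, (g, k))]%mset.
Proof.
case: x => m n; rewrite /xi_term bserD bserN !bvar_val => h.
have n0 : n = 0.
  by apply/eqP; apply: contraNT h => n0; rewrite !(fvar_z _ _ n0) subrr.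
split=> //; have [->|m1] := eqVneq m [mset (false, b, (g, k))]%mset; first by exists false.
have [->|m2] := eqVneq m [mset (true, b, (g, k))]%mset; first by exists true.
by rewrite (fvar_m _ m1) (fvar_m _ m2) subrr eqxx in h.
Qed.

Lemma xi_ser_neq0 x : xi_ser x != 0 -> wexp x = 0 /\ size x.1 = 1%N.
Proof.
rewrite xi_serE => h.
have [k _ /xi_term_neq0[/= h2 [p h1]]] :=
  @fsbigN1 _ _ _ unit _ _ (fun _ k => xi_term k (x.1, x.2 - k.+1%:Z)) tt h.
rewrite /wexp h1 -[X in mweight _ X]msetD0 -[in size _](msetD0 [mset (p, b, (g, k))]%mset).
rewrite mweightD1 mweight0 size_msetD1 size_mset0; split=> //=.
by rewrite addn0 -opprB h2 oppr0.
Qed.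

Definition bxi : bs := Bser (wzero_zbounded (fun x h => (xi_ser_neq0 h).1)).

Definition xi_sgn (v : V) : K :=
  if (v.1.2 == b) && (v.2.1 == g) then (if v.1.1 then -1 else 1) else 0.

Lemma der_bxi v : der (vexp v) bxi = bcz (xi_sgn v) v.2.2.+1%:Z * bvar v.
Proof.
apply: bser_eqP => x; rewrite derE bczE; transitivity (vexp v x * xi_ser x) => //.
rewrite xi_serE mulr_fsumr.
have E k : vexp v x * xi_term k (x.1, x.2 - k.+1%:Z) =
    ((v == (false, b, (g, k)))%:R - (v == (true, b, (g, k)))%:R) * bvar v (x.1, x.2 - k.+1%:Z).
  transitivity (der (vexp v) (xi_term k) (x.1, x.2 - k.+1%:Z)) => //.
  rewrite /xi_term derB !der_bvar bserD bserN mulrBl.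
  by congr (_ - _); case: eqP; rewrite ?mul1r ?mul0r.
under eq_fsbigr do rewrite E.
rewrite (fsbigTE [fset v.2.2]%fset) => [|k]; last first.
  rewrite in_fset1 => kv; case: eqP => [e|_]; first by rewrite e eqxx in kv.
  case: eqP => [e|_]; first by rewrite e eqxx in kv.
  by rewrite subrr mul0r.
rewrite big_seq_fset1; congr (_ * _); rewrite /xi_sgn; case: v {E} => -[p b'] [a k] /=.
rewrite !xpair_eqE eqxx andbT.
case: p; case: (b' == b); case: (a == g); rewrite /= ?subrr ?subr0 ?sub0r //.
Qed.

Definition sexp (x : {mset V}%mset * int) : int := (size x.1)%:Z.

Lemma sexpD c d : sexp (exadd c d) = sexp c + sexp d.
Proof.
rewrite /sexp /exadd /=; elim/mset_indD: (c.1) => [|u m IH].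
  by rewrite mset0D size_mset0 add0r.
by rewrite -msetDA !size_msetD1 intS IH [in RHS]intS addrA.
Qed.

Lemma homog_bxiX n : homog sexp n%:Z (bxi ^+ n).
Proof.
elim: n => [|n IH].
  move=> [m n]; rewrite expr0 bser1E bz_val /sexp /=; have [->|m0] := eqVneq m mset0.
    by rewrite size_mset0.
  by rewrite fz_m ?eqxx.
rewrite exprS intS; apply: homogM => //; first exact: sexpD.
by move=> x /xi_ser_neq0[_]; rewrite /sexp => ->.
Qed.

Lemma homog_bxiX0 n : homog wexp 0 (bxi ^+ n).
Proof.
elim: n => [|n IH].
  move=> [m n]; rewrite expr0 bser1E bz_val /wexp /=; have [->|m0] := eqVneq m mset0.
    have [->|n0] := eqVneq n 0; first by rewrite mweight0 subr0.
    by rewrite fz_z ?eqxx.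
  by rewrite fz_m ?eqxx.
rewrite exprS -[0]addr0; apply: homogM => //; first exact: wexpD.
by move=> x /xi_ser_neq0[].
Qed.

(** [xi] is linear in the times, so its [n]-th power only meets monomials with [n] letters and the
    exponential series reduces to one term. *)
Lemma fexp_xi x : fexp xi_ser x = (bxi ^+ size x.1) x / (size x.1)`!%:R.
Proof.
rewrite /fexp (fsbigTE [fset size x.1]%fset) => [|n]; last first.
  rewrite in_fset1 => nx; transitivity ((bxi ^+ n) x / n`!%:R).
    by rewrite -(fpowE bxi).
  have [->|/homog_bxiX] := eqVneq ((bxi ^+ n) x) 0; first by rewrite mul0r.
  by rewrite /sexp => -[e]; rewrite e eqxx in nx.
by rewrite big_seq_fset1 -(fpowE bxi).
Qed.

Lemma fexp_xi_wzero : wzero (fexp xi_ser).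
Proof.
move=> x; rewrite fexp_xi => h; apply: (@homog_bxiX0 (size x.1)).
by apply: contraNneq h => ->; rewrite mul0r.
Qed.

Definition bexp_xi : bs := Bser (wzero_zbounded fexp_xi_wzero).

Lemma bexp_xi0 n : bexp_xi (mset0, n) = (n == 0)%:R.
Proof.
transitivity (fexp xi_ser (mset0, n)) => //.
rewrite fexp_xi size_mset0 expr0 bser1E bz_val divr1.
by case: eqVneq => [->|n0]; rewrite ?fzxx ?fz_z.
Qed.

Lemma bexp_xi_dvar (v : V) (x : {mset V}%mset * int) : v \in x.1 ->
  (x.1 v)%:R * bexp_xi x = xi_sgn v * bexp_xi ((x.1 `\ v)%mset, x.2 - v.2.2.+1%:Z).
Proof.
move=> vx; have sx : size x.1 = (size (x.1 `\ v)%mset).+1 by rewrite -(size_msetD1 v) msetB1K.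
transitivity (vexp v x * fexp xi_ser x) => //; transitivity (xi_sgn v * fexp xi_ser ((x.1 `\ v)%mset, x.2 - v.2.2.+1%:Z)) => //.
rewrite !fexp_xi sx /= mulrA -derE derX; last exact: vexpD.
rewrite /= der_bxi bserMnE mulrCA bczE (mulrC (bxi ^+ _)) bvarE vx factS natrM.
rewrite -[_ *+ _.+1]mulr_natl; field.
by rewrite nat1r !pnatr_eq0 -lt0n fact_gt0.
Qed.

Lemma bexp_xi_dser (v : V) : der (vexp v) bexp_xi = bcz (xi_sgn v) v.2.2.+1%:Z * (bvar v * bexp_xi).
Proof.
apply: bser_eqP => x; rewrite bczE bvarE derE.
have [vx|vx] := boolP (v \in x.1); first exact: bexp_xi_dvar.
by rewrite /vexp (mset_eq0P vx) mul0r mulr0.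
Qed.

End ExpXi.

(** * Exponentials of commuting operators *)

Section ExpAct.
Context {K : numFieldType} {W : lmodType K} {U : choiceType}.
Variable L : U -> W -> W.
Hypothesis L_lin : forall u, linear (L u).
Hypothesis L_comm : forall u u' w, L u (L u' w) = L u' (L u w).

Definition Lapp (s : seq U) w := foldr L w s.

Lemma L_0 u : L u 0 = 0.
Proof. by have := L_lin u (-1) 0 0; rewrite !scaleN1r !addNr. Qed.

Lemma L_scale u a w : L u (a *: w) = a *: L u w.
Proof. by have := L_lin u a w 0; rewrite L_0 !addr0. Qed.

Lemma Lapp_comm s u w : Lapp s (L u w) = L u (Lapp s w).
Proof. by elim: s => //= v s ->. Qed.

Lemma Lapp_perm s s' w : perm_eq s s' -> Lapp s w = Lapp s' w.
Proof.
elim: s s' => [|u s IH] s' ss'; first by rewrite perm_sym in ss'; move/perm_nilP: ss' => ->.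
have us' : u \in s' by rewrite -(perm_mem ss') inE eqxx.
case/splitPr: us' ss' => s1 s2; rewrite perm_sym -cat1s perm_catCA perm_cons perm_sym => /IH /= ->.
by rewrite /Lapp !foldr_cat /= -!/(Lapp _ _) Lapp_comm.
Qed.

Definition mfact (m : {mset U}%mset) : K := (\prod_(u <- finsupp m) (m u)`!)%:R.

Definition Lmset (m : {mset U}%mset) w := Lapp (EnumMset.f m) w.

Lemma Lmset_D1 u m w : Lmset ([mset u] `+` m)%mset w = L u (Lmset m w).
Proof. by rewrite /Lmset (Lapp_perm _ (perm_msetD1 u m)). Qed.

Lemma actserE (F : {mset U}%mset -> W) m :
  actser L F m = \sum_(u <- finsupp m) L u (F (m `\ u)%mset).
Proof.
rewrite /actser fsbig_mkcond (fsbigE [seq (u, (m `\ u)%mset) | u <- finsupp m]) //; first last.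
- move=> [u q] _; rewrite /patch; case: ifPn => // /set_mem /= e /negP[].
  apply/mapP; exists u; last by rewrite -e msetD1K.
  by rewrite msuppE -e in_mset1D eqxx.
- by rewrite map_inj_uniq // => u u' [].
under eq_bigl do rewrite in_setT.
rewrite big_map big_seq [RHS]big_seq; apply: eq_bigr => u; rewrite msuppE => um.
by rewrite /patch mem_set //= msetB1K.
Qed.

Lemma mfact_fset (S : {fset U}) m : (finsupp m `<=` S)%fset ->
  mfact m = (\prod_(u <- S) (m u)`!)%:R.
Proof.
move=> mS; congr (_%:R); apply: big_fset_incl => // u _.
by rewrite msuppE => /mset_eq0P->.
Qed.

Lemma mfact_neq0 m : mfact m != 0.
Proof. by rewrite /mfact pnatr_eq0 -lt0n; apply: prodn_gt0 => u; exact: fact_gt0. Qed.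

Lemma mfactD1 u m : mfact ([mset u] `+` m)%mset = (m u).+1%:R * mfact m.
Proof.
pose S := (u |` finsupp m)%fset; have uS : u \in S by rewrite fset1U1.
rewrite !(@mfact_fset S) ?fsubsetU1 //; last first.
  apply/fsubsetP => v; rewrite msuppE in_mset1D in_fset1U msuppE.
  by [].
rewrite !(big_fsetD1 u uS) /= mset1DE eqxx factS -!natrM mulnA; congr ((_ * _)%N%:R).
rewrite !big_seq; apply: eq_bigr => v; rewrite in_fsetD1 mset1DE => /andP[/negPf vu _].
by rewrite vu.
Qed.

Lemma mfact0 : mfact mset0 = 1.
Proof.
rewrite /mfact big1_seq // => u; rewrite msuppE; by rewrite in_mset0.
Qed.

(** The words of length [n] with multiset of letters [m] number [n! / mfact m], and by commutativity
    all of them act alike. *)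
Lemma iter_actserE w n m : iter n (actser L) (fun m' => if m' == mset0 then w else 0) m =
  if size m == n then (n`!%:R / mfact m) *: Lmset m w else 0.
Proof.
elim: n m => [|n IH] m.
  rewrite /= size_mset_eq0; case: eqP => // ->.
  by rewrite mfact0 divr1 scale1r /Lmset enum_mset0.
rewrite iterS actserE.
transitivity (\sum_(u <- finsupp m) if size m == n.+1 then
    (n`!%:R * (m u)%:R / mfact m) *: Lmset m w else 0).
  rewrite big_seq [RHS]big_seq; apply: eq_bigr => u; rewrite msuppE => um; rewrite IH.
  have [k kE] : exists k, (m `\ u)%mset = k by exists (m `\ u)%mset.
  rewrite kE -(msetB1K um) kE size_msetD1 eqSS; case: ifP => _; last exact: L_0.
  rewrite L_scale -Lmset_D1 mfactD1 mset1DE eqxx add1n; congr (_ *: _).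
  have k0 := mfact_neq0 k; field.
  by rewrite k0 nat1r pnatr_eq0.
have [e|_] := eqVneq (size m) n.+1; last by rewrite big1.
rewrite -scaler_suml -mulr_suml -mulr_sumr -natr_sum -size_mset e -natrM mulnC.
by rewrite factS.
Qed.

Lemma expactE w m : expact L w m = (mfact m)^-1 *: Lmset m w.
Proof.
rewrite /expact (fsbigTE [fset size m]%fset) => [|n]; last first.
  by rewrite in_fset1 iter_actserE eq_sym => /negPf->; rewrite scaler0.
rewrite big_seq_fset1 iter_actserE eqxx scalerA mulrA mulVf ?mul1r //.
Qed.

Lemma expact0 w : expact L w mset0 = w.
Proof. by rewrite expactE mfact0 invr1 scale1r /Lmset enum_mset0. Qed.

(** Differentiating the exponential in [x_u] inserts [L u], which by commutativity may act first.
    This is how a time derivative of a tau-function replaces a vector by its image under a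
    current. *)
Lemma expactD1 w u (m : {mset U}%mset) :
  (m u).+1%:R *: expact L w ([mset u] `+` m)%mset = expact L (L u w) m.
Proof.
rewrite !expactE mfactD1 scalerA invfM mulrA divff ?pnatr_eq0 // mul1r.
by rewrite Lmset_D1 /Lmset Lapp_comm.
Qed.

Lemma Lapp_lin s : linear (Lapp s).
Proof. by elim: s => // u s IH a w w'; rewrite /Lapp /= -!/(Lapp s _) IH L_lin. Qed.

Lemma expact_lin m : linear (expact L ^~ m).
Proof.
move=> a w w'; rewrite !expactE /Lmset Lapp_lin scalerDr !scalerA.
by rewrite mulrC.
Qed.

End ExpAct.

(** * Fields as shifts of times *)

Section VertexSeries.
Context {K : numFieldType} {N : nat}.
Local Notation V := (@tvar N).
Local Notation U := (tidx N).
Local Notation bs := (@bser K V).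
Local Notation ser2 := ({mset U}%mset -> {mset U}%mset -> K).
Implicit Types (f : ser2) (p b : bool) (c : K) (g : 'I_N).

Lemma eq_sbst p c1 c2 g f1 f2 x : (forall m1 m2, f1 m1 m2 = f2 m1 m2) ->
  sbst p c1 c2 g f1 x = sbst p c1 c2 g f2 x.
Proof. by move=> e; rewrite !sbstE; apply: eq_fsbigr => q _; rewrite e. Qed.

Lemma sbst_zbounded p c1 c2 g f : sbst p c1 c2 g f \in zbounded.
Proof. by apply/asboolP => m; exists 0 => m1 n _ n0; rewrite sbst_npos. Qed.
Definition bsbst p c1 c2 g f : bs := Bser (sbst_zbounded p c1 c2 g f).

(** The shift contributes only negative powers of [z], so it is invisible at [z^0]. *)
Lemma sbst_z0 p c1 c2 g f m : sbst p c1 c2 g f (m, 0) = sbst p 0 0 g f (m, 0).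
Proof.
have [n mn] := ubnP (size m); elim: n m f mn => // n IH m f mn.
have [->|[v vm]] := mset_0Vmem m; first by rewrite !sbst_const.
have m0 : (m v)%:R != 0 :> K by rewrite pnatr_eq0 mset_neq0.
apply: (mulfI m0); rewrite !(@sbst_dvar _ _ _ _ _ _ _ _ (m, 0)) //=.
case: eqP => // _; apply: IH.
by move: mn; rewrite -{1}(msetB1K vm) size_msetD1.
Qed.

Lemma dser_comm b u b' u' f m1 m2 :
  dser b u (dser b' u' f) m1 m2 = dser b' u' (dser b u f) m1 m2.
Proof.
case: b; case: b'; rewrite /dser /=.
- rewrite !mulrA !mset1DE msetDCA; congr (_ * _); have [->|_] := eqVneq u u'; first by [].
  by rewrite !add0n mulrC.
- by rewrite mulrCA.
- by rewrite mulrCA.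
- rewrite !mulrA !mset1DE msetDCA; congr (_ * _); have [->|_] := eqVneq u u'; first by [].
  by rewrite !add0n mulrC.
Qed.

Lemma sbst0 p c1 c2 g x : sbst p c1 c2 g (fun _ _ => 0) x = 0.
Proof. by rewrite sbstE fsbig1 // => q _; rewrite mul0r. Qed.

Lemma sbst_sum p c1 c2 g (I : Type) (r : seq I) (f : I -> ser2) x :
  sbst p c1 c2 g (fun m1 m2 => \sum_(i <- r) f i m1 m2) x = \sum_(i <- r) sbst p c1 c2 g (f i) x.
Proof.
elim: r => [|i r IH].
  by rewrite big_nil -[RHS](sbst0 p c1 c2 g x); apply: eq_sbst => m1 m2; rewrite big_nil.
rewrite big_cons -IH -sbstD; apply: eq_sbst => m1 m2; by rewrite big_cons.
Qed.

Lemma dser_sum b u (I : Type) (r : seq I) (f : I -> ser2) m1 m2 :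
  dser b u (fun m1 m2 => \sum_(i <- r) f i m1 m2) m1 m2 = \sum_(i <- r) dser b u (f i) m1 m2.
Proof. by rewrite /dser; case: b; rewrite mulr_sumr. Qed.

Lemma dserZ b u c f m1 m2 :
  dser b u (fun m1 m2 => c * f m1 m2) m1 m2 = c * dser b u f m1 m2.
Proof. by rewrite /dser; case: b; rewrite mulrCA. Qed.

Lemma eq_dser b u f1 f2 m1 m2 : (forall m1 m2, f1 m1 m2 = f2 m1 m2) ->
  dser b u f1 m1 m2 = dser b u f2 m1 m2.
Proof. by move=> e; rewrite /dser !e. Qed.

(* Newton's recursion determines the coefficients of [f (t + c [z^-1]_g)]. *)
Lemma sbst_newton p b c g (f : nat -> ser2) m j :
  (forall n m1 m2, n%:R * f n m1 m2 =
     c * \sum_(k < n) dser b (g, k : nat) (f (n - k.+1)%N) m1 m2) ->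
  sbst p (if b then 0 else c) (if b then c else 0) g (f 0%N) (m, - j%:Z) =
  sbst p 0 0 g (f j) (m, 0).
Proof.
have [n jn] := ubnP j; elim: n j jn f m => // n IH [|j] jn f m hf.
  by rewrite oppr0 sbst_z0.
have j0 : j.+1%:R != 0 :> K by rewrite pnatr_eq0.
apply: (mulfI j0); rewrite (@sbst_vertex _ _ _ _ _ _ b); last by rewrite /coef; case: (b).
rewrite -sbstZ [RHS](eq_sbst _ _ _ _ _ (hf j.+1)) sbstZ sbst_sum.
congr (_ * _); first by rewrite /coef; case: (b).
(* The recursion is linear and derivatives commute, so the differentiated family satisfies it too
   and the induction hypothesis applies to that family. *)
apply: eq_bigr => k _; rewrite (IH _ _ (fun i => dser b (g, k : nat) (f i))) //.
  by rewrite subSS (leq_ltn_trans (leq_subr _ _)).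
move=> i m1 m2; rewrite -dserZ (eq_dser _ _ _ _ (hf i)) dserZ dser_sum.
by congr (_ * _); apply: eq_bigr => l _; rewrite dser_comm.
Qed.

Lemma bmul_const_coef (f1 f2 : bs) (B : nat) :
  (forall n, B%:Z < n -> f1 (mset0, n) = 0) -> (forall n, B%:Z < n -> f2 (mset0, n) = 0) ->
  (f1 * f2) (mset0, 0) = \sum_(i < B.*2.+1) f1 (mset0, i%:Z - B%:Z) * f2 (mset0, B%:Z - i%:Z).
Proof.
move=> h1 h2; rewrite bsermulE /fmul fsbig_mkcond.
pose h (i : nat) : ({mset V}%mset * int) * ({mset V}%mset * int) := ((mset0, i%:Z - B%:Z), (mset0, B%:Z - i%:Z)).
have [s sE] : exists s, s = iota 0 B.*2.+1 by exists (iota 0 B.*2.+1).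
rewrite (fsbigE [seq h i | i <- s]) //; first last.
- move=> [[b1 b2] [c1 c2]] _; rewrite /patch; case: ifPn => // /set_mem /= [e1 e2].
  have /eqP : size (b1 `+` c1)%mset = 0%N by rewrite e1 size_mset0.
  have [bm cm] := msubDl e1; rewrite !msubset0 in bm cm; move/eqP: bm => ->; move/eqP: cm => -> _.
  have [|b2B] := ltP B%:Z b2; first by move/h1 ->; rewrite mul0r.
  have [|c2B] := ltP B%:Z c2; first by move/h2 ->; rewrite mulr0.
  have -> : ((mset0, b2), (mset0, c2)) = h (absz (b2 + B%:Z)) by rewrite /h; congr ((_, _), (_, _)); lia.
  by move=> /negP[]; apply: map_f; rewrite sE mem_iota; lia.
- rewrite map_inj_in_uniq ?sE ?iota_uniq // => i i' _ _ [e _]; lia.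
under eq_bigl do rewrite in_setT.
rewrite big_map sE -[X in iota 0 X]subn0 -/(index_iota 0 _) big_mkord; apply: eq_bigr => i _.
by rewrite /patch mem_set //= msetD0; split=> //; lia.
Qed.

Section OneVertex.
Variables (Z : Type) (F : Z -> ser2) (Lb : bool -> U -> Z -> Z) (r : int -> Z -> Z).
Variables (p b0 : bool) (g : 'I_N) (sg : K).
Hypothesis F_dser : forall b u z m1 m2, dser b u (F z) m1 m2 = F (Lb b u z) m1 m2.
Hypothesis F_comm : forall b u n z m1 m2, F (Lb b u (r n z)) m1 m2 =
  F (r n (Lb b u z)) m1 m2 - ((b == b0) && (u.1 == g))%:R * (sg * F (r (n - u.2.+1%:Z) z) m1 m2).
Hypothesis F_bound : forall z, exists B : int, forall n, B < n -> forall m1 m2, F (r n z) m1 m2 = 0.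

Lemma vser_zbounded z : (fun x => sbst p 0 0 g (F (r x.2 z)) (x.1, 0)) \in zbounded.
Proof.
apply/asboolP => m; have [B hB] := F_bound z; exists B => m1 n _ hn.
by rewrite /= -[RHS](sbst0 p 0 0 g (m1, 0)); apply: eq_sbst => *; exact: hB.
Qed.
Definition vser z : bs := Bser (vser_zbounded z).

Lemma vserE z m n : vser z (m, n) = sbst p 0 0 g (F (r n z)) (m, 0).
Proof. by []. Qed.

Lemma vser_const z n : vser z (mset0, n) = F (r n z) mset0 mset0.
Proof. by rewrite vserE sbst_const. Qed.

Lemma der_vser v z : der (vexp v) (vser z) =
  if v.1.1 == p then
    bvar v * (vser (Lb v.1.2 v.2 z) -
      bcz (((v.1.2 == b0) && (v.2.1 == g))%:R * sg) v.2.2.+1%:Z * vser z)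
  else 0.
Proof.
apply: bser_eqP => -[m n]; rewrite derE /vexp vserE.
have [vm|vm] := boolP (v \in m); last first.
  rewrite (mset_eq0P vm) mul0r; case: ifP => // _; by rewrite bvarE /= (negPf vm).
rewrite (@sbst_dvar _ _ _ _ _ _ _ v (m, 0)) //=; case: ifP => // _.
rewrite bvarE /= vm bserD bserN bczE !vserE /=.
transitivity (sbst p 0 0 g (fun m1 m2 => F (r n (Lb v.1.2 v.2 z)) m1 m2 +
   - (((v.1.2 == b0) && (v.2.1 == g))%:R * sg) * F (r (n - v.2.2.+1%:Z) z) m1 m2) ((m `\ v)%mset, 0)).
  by apply: eq_sbst => m1 m2; rewrite F_dser F_comm mulNr mulrA.
by rewrite sbstD sbstZ mulNr.
Qed.

(** Bosonization in abstract form. When [n0] bounds the modes that survive on [z] and those below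
    obey Newton's recursion, the field and the shift of times have the same leading coefficient and
    the same recursion. *)
Lemma vser_shift z (n0 : int) :
  (forall n, n0 < n -> forall m1 m2, F (r n z) m1 m2 = 0) ->
  (forall (j : nat) m1 m2, j%:R * F (r (n0 - j%:Z) z) m1 m2 =
    - sg * \sum_(k < j) F (Lb b0 (g, k : nat) (r (n0 - (j - k.+1)%N%:Z) z)) m1 m2) ->
  vser z = bz n0 * bsbst p (if b0 then 0 else - sg) (if b0 then - sg else 0) g (F (r n0 z)).
Proof.
move=> hb hN; apply: bser_eqP => -[m n]; rewrite bzE vserE /=.
have [n0n|nn0] := ltP n0 n.
  have -> : sbst p 0 0 g (F (r n z)) (m, 0) = 0.
    by rewrite -[RHS](sbst0 p 0 0 g (m, 0)); apply: eq_sbst => m1 m2; exact: hb.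
  by apply/esym; apply: sbst_npos => /=; rewrite subr_gt0.
have [j jE] : exists j : nat, n = n0 - j%:Z.
  exists (absz (n0 - n)); lia.
rewrite jE (_ : n0 - j%:Z - n0 = - j%:Z); last by rewrite addrAC subrr add0r.
rewrite -(@sbst_newton p b0 (- sg) g (fun j => F (r (n0 - j%:Z) z)) m j); first by rewrite subr0.
move=> i m1 m2; rewrite hN; congr (_ * _); apply: eq_bigr => k _.
by rewrite F_dser.
Qed.

End OneVertex.
End VertexSeries.

(** * Bilinear products of fields *)

Section BilinearSeries.
Context {K : numFieldType} {N : nat}.
Local Notation V := (@tvar N).
Local Notation U := (tidx N).
Local Notation bs := (@bser K V).
Local Notation ser2 := ({mset U}%mset -> {mset U}%mset -> K).
Variables (Z : Type) (F : Z -> ser2) (Lb : bool -> U -> Z -> Z).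
Hypothesis F_dser : forall b u z m1 m2, dser b u (F z) m1 m2 = F (Lb b u z) m1 m2.

Lemma bmul_unit_coef (f1 f2 : bs) :
  (forall n, f1 (mset0, n) = (n == 0)%:R) -> (f1 * f2) (mset0, 0) = f2 (mset0, 0).
Proof.
move=> h1; have [B' h2] := bserP f2 mset0; pose B := `|B'|%N.
rewrite (@bmul_const_coef _ _ _ _ B); first last.
- by move=> n hn; apply: h2; rewrite ?msub0set //; rewrite /B in hn; lia.
- by move=> n hn; rewrite h1 gt_eqF //; lia.
have BB : (B < B.*2.+1)%N by lia.
rewrite (bigD1 (Ordinal BB)) //= subrr h1 eqxx mul1r big1 ?addr0 // => i iB.
rewrite h1; case: eqP => [e|_]; last by rewrite mul0r.
by case/negP: iB; apply/eqP/val_inj => /=; lia.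
Qed.

(* [r n z] is the coefficient of [w^n] in a field acting on [z], which
   satisfies [r (L_u z) = L_u (r z) + sg w^k r z] for the time [u = (g, k)] of the
   group [b0], and commutes with the other [L]. *)
Definition vertex (b0 : bool) (g : 'I_N) (sg : K) (r : int -> Z -> Z) : Prop :=
  (forall b u n z m1 m2, F (Lb b u (r n z)) m1 m2 =
    F (r n (Lb b u z)) m1 m2 - ((b == b0) && (u.1 == g))%:R * (sg * F (r (n - u.2.+1%:Z) z) m1 m2)) /\
  (forall z, exists B : int, forall n, B < n -> forall m1 m2, F (r n z) m1 m2 = 0).

Section OneTerm.
Variables (b0 : bool) (g : 'I_N) (r1 r2 : int -> Z -> Z).
Hypotheses (v1 : vertex b0 g 1 r1) (v2 : vertex b0 g (-1) r2).

Definition vprod z1 z2 : bs :=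
  bexp_xi b0 g * (vser false g v1.2 z1 * vser true g v2.2 z2).

(** [xi] depends on the difference of unprimed and primed times, and the two fields carry the signs
    [1] and [-1]. Hence the terms in a power of [z] from [e^xi] and from the differentiated field
    cancel, and only the insertion of [Lb] remains. *)
Lemma vprod_dvar z1 z2 (v : V) (m : {mset V}%mset) (n : int) : v \in m -> (m v)%:R * vprod z1 z2 (m, n) =
  (if v.1.1 then vprod z1 (Lb v.1.2 v.2 z2) else vprod (Lb v.1.2 v.2 z1) z2) ((m `\ v)%mset, n).
Proof.
move=> vm; transitivity (der (vexp v) (vprod z1 z2) (m, n)); first by [].
set w := if _ then _ else _; suff -> : der (vexp v) (vprod z1 z2) = bvar v * w.
  by rewrite bvarE /= vm.
have cN c k : bcz (- c) k = - bcz c k :> bs.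
  by apply: bser_eqP => x; rewrite bserN !bcz_val mulNr.
have c0 k : bcz 0 k = 0 :> bs by apply: bser_eqP => x; rewrite bcz_val mul0r.
rewrite /vprod !derM; try exact: vexpD.
rewrite bexp_xi_dser (der_vser _ F_dser v1.1 v1.2) (der_vser _ F_dser v2.1 v2.2) /xi_sgn /w.
case: (v.1.1) => /=; rewrite ?eqxx /=.
  rewrite mulrN1 cN; case: ifP => _ /=; rewrite /vprod ?cN ?c0 ?oppr0; ring.
rewrite mulr1; case: ifP => _ /=; rewrite /vprod ?c0 ; ring.
Qed.

Lemma vprod_const z1 z2 : exists B0 : nat, forall B, (B0 <= B)%N ->
  vprod z1 z2 (mset0, 0) = \sum_(i < B.*2.+1)
    F (r1 (i%:Z - B%:Z) z1) mset0 mset0 * F (r2 (B%:Z - i%:Z) z2) mset0 mset0.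
Proof.
have [B1 h1] := v1.2 z1; have [B2 h2] := v2.2 z2.
exists (`|B1| + `|B2|)%N => B hB; pose A1 := vser false g v1.2 z1; pose A2 := vser true g v2.2 z2.
have A1B n : B%:Z < n -> A1 (mset0, n) = 0 by move=> hn; rewrite vser_const h1 //; lia.
have A2B n : B%:Z < n -> A2 (mset0, n) = 0 by move=> hn; rewrite vser_const h2 //; lia.
rewrite /vprod bmul_unit_coef; last exact: bexp_xi0.
rewrite (bmul_const_coef A1B A2B); apply: eq_bigr => i _.
by rewrite !vser_const.
Qed.

End OneTerm.
(** [z1] and [z2] are generalized in the induction because each step replaces one of them by its
    image under [Lb], in the same way on both sides. *)
Lemma vprod_eq (rL1 rL2 rR1 rR2 : 'I_N -> int -> Z -> Z)
    (vL1 : forall g, vertex false g 1 (rL1 g)) (vL2 : forall g, vertex false g (-1) (rL2 g))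
    (vR1 : forall g, vertex true g 1 (rR1 g)) (vR2 : forall g, vertex true g (-1) (rR2 g)) :
  (forall z1 z2, \sum_g vprod (vL1 g) (vL2 g) z1 z2 (mset0, 0) =
                 \sum_g vprod (vR1 g) (vR2 g) z1 z2 (mset0, 0)) ->
  forall z1 z2 m, \sum_g vprod (vL1 g) (vL2 g) z1 z2 (m, 0) =
                  \sum_g vprod (vR1 g) (vR2 g) z1 z2 (m, 0).
Proof.
move=> h0 z1 z2 m; have [n mn] := ubnP (size m); elim: n m z1 z2 mn => // n IH m z1 z2 mn.
have [->|[v vm]] := mset_0Vmem m; first exact: h0.
have m0 : (m v)%:R != 0 :> K by rewrite pnatr_eq0 mset_neq0.
apply: (mulfI m0); rewrite !mulr_sumr.
under eq_bigr do rewrite vprod_dvar //.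
under [RHS]eq_bigr do rewrite vprod_dvar //.
have lm : (size (m `\ v)%mset < n)%N by move: mn; rewrite -{1}(msetB1K vm) size_msetD1.
by case: (v.1.1); apply: IH.
Qed.

End BilinearSeries.

(** * Fermions and currents *)

Section Windows.
Context {W : zmodType}.
Implicit Types (f : int -> W) (B : nat).

Definition wsum B f : W := \sum_(i < B.*2.+1) f (i%:Z - B%:Z).

Lemma wsumE B f : (forall j, B%:Z < `|j| -> f j = 0) ->
  \sum_(j \in [set: int]) f j = wsum B f.
Proof.
move=> fB; rewrite (fsbigE [seq i%:Z - B%:Z | i <- index_iota 0 B.*2.+1]) //.
- by under eq_bigl do rewrite in_setT; rewrite big_map big_mkord.
- by rewrite map_inj_uniq ?iota_uniq // => i i'; lia.
- move=> j _ jB; apply: fB; rewrite ltNge; apply/negP => jB'; case/negP: jB.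
  apply/mapP; exists (absz (j + B%:Z)); last lia.
  by rewrite mem_index_iota; lia.
Qed.

Lemma eq_wsum B f f' : (forall j, f j = f' j) -> wsum B f = wsum B f'.
Proof. by move=> e; apply: eq_bigr. Qed.

Lemma wsumD B f f' : wsum B (fun j => f j + f' j) = wsum B f + wsum B f'.
Proof. exact: big_split. Qed.

Lemma wsum1 B f (j : int) : `|j| <= B%:Z -> wsum B (fun i => f i *+ (i == j)) = f j.
Proof.
move=> jB; have iB : (absz (j + B%:Z)%R < B.*2.+1)%N by lia.
have e : (absz (j + B%:Z))%:Z - B%:Z = j by lia.
rewrite /wsum (bigD1 (Ordinal iB)) //= e eqxx mulr1n big1 ?addr0 // => i ij.
case: eqP => // e'; case/negP: ij; apply/eqP/val_inj => /=; lia.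
Qed.

Lemma wsum_widen B B' f : (B <= B')%N -> (forall j, B%:Z < `|j| -> f j = 0) ->
  wsum B' f = wsum B f.
Proof. by move=> BB h; rewrite -!wsumE // => j jB; apply: h; lia. Qed.

End Windows.

(* The pairs [(p, q)] are [(psi, psi^* )] on the dual Fock space and
   [(psi^*, psi)] on the Fock space. *)
Record fermi_rep (K : fieldType) (W : lmodType K) (N : nat)
    (p q : 'I_N -> int -> W -> W) : Prop := FermiRep {
  fp_lin : forall a j, linear (p a j);
  fq_lin : forall a j, linear (q a j);
  fpq : forall a b j k w,
    q b k (p a j w) + p a j (q b k w) = w *+ ((a == b) && (j == k));
  fpp : forall a b j k w, p a j (p b k w) = - p b k (p a j w);
  fqq : forall a b j k w, q a j (q b k w) = - q b k (q a j w);
  f_fin : forall w, exists M : nat,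
    (forall a j, M%:Z <= j -> p a j w = 0) /\ (forall a j, j < - M%:Z -> q a j w = 0) }.

Section FermiRep.
Context {K : numFieldType} {W : lmodType K} {N : nat}.
Implicit Types (p q : 'I_N -> int -> W -> W) (w : W).

(** One formula for two currents: [J_k] on the dual space, where the left factor acts first, and
    [J_{-k}] on the Fock space after a shift of the summation index. *)
Definition cur p q (a : 'I_N) (k : int) w : W :=
  \sum_(j \in [set: int]) q a (j + k) (p a j w).

Lemma lin0 (f : W -> W) : linear f -> f 0 = 0.
Proof. by move=> h; have := h (-1) 0 0; rewrite !scaleN1r !addNr. Qed.
Lemma linD (f : W -> W) x y : linear f -> f (x + y) = f x + f y.
Proof. by move=> h; have := h 1 x y; rewrite !scale1r. Qed.
Lemma linZ (f : W -> W) c x : linear f -> f (c *: x) = c *: f x.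
Proof. by move=> h; have := h c x 0; rewrite (lin0 h) !addr0. Qed.
Lemma linN (f : W -> W) x : linear f -> f (- x) = - f x.
Proof. by move=> h; rewrite -scaleN1r linZ // scaleN1r. Qed.
Lemma lin_sum (f : W -> W) (I : Type) (r : seq I) P (F : I -> W) : linear f ->
  f (\sum_(i <- r | P i) F i) = \sum_(i <- r | P i) f (F i).
Proof.
move=> h; elim/big_rec2: _ => [|i y1 y2 _ <-]; first exact: lin0.
exact: linD.
Qed.

Section Currents.
Variables p q : 'I_N -> int -> W -> W.
Hypothesis H : fermi_rep p q.

Lemma f_anti a b j k w : (a == b) && (j == k) = false -> q b k (p a j w) = - p a j (q b k w).
Proof.
by move=> e; apply/eqP; rewrite -addr_eq0 (fpq H) e mulr0n.
Qed.

Lemma curE a k w : 0 < k -> exists B0 : nat, forall B, (B0 <= B)%N ->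
  cur p q a k w = wsum B (fun j => q a (j + k) (p a j w)).
Proof.
move=> k0; have [M [pM qM]] := f_fin H w; exists (M + absz k)%N => B hB.
apply: wsumE => j jB; have [Mj|jM] := leP M%:Z j; first by rewrite pM // (lin0 (fq_lin H _ _)).
rewrite f_anti; last by apply/negbTE; rewrite eqxx /=; lia.
by rewrite qM ?(lin0 (fp_lin H _ _)) ?oppr0 //; lia.
Qed.

Lemma cur_lin a k : 0 < k -> linear (cur p q a k).
Proof.
move=> k0 c w w'; have [B1 h1] := curE a w k0; have [B2 h2] := curE a w' k0.
have [B3 h3] := curE a (c *: w + w') k0; pose B := (B1 + B2 + B3)%N.
rewrite (h1 B) 1?(h2 B) 1?(h3 B) /B; try lia.
rewrite scaler_sumr -big_split; apply: eq_bigr => i _ /=.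
by rewrite (fp_lin H) (fq_lin H).
Qed.

Lemma p_cur a b k m w : 0 < k ->
  p b m (cur p q a k w) = cur p q a k (p b m w) + p a (m - k) w *+ (a == b).
Proof.
move=> k0; have [B1 h1] := curE a w k0; have [B2 h2] := curE a (p b m w) k0.
pose B := (B1 + B2 + absz m + absz k)%N.
rewrite (h1 B) 1?(h2 B) /B; try lia; rewrite -/B.
rewrite -(@wsum1 _ B (fun j => p a j w *+ (a == b)) (m - k)) /B; last lia.
rewrite -/B -wsumD (lin_sum _ _ _ (fp_lin H b m)); apply: eq_bigr => i _.
move: (i%:Z - B%:Z) => j; have := fpq H b a m (j + k) (p a j w).
rewrite (fpp H) (linN _ (fq_lin H _ _)) => /(canRL (addNKr _)) ->; congr (_ + _).
rewrite (eq_sym b) -mulrnA -mulnb (_ : (j == m - k) = (m == j + k)) 1?mulnC //.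
by apply/eqP/eqP; lia.
Qed.

Lemma q_cur a b k m w : 0 < k ->
  q b m (cur p q a k w) = cur p q a k (q b m w) - q a (m + k) w *+ (a == b).
Proof.
move=> k0; have [B1 h1] := curE a w k0; have [B2 h2] := curE a (q b m w) k0.
pose B := (B1 + B2 + absz m + absz k)%N.
rewrite (h1 B) 1?(h2 B) /B; try lia; rewrite -/B.
rewrite -mulNrn -(@wsum1 _ B (fun j => - q a (j + k) w *+ (a == b)) m) /B; last lia.
rewrite -/B -wsumD (lin_sum _ _ _ (fq_lin H b m)); apply: eq_bigr => i _.
move: (i%:Z - B%:Z) => j; rewrite (fqq H); have := fpq H a b j m w => /(canRL (addrK _)) ->.
rewrite (linD _ _ (fq_lin H _ _)) (linN _ (fq_lin H _ _)) opprD opprK addrC; congr (_ + _).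
case: (a == b); rewrite /= ?mulr0n ?mul0rn ?(lin0 (fq_lin H _ _)) ?oppr0 ?mulr1n //.
by case: (j == m); rewrite /= ?mulr0n ?mulr1n ?(lin0 (fq_lin H _ _)) ?oppr0.
Qed.

(** Moving one current through the other leaves the difference of two expressions for the current of
    mode [k + l], which agree after a shift of the index. As [k + l] is not zero, no central term
    arises from reordering. *)
Lemma cur_comm a b k l w : 0 < k -> 0 < l ->
  cur p q b l (cur p q a k w) = cur p q a k (cur p q b l w).
Proof.
move=> k0 l0; have [B1 h1] := curE b w l0; have [B2 h2] := curE b (cur p q a k w) l0.
have [B3 h3] := curE a w (addr_gt0 k0 l0).
have [M [pM qM]] := f_fin H w; pose B := (B1 + B2 + B3 + M + absz k + absz l)%N.
rewrite (h2 B) 1?(h1 B) /B; try lia; rewrite -/B.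
rewrite (lin_sum _ _ _ (cur_lin a k0)).
transitivity (wsum B (fun j => cur p q a k (q b (j + l) (p b j w)) +
  (q a (j + l) (p a (j - k) w) - q a (j + l + k) (p a j w)) *+ (a == b))).
  apply: eq_bigr => i _; move: (i%:Z - B%:Z) => j.
  rewrite (p_cur _ _ _ _ k0) (linD _ _ (fq_lin H _ _)) (q_cur _ _ _ _ k0) -addrA; congr (_ + _).
  have [->|_] := eqVneq a b; last by rewrite !mulr0n (lin0 (fq_lin H _ _)) oppr0 addr0.
  by rewrite !mulr1n addrC.
rewrite wsumD -[RHS]addr0; congr (_ + _).
have [_|_] := eqVneq a b; last by apply: big1 => i _; rewrite mulr0n.
rewrite /wsum; under eq_bigr do rewrite mulr1n.
rewrite big_split sumrN /= -/(wsum B (fun j => q a (j + l) (p a (j - k) w))).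
rewrite -/(wsum B (fun j => q a (j + l + k) (p a j w))); apply/eqP; rewrite subr_eq0; apply/eqP.
transitivity (cur p q a (k + l) w); last first.
  by rewrite (h3 B) /B; [apply: eq_wsum => j; rewrite (addrC k) addrA|lia].
rewrite -wsumE.
  rewrite /cur [RHS](reindex_fsbigT (fun j => j - k)) /=.
    by apply: eq_fsbigr => j _; rewrite addrA subrK.
  by exists (fun j => j + k) => j; lia.
move=> j jB; have [Mj|jM] := leP M%:Z (j - k).
  by rewrite pM // (lin0 (fq_lin H _ _)).
rewrite f_anti; last by apply/negbTE; rewrite eqxx /=; lia.
have jl : j + l < - M%:Z by rewrite /B in jB; lia.
by rewrite qM ?(lin0 (fp_lin H _ _)) ?oppr0.
Qed.

(* Both sums run over a triangle on which the anticommuting products cancel. *)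
Lemma p_newton g (s : int) w : (forall j, s <= j -> p g j w = 0) ->
  (forall j, j < s -> q g j w = 0) -> forall n : nat,
  n%:R *: p g (s - 1 - n%:Z) w =
  - \sum_(k < n) cur p q g k.+1%:Z (p g (s - 1 - (n - k.+1)%N%:Z) w).
Proof.
move=> pw qw n.
have curw k : (k <= n)%N -> (0 < k)%N -> cur p q g k%:Z w =
    \sum_(b < n) (q g (s - 1 - b%:Z + k%:Z) (p g (s - 1 - b%:Z) w)) *+ (b < k)%N.
  move=> kn k0; rewrite /cur (fsbigE [seq s - 1 - b%:Z | b <- index_iota 0 n]) //.
  - under eq_bigl do rewrite in_setT.
    rewrite big_map big_mkord; apply: eq_bigr => b _; case: ltnP => bk //.
    rewrite f_anti; last by apply/negbTE; rewrite eqxx /=; lia.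
    by rewrite qw ?(lin0 (fp_lin H _ _)) ?oppr0 //; lia.
  - by rewrite map_inj_uniq ?iota_uniq // => i i'; lia.
  - move=> j _ js; have [sj|js'] := leP s j; first by rewrite pw // (lin0 (fq_lin H _ _)).
    rewrite f_anti; last by apply/negbTE; rewrite eqxx /=; lia.
    rewrite qw ?(lin0 (fp_lin H _ _)) ?oppr0 //.
    rewrite ltNge; apply/negP => h; case/negP: js; apply/mapP; exists (absz (s - 1 - j)%R); last lia.
    by rewrite mem_index_iota; lia.
pose f (a b : nat) := (q g (s - 1 + n%:Z - a%:Z - b%:Z) (p g (s - 1 - a%:Z) (p g (s - 1 - b%:Z) w)))
   *+ (a + b < n)%N.
have fC a b : f a b = - f b a.
  rewrite /f addnC; case: ltnP => _; last by rewrite oppr0.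
  rewrite !mulr1n (fpp H) (linN _ (fq_lin H _ _)); congr (- q g _ _); lia.
have f0 : \sum_(a < n) \sum_(b < n) f a b = 0.
  set S := LHS; have : S = - S.
    transitivity (\sum_(a < n) \sum_(b < n) f b a); first by rewrite /S exchange_big.
    rewrite /S -sumrN; apply: eq_bigr => a _ /=.
    by rewrite -sumrN; apply: eq_bigr => b _; exact: fC.
  by move/eqP; rewrite -addr_eq0 -mulr2n -scaler_nat scaler_eq0 pnatr_eq0 /= => /eqP.
have key : \sum_(k < n) p g (s - 1 - (n - k.+1)%N%:Z) (cur p q g k.+1%:Z w) = 0.
  rewrite (reindex_inj rev_ord_inj) /= -[RHS]oppr0 -[in RHS]f0 -sumrN; apply: eq_bigr => a _.
  have an := ltn_ord a; have -> : (n - (n - a.+1).+1 = a)%N by lia.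
  have -> : (n - a.+1).+1 = (n - a)%N by lia.
  rewrite curw; [|exact: leq_subr|by rewrite subn_gt0].
  rewrite (lin_sum _ _ _ (fp_lin H _ _)) -sumrN; apply: eq_bigr => b _.
  have bn := ltn_ord b; rewrite /f ltn_subRL; case: ltnP => ab.
    rewrite !mulr1n -[LHS]opprK -f_anti; last by apply/negbTE; rewrite eqxx /=; lia.
    by congr (- q g _ _); lia.
  by rewrite !mulr0n (lin0 (fp_lin H _ _)) oppr0.
(* Commuting each current with its fermion produces the same mode [s - 1 - n], so the [n]
   commutators add up to the left side, while the reordered sum vanishes by [key]. *)
transitivity (- \sum_(k < n) (p g (s - 1 - (n - k.+1)%N%:Z) (cur p q g k.+1%:Z w) - p g (s - 1 - n%:Z) w)).
  by rewrite big_split /= key add0r sumrN opprK sumr_const card_ord scaler_nat.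
congr (- _); apply: eq_bigr => k _; rewrite p_cur // eqxx mulr1n.
have kn := ltn_ord k; rewrite (_ : s - 1 - (n - k.+1)%N%:Z - k.+1%:Z = s - 1 - n%:Z); last lia.
by rewrite addrK.
Qed.

End Currents.

(** Particle-hole symmetry: the reflection [j -> - 1 - j] exchanges [j >= 0] with [j < 0]. It turns
    a level [s] into [- s] and yields statements on [q] from those on [p]. *)
Lemma fermi_rep_dual p q : fermi_rep p q ->
  fermi_rep (fun a j => q a (- 1 - j)) (fun a j => p a (- 1 - j)).
Proof.
move=> H; split=> [a j|a j|a b j k w|a b j k w|a b j k w|w].
- exact: (fq_lin H).
- exact: (fp_lin H).
- rewrite addrC (fpq H) (eq_sym b) (_ : (-1 - k == -1 - j) = (j == k)) //.
  by apply/eqP/eqP; lia.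
- exact: (fqq H).
- exact: (fpp H).
have [M [pM qM]] := f_fin H w; exists M; split=> a j jM; [apply: qM; lia|apply: pM; lia].
Qed.

(** The symmetry reverses the order of the two fermions; for [k] nonzero they anticommute, whence
    the sign. *)
Lemma cur_dual p q a k w : fermi_rep p q -> 0 < k ->
  cur (fun a j => q a (- 1 - j)) (fun a j => p a (- 1 - j)) a k w = - cur p q a k w.
Proof.
move=> H k0; pose P (j : int) : W := p a (- 1 - j) w.
have -> : cur (fun a j => q a (- 1 - j)) (fun a j => p a (- 1 - j)) a k w =
    \sum_(j \in [set: int]) p a j (q a (j + k) w).
  rewrite /cur [RHS](reindex_fsbigT (fun j => - 1 - (j + k))) /=.
    by apply: eq_fsbigr => j _; congr (p a _ (q a _ w)); lia.
  by exists (fun j => - 1 - k - j) => j; lia.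
have [M [pM qM]] := f_fin H w; pose B := (M + absz k)%N.
have big j : B%:Z < `|j| -> q a (j + k) w = 0 \/ p a j w = 0.
  by move=> jB; have [Mj|jM] := leP M%:Z j; [right; exact: pM|left; apply: qM; rewrite /B in jB; lia].
have anti j : p a j (q a (j + k) w) = - q a (j + k) (p a j w).
  by rewrite (f_anti H) ?opprK //; apply/negbTE; rewrite eqxx /=; lia.
rewrite /cur !(@wsumE _ B).
- by rewrite /wsum -sumrN; apply: eq_bigr => i _.
- move=> j /big[qw|->]; last exact: lin0 (fq_lin H _ _).
  by rewrite -[LHS]opprK -anti qw (lin0 (fp_lin H _ _)) oppr0.
- by move=> j /big[->|pw]; [exact: lin0 (fp_lin H _ _)|rewrite anti pw (lin0 (fq_lin H _ _)) oppr0].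
Qed.

Lemma q_newton p q (H : fermi_rep p q) g (s : int) w :
  (forall j, s <= j -> p g j w = 0) -> (forall j, j < s -> q g j w = 0) -> forall n : nat,
  n%:R *: q g (s + n%:Z) w = \sum_(k < n) cur p q g k.+1%:Z (q g (s + (n - k.+1)%N%:Z) w).
Proof.
move=> pw qw n; have := @p_newton _ _ (fermi_rep_dual H) g (- s) w _ _ n.
have e (i : int) : - 1 - (- s - 1 - i) = s + i by lia.
rewrite e => ->; [|by move=> j hj; apply: qw; lia|by move=> j hj; apply: pw; lia].
by rewrite -sumrN; apply: eq_bigr => k _; rewrite (cur_dual _ _ H) // opprK e.
Qed.

End FermiRep.

Import numFieldNormedType.Exports.

(** * The bilinear identity for g *)

Section CauchyProduct.
Context {K : numFieldType}.

Lemma sum_triangle (V : nmodType) (F : nat -> nat -> V) M :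
  \sum_(k < M) \sum_(n < k.+1) F n (k - n)%N =
  \sum_(n < M) \sum_(m < M) F n m *+ (n + m < M)%N.
Proof.
transitivity (\sum_(k < M) \sum_(n < M) F n (k - n)%N *+ (n <= k)%N).
  apply: eq_bigr => k _; rewrite (big_ord_widen _ (fun n => F n (k - n)%N) (ltn_ord k)).
  by rewrite big_mkcond; apply: eq_bigr => n _; rewrite ltnS; case: (n <= k)%N.
rewrite exchange_big; apply: eq_bigr => n _ /=; have nM := ltnW (ltn_ord n).
transitivity (\sum_(m < M - n) F n m).
  rewrite -(big_mkord xpredT (fun k => F n (k - n)%N *+ (n <= k)%N)) (big_cat_nat _ nM) //=.
  rewrite big_nat big1 => [|k /andP[_ kn]]; last by rewrite leqNgt kn.
  rewrite add0r -{1}(add0n (val n)) big_addn big_mkord; apply: eq_bigr => m _.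
  by rewrite leq_addl mulr1n addnK.
rewrite (big_ord_widen _ (F n) (leq_subr n M)) big_mkcond; apply: eq_bigr => m _.
by rewrite ltn_subRL; case: (n + m < M)%N.
Qed.

Lemma ler_sum_widen n m (f g : nat -> K) : (n <= m)%N ->
  (forall i, (i < n)%N -> f i <= g i) -> (forall i, 0 <= g i) ->
  \sum_(i < n) f i <= \sum_(i < m) g i.
Proof.
move=> nm fg g0; rewrite (big_ord_widen _ f nm) big_mkcond; apply: ler_sum => i _ /=.
by case: ifP => // /fg.
Qed.

(** The product of partial sums runs over a square, the partial sum of the product over its lower
    triangle. The rest of the square of side [n] lies in the triangle of side [2n], so the
    difference is bounded by the absolute series between [n] and [2n]. *)
Lemma cvg_cauchy_prod (a b : nat -> K^o) (A B : K^o) :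
  series a @ \oo --> A -> series b @ \oo --> B ->
  cvgn (series ((fun k => \sum_(n < k.+1) `|a n| * `|b (k - n)%N|) : nat -> K^o)) ->
  series ((fun k => \sum_(n < k.+1) a n * b (k - n)%N) : nat -> K^o) @ \oo --> (A * B : K^o).
Proof.
move=> cva cvb cvd; set d := (X in series X) in cvd; set c := (X in series X).
have cvab : (series a \* series b) @ \oo --> A * B by apply: cvgM.
have e0 : ((series a \* series b) - series c) @ \oo --> (0 : K^o).
  move/cvgrPdist_lt: cvd => cvd; apply/cvgr0Pnorm_lt => eps eps0.
  have [|M _ hM] := cvd (eps / 2); first by rewrite divr_gt0.
  exists M => // n /= Mn; apply: (@le_lt_trans _ _ `|series d n.*2 - series d n|).
    rewrite !fctE /series /= !big_mkord /c /d /= (sum_triangle (fun i j => a i * b j)).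
    rewrite (sum_triangle (fun i j => `|a i| * `|b j|)) (sum_triangle (fun i j => `|a i| * `|b j|)).
    rewrite mulr_suml -sumrB.
    apply: (@le_trans _ _ (\sum_(i < n) \sum_(j < n) (`|a i| * `|b j|) *+ (n <= i + j)%N)).
      apply: le_trans (ler_norm_sum _ _ _) _; apply: ler_sum => i _.
      rewrite mulr_sumr -sumrB; apply: le_trans (ler_norm_sum _ _ _) _; apply: ler_sum => j _.
      by rewrite ltnNge; case: (n <= i + j)%N; rewrite /= ?subr0 ?subrr ?normr0 // normrM.
    have D0 m : 0 <= \sum_(i < m) \sum_(j < m) (`|a i| * `|b j|) *+ (i + j < m)%N.
      by apply: sumr_ge0 => i _; apply: sumr_ge0 => j _; rewrite mulrn_wge0 // mulr_ge0.
    apply: le_trans (real_ler_norm _); last by rewrite rpredB // ger0_real.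
    rewrite lerBrDr -big_split /=.
    apply: (@le_trans _ _ (\sum_(i < n) \sum_(j < n) (`|a i| * `|b j|))).
      apply: ler_sum => i _; rewrite -big_split; apply: ler_sum => j _ /=.
      by rewrite ltnNge; case: (n <= i + j)%N; rewrite /= ?addr0 ?add0r.
    have nn : (n <= n.*2)%N by rewrite -addnn leq_addr.
    apply: (ler_sum_widen (f := fun i => \sum_(j < n) (`|a i| * `|b j|))
      (g := fun i => \sum_(j < n.*2) (`|a i| * `|b j|) *+ (i + j < n.*2)%N) nn) => [i ilt|i].
      apply: (ler_sum_widen (f := fun j => `|a i| * `|b j|)
        (g := fun j => (`|a i| * `|b j|) *+ (i + j < n.*2)%N) nn) => [j jlt|j].
        by rewrite (_ : (i + j < n.*2)%N) //; lia.
      by rewrite mulrn_wge0 // mulr_ge0.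
    by apply: sumr_ge0 => j _; rewrite mulrn_wge0 // mulr_ge0.
  rewrite (splitr eps); apply: le_lt_trans (ler_distD (limn (series d)) _ _) _.
  by rewrite [X in X + _]distrC ltrD // hM //= -addnn; exact: leq_trans (leq_addr _ _).
rewrite -(subr0 (A * B)) (_ : series c = (series a \* series b) - ((series a \* series b) - series c)).
  exact: cvgB cvab e0.
by apply/funext => n; rewrite /= !fctE opprB addrC subrK.
Qed.

End CauchyProduct.

(** * Exponential series of complex numbers *)

Section ComplexSeries.
Context {R : realType}.
Local Notation C := R[i].
Local Notation realC x := (real_complex R x).

Lemma norm_realC (x : R) : `|realC x| = realC `|x|.
Proof. by rewrite normc_def /= expr0n /= addr0 sqrtr_sqr. Qed.

Lemma norm_complex_le (z : C) : `|z| <= realC (`|complex.Re z| + `|complex.Im z|).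
Proof.
rewrite [in X in X <= _](complexE z) (le_trans (ler_normD _ _)) // rmorphD /= lerD //.
  by rewrite norm_realC.
rewrite normrM norm_realC normc_def /= expr0n expr1n add0r sqrtr1 mul1r.
by [].
Qed.

Lemma Re_le_norm (z : C) : realC `|complex.Re z| <= `|z|.
Proof.
rewrite normc_def lecR -sqrtr_sqr ler_wsqrtr // lerDl; exact: sqr_ge0.
Qed.

Lemma Im_le_norm (z : C) : realC `|complex.Im z| <= `|z|.
Proof.
rewrite normc_def lecR -sqrtr_sqr ler_wsqrtr // lerDr; exact: sqr_ge0.
Qed.

Lemma cvg_complex (f : nat -> C) (a b : R) :
  (fun n => complex.Re (f n)) @ \oo --> a -> (fun n => complex.Im (f n)) @ \oo --> b ->
  (f : nat -> C^o) @ \oo --> (a +i* b : C^o)%C.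
Proof.
move=> /cvgrPdist_lt fa /cvgrPdist_lt fb; apply/cvgrPdist_lt => e e0.
have [r r0 ->] : exists2 r : R, 0 < r & e = realC r.
  exists (complex.Re e); first by move: e0; rewrite ltcE => /andP[].
  by rewrite RRe_real // gtr0_real.
have r20 : 0 < r / 2 by rewrite divr_gt0.
near=> n; apply: le_lt_trans (norm_complex_le _) _; rewrite ltcR.
rewrite (splitr r); apply: ltrD.
  rewrite (_ : complex.Re _ = a - complex.Re (f n)); last by case: (f n).
  by near: n; exact: fa.
rewrite (_ : complex.Im _ = b - complex.Im (f n)); last by case: (f n).
by near: n; exact: fb.
Unshelve. all: by end_near. Qed.

Lemma Re_sum (I : Type) (r : seq I) P (F : I -> C) :
  complex.Re (\sum_(i <- r | P i) F i) = \sum_(i <- r | P i) complex.Re (F i).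
Proof. by elim/big_rec2: _ => // i x y _ <-; case: y; case: (F i). Qed.

Lemma Im_sum (I : Type) (r : seq I) P (F : I -> C) :
  complex.Im (\sum_(i <- r | P i) F i) = \sum_(i <- r | P i) complex.Im (F i).
Proof. by elim/big_rec2: _ => // i x y _ <-; case: y; case: (F i). Qed.

Lemma real_dom_cvg (f : nat -> R) (c k : R) : 0 <= c -> 0 <= k ->
  (forall n, `|f n| <= c * (k ^+ n / n`!%:R)) -> cvgn (series f).
Proof.
move=> c0 k0 hf; apply: normed_cvg.
apply: (@series_le_cvg _ _ (fun n => c * exp_coeff k n)) => [n|n|n|]; first exact: normr_ge0.
- by apply: mulr_ge0 => //; exact: exp_coeff_ge0.
- exact: hf.
exact: (@is_cvg_seriesZ R (exp_coeff k) c (is_cvg_series_exp_coeff k)).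
Qed.

Definition geom_bounded (a : nat -> C) : Prop :=
  exists c k : R, [/\ 0 <= c, 0 <= k & forall n, `|a n| <= realC (c * k ^+ n)].

(** Real and imaginary parts are each dominated by a multiple of the real exponential series of
    [k]. *)
Lemma exp_series_cvg (a : nat -> C) : geom_bounded a ->
  cvgn (series (fun n => n`!%:R^-1 * a n : C^o)).
Proof.
move=> [c [k [c0 k0 ak]]].
have nE n : `|n`!%:R^-1 * a n| <= realC (c * (k ^+ n / n`!%:R)).
  rewrite normrM ger0_norm ?invr_ge0 ?ler0n // mulrC.
  apply: le_trans (ler_wpM2r _ (ak n)) _; first by rewrite invr_ge0 ler0n.
  by rewrite mulrA [in leRHS]rmorphM /= fmorphV /= rmorph_nat.
have reC : cvgn (series (fun n => complex.Re (n`!%:R^-1 * a n))).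
  apply: (real_dom_cvg c0 k0) => n.
  by rewrite -lecR (le_trans (Re_le_norm _)).
have imC : cvgn (series (fun n => complex.Im (n`!%:R^-1 * a n))).
  apply: (real_dom_cvg c0 k0) => n.
  by rewrite -lecR (le_trans (Im_le_norm _)).
apply/cvg_ex; eexists; apply: cvg_complex.
  rewrite (_ : (fun n => _) = series (fun n => complex.Re (n`!%:R^-1 * a n))); first exact: reC.
  by apply/funext => n; rewrite /series /= Re_sum.
rewrite (_ : (fun n => _) = series (fun n => complex.Im (n`!%:R^-1 * a n))); first exact: imC.
by apply/funext => n; rewrite /series /= Im_sum.
Qed.

Lemma cauchy_prod (a b : nat -> C) : geom_bounded a -> geom_bounded b ->
  series (fun k => k`!%:R^-1 * (\sum_(n < k.+1) 'C(k, n)%:R * (a n * b (k - n)%N)) : C^o) @ \oo -->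
  (limn (series (fun n => n`!%:R^-1 * a n : C^o)) * limn (series (fun n => n`!%:R^-1 * b n : C^o)) : C^o).
Proof.
move=> ha hb; have cva := exp_series_cvg ha; have cvb := exp_series_cvg hb.
set al := fun n => _ in cva *; set be := fun n => _ in cvb *.
pose D n m : C := `|al n| * `|be m|.
pose d k : C := \sum_(n < k.+1) D n (k - n)%N.
have gE k : k`!%:R^-1 * (\sum_(n < k.+1) 'C(k, n)%:R * (a n * b (k - n)%N)) =
    \sum_(n < k.+1) al n * be (k - n)%N.
  rewrite mulr_sumr; apply: eq_bigr => n _; have nk : (n <= k)%N by rewrite -ltnS.
  rewrite /al /be -(bin_fact nk) !natrM.
  have f0 (m : nat) : m`!%:R != 0 :> C by rewrite pnatr_eq0 -lt0n fact_gt0.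
  have b0 : 'C(k, n)%:R != 0 :> C by rewrite pnatr_eq0 -lt0n bin_gt0.
  by field; rewrite !f0 b0.
have cvd : cvgn (series (d : nat -> C^o)).
  have [c1 [k1 [c10 k10 h1]]] := ha; have [c2 [k2 [c20 k20 h2]]] := hb.
  pose e k : C := k`!%:R * d k.
  rewrite (_ : d = fun k => k`!%:R^-1 * e k); last first.
    by apply/funext => k; rewrite /e mulrA mulVf ?mul1r // pnatr_eq0 -lt0n fact_gt0.
  (* By the binomial theorem [k!] times the [k]-th absolute term is again geometrically bounded,
     with ratio the sum of the two ratios. *)
  apply: exp_series_cvg; exists (c1 * c2), (k1 + k2); split; [exact: mulr_ge0|exact: addr_ge0|].
  move=> k; have al_ge0 : 0 <= e k.
    by rewrite mulr_ge0 ?ler0n // sumr_ge0 // => n _; rewrite mulr_ge0.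
  rewrite ger0_norm // /e /d mulr_sumr.
  have -> : realC (c1 * c2 * (k1 + k2) ^+ k) = \sum_(n < k.+1)
      'C(k, n)%:R * (realC (c1 * k1 ^+ n) * realC (c2 * k2 ^+ (k - n))).
    rewrite [k1 + k2]addrC exprDn mulr_sumr rmorph_sum; apply: eq_bigr => n _ /=.
    rewrite -(rmorph_nat (real_complex R)) -!rmorphM /=; congr (real_complex R _).
    by rewrite -[_ *+ _]mulr_natl; ring.
  apply: ler_sum => n _; have nk : (n <= k)%N by rewrite -ltnS.
  have f0 (m : nat) : m`!%:R != 0 :> C by rewrite pnatr_eq0 -lt0n fact_gt0.
  have nf (m : nat) : `|m`!%:R^-1| = m`!%:R^-1 :> C by rewrite ger0_norm // invr_ge0 ler0n.
  rewrite /D /al /be !normrM !nf.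
  have -> : k`!%:R * (n`!%:R^-1 * `|a n| * ((k - n)`!%:R^-1 * `|b (k - n)%N|)) =
      'C(k, n)%:R * (`|a n| * `|b (k - n)%N|) :> C.
    by rewrite -(bin_fact nk) !natrM; field; rewrite !f0.
  by apply: ler_wpM2l; rewrite ?ler0n //; apply: ler_pM.
have -> : (fun k => k`!%:R^-1 * (\sum_(n < k.+1) 'C(k, n)%:R * (a n * b (k - n)%N))) =
  (fun k => \sum_(n < k.+1) al n * be (k - n)%N) by apply/funext.
exact: (@cvg_cauchy_prod C al be _ _ cva cvb cvd).
Qed.

End ComplexSeries.

(** * Binomial sums *)

Section Pascal.
Context {K : comPzRingType}.

Lemma sum_binS (k : nat) (f : nat -> nat -> K) :
  \sum_(n < k.+2) 'C(k.+1, n)%:R * f n (k.+1 - n)%N =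
  \sum_(n < k.+1) 'C(k, n)%:R * (f n.+1 (k - n)%N + f n (k - n).+1).
Proof.
under [RHS]eq_bigr do rewrite mulrDr.
rewrite big_split /= [LHS]big_ord_recl /= bin0 subn0.
under eq_bigr => n _ do rewrite /bump /= add1n binS subSS natrD mulrDl.
rewrite big_split /= addrA addrC; congr (_ + _).
rewrite big_ord_recr /= bin_small // mul0r addr0.
rewrite [RHS]big_ord_recl /= bin0 subn0; congr (_ + _).
by apply: eq_bigr => n _; rewrite /bump /= add1n -subSn.
Qed.

(** The binomial expansion of the [k]-th power of [X (x) 1 + 1 (x) X]. In [t n1 m1 n2 m2] the
    numbers [n1], [n2] count the powers on the left of the two tensor factors and [m1], [m2] those
    on the right; the hypothesis carries one power across. *)
Lemma sum_bin_comm (t : nat -> nat -> nat -> nat -> K) :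
  (forall n1 m1 n2 m2, t n1.+1 m1 n2 m2 + t n1 m1 n2.+1 m2 =
                       t n1 m1.+1 n2 m2 + t n1 m1 n2 m2.+1) ->
  forall k m1 m2, \sum_(n < k.+1) 'C(k, n)%:R * t n m1 (k - n)%N m2 =
    \sum_(n < k.+1) 'C(k, n)%:R * t 0%N (m1 + n)%N 0%N (m2 + (k - n))%N.
Proof.
move=> ht; elim=> [|k IH] m1 m2; first by rewrite !big_ord1 !addn0.
rewrite (sum_binS k (fun n n' => t n m1 n' m2)).
rewrite (sum_binS k (fun n n' => t 0%N (m1 + n)%N 0%N (m2 + n')%N)).
transitivity (\sum_(n < k.+1) 'C(k, n)%:R * t n m1.+1 (k - n)%N m2 +
              \sum_(n < k.+1) 'C(k, n)%:R * t n m1 (k - n)%N m2.+1).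
  by rewrite -big_split; apply: eq_bigr => n _; rewrite ht mulrDr.
rewrite !IH -big_split; apply: eq_bigr => n _ /=.
by rewrite -mulrDr addSnnS addnS addSn addnS.
Qed.

End Pascal.

(** * Growth of powers and the commuting tensor *)

Section Growth.
Context {R : realType} {N : nat} (F : clifford_fock R N).
Local Notation C := R[i].
Local Notation mode := ('I_N * int)%type.
Local Notation Cl := (clif F).

Definition gen (w : bool * mode) : Cl := if w.1 then psi F w.2.1 w.2.2 else psis F w.2.1 w.2.2.

Lemma gen_anti w w' : exists c : C, gen w * gen w' + gen w' * gen w = c *: 1.
Proof.
rewrite /gen; case: (w.1); case: (w'.1).
- by exists 0; rewrite psi_psi scale0r.
- by eexists; rewrite psi_psis -scaler_nat.
- by eexists; rewrite addrC psi_psis -scaler_nat.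
- by exists 0; rewrite psis_psis scale0r.
Qed.

Lemma gen_sqr w : gen w * gen w = 0.
Proof.
have : gen w * gen w + gen w * gen w = 0.
  by rewrite /gen; case: (w.1); [exact: psi_psi|exact: psis_psis].
by rewrite -mulr2n -scaler_nat => /eqP; rewrite scaler_eq0 pnatr_eq0 /= => /eqP.
Qed.

(** The smallest linear set containing [E], encoded by its induction principle; coefficients are
    extracted only once, in [in_span_coef]. *)
Definition in_span (E : seq Cl) (x : Cl) : Prop := forall P : Cl -> Prop,
  P 0 -> (forall c y z, P y -> P z -> P (c *: y + z)) -> (forall e, e \in E -> P e) -> P x.

Lemma in_span_lin E c x y : in_span E x -> in_span E y -> in_span E (c *: x + y).
Proof. by move=> hx hy P P0 PD PE; apply: (PD); [exact: (hx P P0 PD PE)|exact: (hy P P0 PD PE)]. Qed.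

Lemma in_span0 E : in_span E 0.
Proof. by move=> P P0. Qed.

Lemma in_span_mem E e : e \in E -> in_span E e.
Proof. by move=> eE P P0 PD PE; exact: PE. Qed.

Lemma in_spanZ E c x : in_span E x -> in_span E (c *: x).
Proof. by move=> hx; rewrite -[_ *: _]addr0; apply: in_span_lin => //; exact: in_span0. Qed.

Lemma in_spanD E x y : in_span E x -> in_span E y -> in_span E (x + y).
Proof. by move=> hx hy; rewrite -[x]scale1r; exact: in_span_lin. Qed.

Lemma in_span_mull E E' w x : in_span E x ->
  (forall e, e \in E -> in_span E' (w * e)) -> in_span E' (w * x).
Proof.
move=> hx hE; apply: (hx (fun x => in_span E' (w * x))) => [|c y z hy hz|//]; first by rewrite mulr0; exact: in_span0.
by rewrite mulrDr -scalerAr; exact: in_span_lin.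
Qed.

(* Left multiplication by finitely many generators preserves a finite-dimensional
   space containing 1, which bounds the matrix elements of powers of [bilin S]. *)
Lemma gens_span (gs : seq (bool * mode)) : exists E : seq Cl,
  1 \in E /\ forall w, w \in gs -> forall e, e \in E -> in_span E (gen w * e).
Proof.
elim: gs => [|w gs [E [E1 hE]]]; first by exists [:: 1]; rewrite inE.
(* [gen w] squares to zero and passes the other generators up to sign and a scalar, so in each word
   it is needed at most once, and then at the front. *)
pose E' := E ++ [seq gen w * e | e <- E]; exists E'.
have sub e : in_span E e -> in_span E' e.
  move=> h P P0 PD PE; apply: (h P) => // e' e'E; apply: PE.
  by rewrite mem_cat e'E.
have wE e : e \in E -> in_span E' (gen w * e).
  by move=> eE; apply: in_span_mem; rewrite mem_cat map_f ?orbT.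
split; first by rewrite mem_cat E1.
move=> w' w'gs e; rewrite mem_cat => /orP[eE|/mapP[e' e'E ->]].
  by move: w'gs; rewrite inE => /orP[/eqP->|w'gs]; [exact: wE|exact: (sub _ (hE _ w'gs _ eE))].
move: w'gs; rewrite inE => /orP[/eqP->|w'gs].
  by rewrite mulrA gen_sqr mul0r; exact: in_span0.
have [c /(canRL (addrK _)) cE] := gen_anti w' w.
rewrite mulrA cE mulrBl addrC -mulNr -scaleN1r -scalerAl.
apply: in_span_lin; last by rewrite -scalerAl mul1r; apply: in_spanZ; apply: sub; exact: in_span_mem.
by rewrite -mulrA; exact: (in_span_mull (hE _ w'gs _ e'E) wE).
Qed.

Lemma in_span_coef E x : in_span E x ->
  exists c : nat -> C, x = \sum_(i < size E) c i *: E`_i.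
Proof.
move=> h; apply: (h (fun x => exists c : nat -> C, x = \sum_(i < size E) c i *: E`_i));
  [|move=> c y z [cy ->] [cz ->]|move=> e eE].
- by exists (fun=> 0); rewrite big1 // => i _; rewrite scale0r.
- exists (fun i => c * cy i + cz i); rewrite scaler_sumr -big_split; apply: eq_bigr => i _ /=.
  by rewrite scalerDl scalerA.
have ie : (index e E < size E)%N by rewrite index_mem.
exists (fun i => (i == index e E)%:R); rewrite (bigD1 (Ordinal ie)) //= eqxx scale1r nth_index //.
rewrite big1 ?addr0 // => i ii; case: eqP => [e'|_]; last by rewrite scale0r.
by case/negP: ii; apply/eqP/val_inj.
Qed.

Variable A : 'I_N -> 'I_N -> int -> int -> C.

Lemma bilin_span S : exists E : seq Cl,
  1 \in E /\ forall e, e \in E -> in_span E (bilin F A S * e).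
Proof.
have [E [E1 hE]] := gens_span (flatten [seq [:: (false, p.1); (true, p.2)] | p <- S]).
exists E; split=> // e eE; rewrite /bilin mulr_suml big_seq.
apply: (big_ind (in_span E)); [exact: in_span0|exact: in_spanD|move=> p pS].
rewrite -scalerAl -mulrA; apply: in_spanZ.
have h1 : (false, p.1) \in flatten [seq [:: (false, p.1); (true, p.2)] | p <- S].
  by apply/flatten_mapP; exists p; rewrite // !inE eqxx.
have h2 : (true, p.2) \in flatten [seq [:: (false, p.1); (true, p.2)] | p <- S].
  by apply/flatten_mapP; exists p; rewrite // !inE eqxx orbT.
exact: (in_span_mull (hE _ h2 _ eE) (hE _ h1)).
Qed.

Lemma pairing_lact_lin (u : dual F) (v : fock F) : scalar (fun x : Cl => pairing u (lact x v)).
Proof. by move=> c x y; rewrite lact_linearl pairing_linear. Qed.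

(** On the span of [E] left multiplication by [X] is given by a matrix [M]. The sum [T n] of the
    absolute values of the matrix elements over [E] grows at each step by at most the factor [k],
    the sum of the absolute values of the entries of [M]. *)
Lemma bilin_growth S (u : dual F) (v : fock F) :
  geom_bounded (fun n => pairing u (lact (bilin F A S ^+ n) v)).
Proof.
have [E [E1 hE]] := bilin_span S; set X := bilin F A S in hE *.
have /choice[M hM] : forall i : 'I_(size E), exists c : nat -> C, X * E`_i = \sum_(j < size E) c j *: E`_j.
  by move=> i; apply: in_span_coef; apply: hE; exact: mem_nth.
pose f (x : Cl) := pairing u (lact x v).
have f_sum (c : nat -> C) (Y : Cl) : f (Y * \sum_(j < size E) c j *: E`_j) =
    \sum_(j < size E) c j * f (Y * E`_j).
  rewrite mulr_sumr; elim/big_rec2: _ => [|j x y _ <-].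
    by have := pairing_lact_lin u v (-1) 0 0; rewrite /f scaleN1r addNr => ->; rewrite mulN1r addNr.
  by rewrite -scalerAr /f pairing_lact_lin.
pose T n := \sum_(i < size E) `|f (X ^+ n * E`_i)|.
pose k := \sum_(i < size E) \sum_(j < size E) `|M i j|.
have k0 : 0 <= k by apply: sumr_ge0 => i _; exact: sumr_ge0.
have T0 n : 0 <= T n by exact: sumr_ge0.
have TS n : T n.+1 <= k * T n.
  rewrite /T /k mulr_suml; apply: ler_sum => i _.
  rewrite exprSr -mulrA hM f_sum; apply: le_trans (ler_norm_sum _ _ _) _.
  rewrite mulr_suml; apply: ler_sum => j _; rewrite normrM; apply: ler_wpM2l => //.
  by rewrite (bigD1 j) //= lerDl sumr_ge0.
have Tk n : T n <= T 0%N * k ^+ n.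
  elim: n => [|n IH]; first by rewrite expr0 mulr1.
  by apply: le_trans (TS n) _; rewrite exprS mulrCA; exact: ler_wpM2l.
exists (complex.Re (T 0%N)), (complex.Re k); split.
- by have := T0 0%N; rewrite lecE => /andP[].
- by move: k0; rewrite lecE => /andP[].
move=> n; rewrite rmorphM rmorphXn /= !RRe_real ?ger0_real //.
apply: le_trans _ (Tk n); rewrite /T.
have i1 : (index 1%R E < size E)%N by rewrite index_mem.
by rewrite (bigD1 (Ordinal i1)) //= nth_index // mulr1 lerDl sumr_ge0.
Qed.

Definition ecomm (x y : Cl) := x * y - y * x.

Lemma mode_comm_psi (p q : mode) a m :
  ecomm (psis F p.1 p.2 * psi F q.1 q.2) (psi F a m) =
  - (psi F q.1 q.2 *+ ((a == p.1) && (m == p.2))).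
Proof.
rewrite /ecomm -mulrA; have /eqP := psi_psi F q.1 a q.2 m; rewrite addr_eq0 => /eqP ->.
rewrite mulrN [psis F _ _ * (_ * _)]mulrA; have /(canRL (addKr _)) -> := psi_psis F a p.1 m p.2.
rewrite mulrDl mulNr opprD opprK mulrA addrAC subrr add0r.
by case: (_ && _); rewrite ?mulr0n ?mul0r // mul1r.
Qed.

Lemma mode_comm_psis (p q : mode) a m :
  ecomm (psis F p.1 p.2 * psi F q.1 q.2) (psis F a m) =
  psis F p.1 p.2 *+ ((a == q.1) && (m == q.2)).
Proof.
rewrite /ecomm -mulrA; have /(canRL (addrK _)) -> := psi_psis F q.1 a q.2 m.
rewrite mulrBr !mulrA; have /eqP := psis_psis F p.1 a p.2 m; rewrite addr_eq0 => /eqP ->.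
rewrite mulNr opprK addrK eq_sym (eq_sym q.2).
by case: (_ && _); rewrite ?mulr1n ?mulr0n ?mulr0 // mulr1.
Qed.

Lemma scalar_lin (f : Cl -> C) : scalar f ->
  [/\ f 0 = 0, forall x, f (- x) = - f x & forall x y, f (x + y) = f x + f y].
Proof.
move=> hf; have f0 : f 0 = 0 by have := hf (-1) 0 0; rewrite scaleN1r addNr mulN1r addNr.
split=> // [x|x y]; last by have := hf 1 x y; rewrite scale1r mul1r.
by have := hf (-1) x 0; rewrite scaleN1r !addr0 f0 addr0 mulN1r.
Qed.

(* [sum psi (x) psis] commutes with [x (x) 1 + 1 (x) x] for [x = bilin S]. *)
Lemma casimir_comm S B (f h : Cl -> C) : scalar f -> scalar h ->
  (forall p, p \in S -> `|p.1.2| <= B%:Z /\ `|p.2.2| <= B%:Z) ->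
  let X := bilin F A S in
  \sum_a wsum B (fun j => f (X * psi F a j) * h (psis F a j) + f (psi F a j) * h (X * psis F a j)) =
  \sum_a wsum B (fun j => f (psi F a j * X) * h (psis F a j) + f (psi F a j) * h (psis F a j * X)).
Proof.
move=> hf hh hS X; have [f0 fN fD] := scalar_lin hf; have [h0 hN hD] := scalar_lin hh.
pose D x : C := \sum_a wsum B (fun j => f (ecomm x (psi F a j)) * h (psis F a j) +
   f (psi F a j) * h (ecomm x (psis F a j))).
have Dlin c x y : D (c *: x + y) = c * D x + D y.
  rewrite /D mulr_sumr -big_split; apply: eq_bigr => a _ /=.
  rewrite mulr_sumr -big_split; apply: eq_bigr => i _ /=.
  have ecommE z : ecomm (c *: x + y) z = c *: ecomm x z + ecomm y z.
    rewrite /ecomm mulrDl mulrDr -scalerAl -scalerAr scalerBr opprD addrACA.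
    by [].
  by rewrite !ecommE hf hh; ring.
have D0 : D 0 = 0 by have := Dlin (-1) 0 0; rewrite scaleN1r addNr mulN1r addNr.
suff DX : D X = 0.
  apply/eqP; rewrite -subr_eq0 -sumrB -[X in _ == X]DX /D; apply/eqP/eq_bigr => a _.
  rewrite -sumrB; apply: eq_bigr => i _; rewrite /ecomm !fD !fN !hD !hN; ring.
rewrite /X /bilin big_seq.
apply: (big_ind (fun x => D x = 0)) => // [x y Dx Dy|p pS].
  by rewrite -[x]scale1r Dlin Dx Dy mulr0 addr0.
suff Dp : D (psis F p.1.1 p.1.2 * psi F p.2.1 p.2.2) = 0.
  by rewrite -[_ *: _]addr0 Dlin D0 Dp mulr0 addr0.
have [p1B p2B] := hS _ pS.
(* The commutator with [psi] survives only at the mode [p.1], that with [psis] only at [p.2]. Both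
   leave the tensor of [psi] at [p.2] with [psis] at [p.1], with opposite signs; the window must
   contain both modes. *)
rewrite /D; transitivity (\sum_a (
   wsum B (fun j => (- (f (psi F p.2.1 p.2.2) * h (psis F a j)) *+ (a == p.1.1)) *+ (j == p.1.2)) +
   wsum B (fun j => (f (psi F a j) * h (psis F p.1.1 p.1.2) *+ (a == p.2.1)) *+ (j == p.2.2)))).
  apply: eq_bigr => a _; rewrite -wsumD; apply: eq_wsum => j.
  rewrite mode_comm_psi mode_comm_psis fN; congr (_ + _).
    case: (a == _); case: (j == _); by rewrite /= ?mulr1n ?mulr0n ?mul0rn ?f0 ?oppr0 ?mul0r ?mulNr.
  by case: (a == _); case: (j == _); rewrite /= ?mulr1n ?mulr0n ?mul0rn ?h0 ?mulr0.
under eq_bigr => a _ do rewrite !wsum1 //.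
rewrite big_split /= (bigD1 p.1.1) //= eqxx mulr1n big1 => [|a /negPf->]; last by rewrite mulr0n.
rewrite (bigD1 p.2.1) //= eqxx mulr1n big1 => [|a /negPf->]; last by rewrite mulr0n.
by rewrite !addr0 addNr.
Qed.

End Growth.

(** * Limits of linear combinations and of sums of products *)

Section LimSeries.
Context {K : numFieldType}.

Lemma cvg_series_lin (f g : nat -> K^o) (c A B : K^o) :
  series f @ \oo --> A -> series g @ \oo --> B ->
  series ((fun n => c * f n + g n) : nat -> K^o) @ \oo --> (c * A + B : K^o).
Proof.
move=> fA gB; rewrite (_ : series _ = (c \*: series f) + series g).
  by apply: cvgD => //; exact: cvgZl_tmp.
apply/funext => n; rewrite /series /=.
by rewrite big_split -mulr_sumr.
Qed.

Lemma cvg_series_sum (I : Type) (r : seq I) (f : I -> nat -> K^o) (A : I -> K^o) :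
  (forall i, series (f i) @ \oo --> A i) ->
  series ((fun n => \sum_(i <- r) f i n) : nat -> K^o) @ \oo --> (\sum_(i <- r) A i : K^o).
Proof.
move=> h; elim: r => [|i r IH].
  rewrite big_nil (_ : series _ = cst 0); first exact: cvg_cst.
  by apply/funext => n; rewrite /series /= big1 // => k _; rewrite big_nil.
rewrite big_cons -[A i]mul1r (_ : (fun n => _) = fun n => 1 * f i n + \sum_(j <- r) f j n).
  exact: cvg_series_lin.
by apply/funext => n; rewrite big_cons mul1r.
Qed.

Lemma cvg_lin (T : Type) (G : set_system T) {FG : Filter G} (f g : T -> K^o) (c A B : K^o) :
  f @ G --> A -> g @ G --> B -> (fun x => c * f x + g x : K^o) @ G --> (c * A + B : K^o).
Proof. by move=> fA gB; apply: cvgD => //; exact: cvgZl_tmp. Qed.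

Lemma cvg_sum_prod (T : Type) (G : set_system T) {FG : Filter G} (I : Type) (r : seq I)
    (f g : I -> T -> K^o) (A B : I -> K^o) :
  (forall i, f i @ G --> A i) -> (forall i, g i @ G --> B i) ->
  (fun x => \sum_(i <- r) f i x * g i x : K^o) @ G --> (\sum_(i <- r) A i * B i : K^o).
Proof.
move=> hf hg; elim: r => [|i r IH].
  rewrite big_nil (_ : (fun x => _) = cst 0); first exact: cvg_cst.
  by apply/funext => x; rewrite big_nil.
rewrite big_cons (_ : (fun x => _) = (fun x => f i x * g i x + \sum_(j <- r) f j x * g j x)).
  by apply: cvgD => //; apply: cvgM.
by apply/funext => x; rewrite big_cons.
Qed.

End LimSeries.

(** * Matrix elements of [g] and the fermionic actions *)

Section GElement.
Context {R : realType} {N : nat} (F : clifford_fock R N).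
Local Notation C := R[i].
Variable A : 'I_N -> 'I_N -> int -> int -> C.
Implicit Types (u : dual F) (v : fock F).
Local Notation mode := ('I_N * int)%type.

Definition expm (S : {fset mode * mode}) u v : C := exp_mx (bilin F A S) u v.

Lemma expm_cvg S u v : series (fun n : nat =>
    n`!%:R^-1 * pairing u (lact (bilin F A S ^+ n) v) : C^o) @ \oo --> (expm S u v : C^o).
Proof. exact: (exp_series_cvg (bilin_growth A S u v)). Qed.

Lemma expmE S u v (f : nat -> C) (l : C) :
  (forall n, n`!%:R^-1 * pairing u (lact (bilin F A S ^+ n) v) = f n) ->
  series (f : nat -> C^o) @ \oo --> (l : C^o) -> expm S u v = l.
Proof.
move=> e fl; rewrite -(funext e) in fl.
by apply: (cvg_lim _ fl); exact: norm_hausdorff.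
Qed.

Lemma expm_linl S v c u u' : expm S (c *: u + u') v = c * expm S u v + expm S u' v.
Proof.
have H := @cvg_series_lin C _ _ c _ _ (@expm_cvg S u v) (@expm_cvg S u' v).
apply: (expmE _ H) => n.
by rewrite pairing_linearl; ring.
Qed.

Lemma lactD x v v' c : lact x (c *: v + v') = c *: lact x v + lact x v' :> fock F.
Proof. exact: lact_linear. Qed.

Lemma expm_linr S u c v v' : expm S u (c *: v + v') = c * expm S u v + expm S u v'.
Proof.
have H := @cvg_series_lin C _ _ c _ _ (@expm_cvg S u v) (@expm_cvg S u v').
apply: (expmE _ H) => n.
by rewrite lactD pairing_linear; ring.
Qed.

Hypothesis hg : g_defined F A.

Lemma g_cvg u v : (fun S => expm S u v : C^o) @ totally --> (g_mx A u v : C^o).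
Proof. exact: hg. Qed.

Lemma g_mxE u v (f : {fset mode * mode} -> C) (l : C) : (forall S, expm S u v = f S) ->
  (f : _ -> C^o) @ totally --> (l : C^o) -> g_mx A u v = l.
Proof.
move=> e fl; rewrite -(funext e) in fl.
by apply: (cvg_lim _ fl); exact: norm_hausdorff.
Qed.

Lemma g_linl v c u u' : g_mx A (c *: u + u') v = c * g_mx A u v + g_mx A u' v.
Proof.
have H := @cvg_lin C _ _ _ _ _ c _ _ (@g_cvg u v) (@g_cvg u' v).
by apply: (g_mxE _ (H _)) => S; exact: expm_linl.
Qed.

Lemma g_linr u c v v' : g_mx A u (c *: v + v') = c * g_mx A u v + g_mx A u v'.
Proof.
have H := @cvg_lin C _ _ _ _ _ c _ _ (@g_cvg u v) (@g_cvg u v').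
by apply: (g_mxE _ (H _)) => S; exact: expm_linr.
Qed.

Definition wpair (B : nat) (i : 'I_N * 'I_B.*2.+1) : mode := (i.1, (i.2 : nat)%:Z - B%:Z).

Lemma sum_wpair B (f : 'I_N -> int -> C) :
  \sum_a wsum B (f a) = \sum_(i <- enum {: 'I_N * 'I_B.*2.+1}) f (wpair i).1 (wpair i).2.
Proof. by rewrite /wsum pair_bigA big_enum. Qed.

Lemma bilinear_fin S B u v u' v' :
  (forall p, p \in S -> `|p.1.2| <= B%:Z /\ `|p.2.2| <= B%:Z) ->
  \sum_a wsum B (fun j => expm S (ract u (psi F a j)) v * expm S (ract u' (psis F a j)) v') =
  \sum_a wsum B (fun j => expm S u (lact (psi F a j) v) * expm S u' (lact (psis F a j) v')).
Proof.
move=> hS; rewrite !sum_wpair; set X := bilin F A S.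
(* The powers of [X] on either side of the two fermions are separate arguments, so that
   [casimir_comm] becomes the hypothesis of [sum_bin_comm]. The two Cauchy products are the cases
   with all powers on the right and all on the left. *)
pose t n1 m1 n2 m2 := \sum_a wsum B (fun j =>
   pairing u (lact (X ^+ n1 * psi F a j * X ^+ m1) v) *
   pairing u' (lact (X ^+ n2 * psis F a j * X ^+ m2) v')).
have ht n1 m1 n2 m2 : t n1.+1 m1 n2 m2 + t n1 m1 n2.+1 m2 = t n1 m1.+1 n2 m2 + t n1 m1 n2 m2.+1.
  pose f x := pairing u (lact (X ^+ n1 * x * X ^+ m1) v).
  pose h x := pairing u' (lact (X ^+ n2 * x * X ^+ m2) v').
  have fs : scalar f.
    by move=> c x y; rewrite /f mulrDr mulrDl -scalerAr -scalerAl pairing_lact_lin.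
  have hs : scalar h.
    by move=> c x y; rewrite /h mulrDr mulrDl -scalerAr -scalerAl pairing_lact_lin.
  have := @casimir_comm _ _ F A S B f h fs hs hS; rewrite -/X /t -!big_split /= => e.
  transitivity (\sum_a wsum B (fun j => f (X * psi F a j) * h (psis F a j) + f (psi F a j) * h (X * psis F a j))).
    apply: eq_bigr => a _; rewrite -wsumD; apply: eq_wsum => j.
    by rewrite /f /h !exprSr !mulrA.
  rewrite e; apply: eq_bigr => a _; rewrite -wsumD; apply: eq_wsum => j.
  by rewrite /f /h !exprS !mulrA.
pose a1 (i : 'I_N * 'I_B.*2.+1) n := pairing u (lact (psi F (wpair i).1 (wpair i).2 * X ^+ n) v).
pose b1 (i : 'I_N * 'I_B.*2.+1) n := pairing u' (lact (psis F (wpair i).1 (wpair i).2 * X ^+ n) v').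
pose a2 (i : 'I_N * 'I_B.*2.+1) n := pairing u (lact (X ^+ n * psi F (wpair i).1 (wpair i).2) v).
pose b2 (i : 'I_N * 'I_B.*2.+1) n := pairing u' (lact (X ^+ n * psis F (wpair i).1 (wpair i).2) v').
pose cc (a b : nat -> C) k := k`!%:R^-1 * (\sum_(n < k.+1) 'C(k, n)%:R * (a n * b (k - n)%N)).
have H1 i : series (cc (a1 i) (b1 i) : nat -> C^o) @ \oo -->
   (expm S (ract u (psi F (wpair i).1 (wpair i).2)) v * expm S (ract u' (psis F (wpair i).1 (wpair i).2)) v' : C^o).
  rewrite /cc (_ : a1 i = fun n => pairing (ract u (psi F (wpair i).1 (wpair i).2)) (lact (X ^+ n) v)).
    rewrite (_ : b1 i = fun n => pairing (ract u' (psis F (wpair i).1 (wpair i).2)) (lact (X ^+ n) v')).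
      exact: (cauchy_prod (bilin_growth _ _ _ _) (bilin_growth _ _ _ _)).
    by apply/funext => n; rewrite /b1 pairing_act lactM.
  by apply/funext => n; rewrite /a1 pairing_act lactM.
have H2 i : series (cc (a2 i) (b2 i) : nat -> C^o) @ \oo -->
   (expm S u (lact (psi F (wpair i).1 (wpair i).2) v) * expm S u' (lact (psis F (wpair i).1 (wpair i).2) v') : C^o).
  rewrite /cc (_ : a2 i = fun n => pairing u (lact (X ^+ n) (lact (psi F (wpair i).1 (wpair i).2) v))).
    rewrite (_ : b2 i = fun n => pairing u' (lact (X ^+ n) (lact (psis F (wpair i).1 (wpair i).2) v'))).
      exact: (cauchy_prod (bilin_growth _ _ _ _) (bilin_growth _ _ _ _)).
    by apply/funext => n; rewrite /b2 lactM.
  by apply/funext => n; rewrite /a2 lactM.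
have := @cvg_series_sum C _ (enum {: 'I_N * 'I_B.*2.+1}) _ _ H1.
have := @cvg_series_sum C _ (enum {: 'I_N * 'I_B.*2.+1}) _ _ H2.
rewrite (_ : (fun n => \sum_(i <- _) cc (a1 i) (b1 i) n) = (fun n => \sum_(i <- enum {: 'I_N * 'I_B.*2.+1}) cc (a2 i) (b2 i) n)).
  by move=> h2 h1; apply: (cvg_unique _ h1 h2); exact: norm_hausdorff.
apply/funext => k; rewrite /cc -!mulr_sumr; congr (_ * _).
rewrite exchange_big [RHS]exchange_big /=.
transitivity (\sum_(n < k.+1) 'C(k, n)%:R * t 0%N n 0%N (k - n)%N).
  apply: eq_bigr => n _; rewrite /t sum_wpair mulr_sumr; apply: eq_bigr => i _.
  by rewrite /a1 /b1 !expr0 !mul1r.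
rewrite -[LHS](@sum_bin_comm C t ht k 0%N 0%N).
apply: eq_bigr => n _; rewrite /t sum_wpair mulr_sumr; apply: eq_bigr => i _.
by rewrite /a2 /b2 !expr0 !mulr1.
Qed.

Lemma lact0 (x : clif F) : lact x 0 = 0.
Proof. by have := lact_linear x (-1) 0 0; rewrite !scaleN1r !addNr. Qed.
Lemma ract0 (x : clif F) : ract 0 x = 0.
Proof. by have := ract_linearl x (-1) 0 0; rewrite !scaleN1r !addNr. Qed.
Lemma lactDl (x y : clif F) v : lact (x + y) v = lact x v + lact y v.
Proof. by have := lact_linearl v 1 x y; rewrite !scale1r. Qed.
Lemma ractDr (x y : clif F) u : ract u (x + y) = ract u x + ract u y.
Proof. by have := ract_linear u 1 x y; rewrite !scale1r. Qed.
Lemma lact0l v : lact 0 v = 0.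
Proof. by have := lact_linearl v (-1) 0 0; rewrite !scaleN1r !addNr. Qed.
Lemma ract0r u : ract u 0 = 0.
Proof. by have := ract_linear u (-1) 0 0; rewrite !scaleN1r !addNr. Qed.
Lemma lactNl (x : clif F) v : lact (- x) v = - lact x v.
Proof. by have := lact_linearl v (-1) x 0; rewrite !scaleN1r lact0l !addr0. Qed.
Lemma ractNr (x : clif F) u : ract u (- x) = - ract u x.
Proof. by have := ract_linear u (-1) x 0; rewrite !scaleN1r ract0r !addr0. Qed.

Definition kpsi a j v := lact (psi F a j) v.
Definition kpsis a j v := lact (psis F a j) v.
Definition bpsi a j u := ract u (psi F a j).
Definition bpsis a j u := ract u (psis F a j).

Lemma kpsi_psis a b j k v :
  kpsi b k (kpsis a j v) + kpsis a j (kpsi b k v) = v *+ ((a == b) && (j == k)).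
Proof.
rewrite /kpsi /kpsis -!lactM -lactDl psi_psis eq_sym (eq_sym k).
by case: (_ && _); rewrite ?mulr1n ?mulr0n ?lact0l // lact1.
Qed.
Lemma kpsi_anti a b j k v : kpsi a j (kpsi b k v) = - kpsi b k (kpsi a j v).
Proof.
by rewrite /kpsi -!lactM -lactNl; congr (lact _ v); apply/eqP; rewrite -addr_eq0 psi_psi.
Qed.
Lemma kpsis_anti a b j k v : kpsis a j (kpsis b k v) = - kpsis b k (kpsis a j v).
Proof.
by rewrite /kpsis -!lactM -lactNl; congr (lact _ v); apply/eqP; rewrite -addr_eq0 psis_psis.
Qed.
Lemma bpsi_psis a b j k u :
  bpsis b k (bpsi a j u) + bpsi a j (bpsis b k u) = u *+ ((a == b) && (j == k)).
Proof.
rewrite /bpsi /bpsis -!ractM -ractDr psi_psis.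
by case: (_ && _); rewrite ?mulr1n ?mulr0n ?ract0r // ract1.
Qed.
Lemma bpsi_anti a b j k u : bpsi a j (bpsi b k u) = - bpsi b k (bpsi a j u).
Proof.
by rewrite /bpsi -!ractM -ractNr; congr (ract u _); apply/eqP; rewrite -addr_eq0 psi_psi.
Qed.
Lemma bpsis_anti a b j k u : bpsis a j (bpsis b k u) = - bpsis b k (bpsis a j u).
Proof.
by rewrite /bpsis -!ractM -ractNr; congr (ract u _); apply/eqP; rewrite -addr_eq0 psis_psis.
Qed.

Definition kfin v := exists M : nat,
  (forall a j, M%:Z <= j -> kpsis a j v = 0) /\ (forall a j, j < - M%:Z -> kpsi a j v = 0).
Definition bfin u := exists M : nat,
  (forall a j, M%:Z <= j -> bpsi a j u = 0) /\ (forall a j, j < - M%:Z -> bpsis a j u = 0).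

Lemma kpsi_lin a j : linear (kpsi a j).
Proof. exact: lact_linear. Qed.
Lemma kpsis_lin a j : linear (kpsis a j).
Proof. exact: lact_linear. Qed.
Lemma bpsi_lin a j : linear (bpsi a j).
Proof. exact: ract_linearl. Qed.
Lemma bpsis_lin a j : linear (bpsis a j).
Proof. exact: ract_linearl. Qed.

(** The vacuum has this property and generates; one more generator disturbs only the mode that pairs
    with it, so the bound [M] is enlarged past that mode. *)
Lemma kfin_all v : kfin v.
Proof.
have [x ->] := fock_gen v; have H0 : kfin (vac F).
  by exists 0%N; split=> a j h; [exact: psis_vac|apply: psi_vac; rewrite oppr0 in h].
suff H y : forall v, kfin v -> kfin (lact y v) by exact: H.
apply: (clif_gen (P := fun y => forall v, kfin v -> kfin (lact y v))) => {x v H0}.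
- move=> b k v [M [h1 h2]]; exists (M + absz k).+1; split=> a j hj.
    have := kpsi_psis a b j k v; rewrite h1 ?lact0; last lia.
    rewrite /kpsi lact0 add0r (_ : j == k = false) ?andbF; last by apply/negbTE; lia.
    by rewrite mulr0n.
  by rewrite -[lact _ _]/(kpsi b k v) kpsi_anti h2 ?lact0 /kpsi ?lact0 ?oppr0 //; lia.
- move=> b k v [M [h1 h2]]; exists (M + absz k).+1; split=> a j hj.
    by rewrite -[lact _ _]/(kpsis b k v) kpsis_anti h1 /kpsis ?lact0 ?oppr0 //; lia.
  have := kpsi_psis b a k j v; rewrite h2; last lia.
  rewrite /kpsis lact0 addr0 (_ : k == j = false) ?andbF; last by apply/negbTE; lia.
  by rewrite mulr0n.
- by move=> v; rewrite lact1.
- move=> c x1 x2 hx hy v fv; have [M1 [h1 h2]] := hx _ fv; have [M2 [h3 h4]] := hy _ fv.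
  exists (M1 + M2)%N; rewrite lact_linearl; split=> a j hj.
    rewrite (kpsis_lin a j) h1 ?h3 ?scaler0 ?addr0 //; lia.
  rewrite (kpsi_lin a j) h2 ?h4 ?scaler0 ?addr0 //; lia.
- by move=> x1 x2 hx hy v fv; rewrite lactM; apply/hx/hy.
Qed.

Lemma bfin_all u : bfin u.
Proof.
have [x ->] := dual_gen u; have H0 : bfin (dvac F).
  by exists 0%N; split=> a j h; [exact: dvac_psi|apply: dvac_psis; rewrite oppr0 in h].
suff H y : forall u, bfin u -> bfin (ract u y) by exact: H.
apply: (clif_gen (P := fun y => forall u, bfin u -> bfin (ract u y))) => {x u H0}.
- move=> b k u [M [h1 h2]]; exists (M + absz k).+1; split=> a j hj.
    by rewrite -[ract _ _]/(bpsi b k u) bpsi_anti h1 /bpsi ?ract0 ?oppr0 //; lia.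
  have := bpsi_psis b a k j u; rewrite h2; last lia.
  rewrite /bpsi ract0 addr0 (_ : k == j = false) ?andbF; last by apply/negbTE; lia.
  by rewrite mulr0n.
- move=> b k u [M [h1 h2]]; exists (M + absz k).+1; split=> a j hj.
    have := bpsi_psis a b j k u; rewrite h1; last lia.
    rewrite /bpsis ract0 add0r (_ : j == k = false) ?andbF; last by apply/negbTE; lia.
    by rewrite mulr0n.
  by rewrite -[ract _ _]/(bpsis b k u) bpsis_anti h2 /bpsis ?ract0 ?oppr0 //; lia.
- by move=> u; rewrite ract1.
- move=> c x1 x2 hx hy u fu; have [M1 [h1 h2]] := hx _ fu; have [M2 [h3 h4]] := hy _ fu.
  exists (M1 + M2)%N; rewrite ract_linear; split=> a j hj.
    rewrite (bpsi_lin a j) h1 ?h3 ?scaler0 ?addr0 //; lia.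
  rewrite (bpsis_lin a j) h2 ?h4 ?scaler0 ?addr0 //; lia.
- by move=> x1 x2 hx hy u fu; rewrite ractM; apply/hy/hx.
Qed.

Lemma bra_rep : fermi_rep bpsi bpsis.
Proof.
split; [exact: bpsi_lin|exact: bpsis_lin|exact: bpsi_psis|exact: bpsi_anti|exact: bpsis_anti|].
exact: bfin_all.
Qed.

Lemma ket_rep : fermi_rep kpsis kpsi.
Proof.
split; [exact: kpsis_lin|exact: kpsi_lin|exact: kpsi_psis|exact: kpsis_anti|exact: kpsi_anti|].
exact: kfin_all.
Qed.

Lemma expm0l S v : expm S 0 v = 0.
Proof. by have := expm_linl S v (-1) 0 0; rewrite scaler0 addr0 mulN1r addNr. Qed.
Lemma expm0r S u : expm S u 0 = 0.
Proof. by have := expm_linr S u (-1) 0 0; rewrite scaler0 addr0 mulN1r addNr. Qed.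

(** [B0] must not depend on [S]. For each [S] the identity holds on a larger window containing its
    modes; [u] and [u'] cut the left side down to [B], [v] and [v'] the right side. The limit over
    [S] then passes through a fixed finite sum. *)
Lemma bilinear_g u v u' v' : exists B0 : nat, forall B, (B0 <= B)%N ->
  \sum_a wsum B (fun j => g_mx A (bpsi a j u) v * g_mx A (bpsis a j u') v') =
  \sum_a wsum B (fun j => g_mx A u (kpsi a j v) * g_mx A u' (kpsis a j v')).
Proof.
have [M1 [b1 _]] := bfin_all u; have [M2 [_ b2]] := bfin_all u'.
have [M3 [_ k3]] := kfin_all v; have [M4 [k4 _]] := kfin_all v'.
exists (M1 + M2 + M3 + M4)%N => B hB.
have key S : \sum_a wsum B (fun j => expm S (bpsi a j u) v * expm S (bpsis a j u') v') =
  \sum_a wsum B (fun j => expm S u (kpsi a j v) * expm S u' (kpsis a j v')).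
  pose B' := (B + \sum_(p <- S) (absz p.1.2 + absz p.2.2))%N.
  have hS p : p \in S -> `|p.1.2| <= B'%:Z /\ `|p.2.2| <= B'%:Z.
    move=> pS; have : (absz p.1.2 + absz p.2.2 <= \sum_(p <- S) (absz p.1.2 + absz p.2.2))%N.
      by rewrite (big_fsetD1 p pS) /= leq_addr.
    rewrite /B'; lia.
  have BB' : (B <= B')%N by exact: leq_addr.
  have := bilinear_fin u v u' v' hS.
  rewrite (eq_bigr (fun a => wsum B (fun j => expm S (bpsi a j u) v * expm S (bpsis a j u') v'))).
    move=> ->; apply: eq_bigr => a _; apply: wsum_widen => // j jB.
    have [Mj|jM] := leP M4%:Z j; first by rewrite -/(kpsis a j v') k4 // expm0r mulr0.
    by rewrite -/(kpsi a j v) k3 ?expm0r ?mul0r //; lia.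
  move=> a _; apply: wsum_widen => // j jB.
  have [Mj|jM] := leP M1%:Z j; first by rewrite -/(bpsi a j u) b1 // expm0l mul0r.
  by rewrite -/(bpsis a j u') b2 ?expm0l ?mulr0 //; lia.
have H1 := @cvg_sum_prod C _ (@totally (mode * mode)%type) _ _ (enum {: 'I_N * 'I_B.*2.+1}) _ _ _ _
  (fun i => @g_cvg (bpsi (wpair i).1 (wpair i).2 u) v) (fun i => @g_cvg (bpsis (wpair i).1 (wpair i).2 u') v').
have H2 := @cvg_sum_prod C _ (@totally (mode * mode)%type) _ _ (enum {: 'I_N * 'I_B.*2.+1}) _ _ _ _
  (fun i => @g_cvg u (kpsi (wpair i).1 (wpair i).2 v)) (fun i => @g_cvg u' (kpsis (wpair i).1 (wpair i).2 v')).
rewrite !sum_wpair.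
have {}H2 := H2 _; have {}H1 := H1 _.
rewrite (_ : (fun S => \sum_(i <- _) expm S u _ * expm S u' _) = (fun S => \sum_(i <- enum {: 'I_N * 'I_B.*2.+1})
   expm S (bpsi (wpair i).1 (wpair i).2 u) v * expm S (bpsis (wpair i).1 (wpair i).2 u') v')) in H2.
  have e1 := cvg_lim (@norm_hausdorff _ (C^o)) (H1 _).
  have e2 := cvg_lim (@norm_hausdorff _ (C^o)) (H2 _).
  exact: (etrans (esym (e1 _ _)) (e2 _ _)).
apply/funext => S; rewrite -(sum_wpair B (fun a j => expm S (bpsi a j u) v * expm S (bpsis a j u') v')).
by rewrite key sum_wpair.
Qed.

End GElement.

Lemma signz (K : numFieldType) (n : int) : (-1) ^ n = (-1) ^+ absz n :> K.
Proof.
by case: n => n //; rewrite /exprz -exprVn invrN1.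
Qed.

(** * The states and the tau-functions *)

Section States.
Context {K : numFieldType} {W : lmodType K} {N : nat}.
Variables p q : 'I_N -> int -> W -> W.
Hypothesis H : fermi_rep p q.
Implicit Types (a b g : 'I_N) (s : 'I_N -> int) (w : W).

(** The common form of [Psi] acting on the dual space and [Psis] acting on the Fock space. *)
Definition step a (n : int) w : W :=
  match n with
  | Posz k => iteri k (fun i => q a i%:Z) w
  | Negz k => iteri k.+1 (fun i => p a (- 1 - i%:Z)) w
  end.

(** The vacuum conditions in the component [g] with the Fermi level moved from [0] to [n]. *)
Definition at_level g (n : int) w : Prop :=
  (forall j, n <= j -> p g j w = 0) /\ (forall j, j < n -> q g j w = 0).

Lemma level_p g n w : at_level g n w -> at_level g (n - 1) (p g (n - 1) w).
Proof.
move=> [pw qw]; split=> j jn.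
  rewrite (fpp H); have [nj|jn'] := leP n j; first by rewrite pw ?(lin0 (fp_lin H _ _)) ?oppr0.
  have -> : j = n - 1 by lia.
  have := fpp H g g (n - 1) (n - 1) w => /eqP; rewrite -addr_eq0 -mulr2n -scaler_nat.
  by rewrite scaler_eq0 pnatr_eq0 /= => /eqP->; rewrite oppr0.
rewrite (f_anti H); last by apply/negbTE; rewrite eqxx /=; lia.
by rewrite qw ?(lin0 (fp_lin H _ _)) ?oppr0 //; lia.
Qed.

Lemma level_q g n w : at_level g n w -> at_level g (n + 1) (q g n w).
Proof.
move=> [pw qw]; split=> j jn.
  have := fpq H g g j n w; rewrite pw ?(lin0 (fq_lin H _ _)) ?add0r; last lia.
  by rewrite eqxx (_ : j == n = false) ?mulr0n //; apply/negbTE; lia.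
rewrite (fqq H); have [jn'|nj] := ltP j n; first by rewrite qw ?(lin0 (fq_lin H _ _)) ?oppr0.
have -> : j = n by lia.
have := fqq H g g n n w => /eqP; rewrite -addr_eq0 -mulr2n -scaler_nat.
by rewrite scaler_eq0 pnatr_eq0 /= => /eqP->; rewrite oppr0.
Qed.

Lemma level_p_other g a j n w : a != g -> at_level g n w -> at_level g n (p a j w).
Proof.
move=> ag [pw qw]; split=> i hi; first by rewrite (fpp H) pw ?(lin0 (fp_lin H _ _)) ?oppr0.
by rewrite (f_anti H) ?(negPf ag) // qw ?(lin0 (fp_lin H _ _)) ?oppr0.
Qed.

Lemma level_q_other g a j n w : a != g -> at_level g n w -> at_level g n (q a j w).
Proof.
move=> ag [pw qw]; split=> i hi; last by rewrite (fqq H) qw ?(lin0 (fq_lin H _ _)) ?oppr0.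
have := fpq H g a i j w; rewrite pw // (lin0 (fq_lin H _ _)) add0r => ->.
by rewrite eq_sym (negPf ag).
Qed.

Lemma step_pos a (k : nat) w : step a k.+1%:Z w = q a k%:Z (step a k%:Z w).
Proof. by []. Qed.

Lemma step_neg a (k : nat) w : step a (Negz k) w = p a (Negz k) (step a (- k%:Z) w).
Proof.
case: k => [|k] /=; first by rewrite oppr0 /= NegzE.
by rewrite -NegzE /= NegzE; congr (p a _ _); lia.
Qed.

Lemma level_step a n w : at_level a 0 w -> at_level a n (step a n w).
Proof.
move=> h; case: n => k.
  by elim: k => // k IH; rewrite step_pos (_ : k.+1%:Z = k%:Z + 1); [exact: level_q|lia].
suff L : forall k : nat, at_level a (- k%:Z) (step a (- k%:Z) w) by rewrite NegzE; exact: L.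
elim=> [|{}k IH]; first by rewrite oppr0.
by rewrite -NegzE step_neg NegzE (_ : - k.+1%:Z = - k%:Z - 1); [exact: level_p|lia].
Qed.

Lemma step_lin a n : linear (step a n).
Proof.
move=> c w w'; case: n => k; rewrite /step.
  by elim: k => //= k ->; rewrite (fq_lin H).
by elim: (k.+1) => //= i ->; rewrite (fp_lin H).
Qed.

Lemma level_step_other g a n m w : a != g -> at_level g n w -> at_level g n (step a m w).
Proof.
move=> ag h; case: m => k; rewrite /step.
  by elim: k => //= k IH; exact: level_q_other.
by elim: (k.+1) => //= i IH; exact: level_p_other.
Qed.

Lemma p_step_other b a j n w : a != b -> p b j (step a n w) = (-1) ^ n *: step a n (p b j w).
Proof.
move=> ab; rewrite signz.
have E k : p b j (iteri k (fun i => q a i%:Z) w) = (-1) ^+ k *: iteri k (fun i => q a i%:Z) (p b j w).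
  elim: k => [|k IH] /=; first by rewrite expr0 scale1r.
  rewrite -[LHS]opprK -(f_anti H) ?IH; last by rewrite eq_sym (negPf ab).
  by rewrite (linZ _ _ (fq_lin H _ _)) exprS mulN1r scaleNr.
have E' k : p b j (iteri k (fun i => p a (- 1 - i%:Z)) w) = (-1) ^+ k *: iteri k (fun i => p a (- 1 - i%:Z)) (p b j w).
  elim: k => [|k IH] /=; first by rewrite expr0 scale1r.
  by rewrite (fpp H) IH (linZ _ _ (fp_lin H _ _)) exprS mulN1r scaleNr.
by case: n => k; [exact: E|exact: E'].
Qed.

Lemma p_step a n w : at_level a 0 w -> p a (n - 1) (step a n w) = step a (n - 1) w.
Proof.
move=> h; case: n => [[|k]|k].
- by rewrite sub0r.
- rewrite (_ : k.+1%:Z - 1 = k%:Z); last lia.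
  have [pw qw] := level_step k%:Z h; rewrite step_pos.
  have := fpq H a a k%:Z k%:Z (step a k%:Z w); rewrite !eqxx mulr1n.
  by rewrite pw // (lin0 (fq_lin H _ _)) add0r.
have -> : Negz k - 1 = Negz k.+1 by rewrite !NegzE; lia.
by rewrite [RHS]step_neg -NegzE.
Qed.

Definition states (l : seq 'I_N) s w : W := foldl (fun w mu => step mu (s mu) w) w l.

Variable w0 : W.
Hypothesis w0_level : forall g, at_level g 0 w0.

Lemma level_states l s g : uniq l -> at_level g (if g \in l then s g else 0) (states l s w0).
Proof.
elim/last_ind: l g => [|l m IH] g; first by move=> _; exact: w0_level.
rewrite rcons_uniq => /andP[ml ul]; rewrite /states foldl_rcons -/(states l s w0).
rewrite mem_rcons inE; have [->|gm] := eqVneq g m.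
  by apply: level_step; have := IH m ul; rewrite (negPf ml).
by apply: level_step_other; [rewrite eq_sym|exact: IH].
Qed.

Lemma eq_states l s s' w : (forall mu, mu \in l -> s mu = s' mu) -> states l s w = states l s' w.
Proof.
elim/last_ind: l => // l m IH h; rewrite /states !foldl_rcons -!/(states l _ w).
rewrite h ?mem_rcons ?inE ?eqxx // IH // => mu mul; apply: h.
by rewrite mem_rcons inE mul orbT.
Qed.

(** [p g] passes the outer factors [mu > g], each giving [(-1) ^ s mu], and on reaching the factor
    of [g] lowers its level by one. *)
Lemma p_states l s g : pairwise (fun i j : 'I_N => (i < j)%N) l -> g \in l ->
  p g (s g - 1) (states l s w0) =
  (-1) ^ (\sum_(mu <- l | (g < mu)%N) s mu) *: states l (Defs.shift s (-1) g) w0.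
Proof.
have m1 : (-1 : K) != 0 by rewrite oppr_eq0 oner_eq0.
elim/last_ind: l => // l m IH; rewrite pairwise_rcons => /andP[/allP lm pl].
have ul : uniq (rcons l m).
  rewrite rcons_uniq; apply/andP; split; last first.
    by apply: pairwise_uniq pl => i; rewrite ltnn.
  by apply/negP => /lm; rewrite ltnn.
rewrite mem_rcons inE /states !foldl_rcons -!/(states l _ w0) big_rcons /=.
have [e _|gm /= gl] := eqVneq g m.
  subst m.
  have gl : g \notin l by have := ul; rewrite rcons_uniq => /andP[].
  have lg : at_level g 0 (states l s w0).
    have := @level_states l s g; rewrite (negPf gl); apply.
    by have := ul; rewrite rcons_uniq => /andP[].
  rewrite p_step // ltnn big_seq_cond big1 ?expr0z ?scale1r; last first.
    by move=> mu /andP[/lm h]; rewrite ltnNge (ltnW h).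
  rewrite (@eq_states l s (Defs.shift s (-1) g)) => [|mu mul].
    by rewrite /Defs.shift eqxx mul1r.
  rewrite /Defs.shift (_ : mu == g = false) ?mul0r ?addr0 //.
  by apply: contraNF gl => /eqP <-.
have gltm := lm _ gl; rewrite gltm p_step_other; last by rewrite eq_sym.
rewrite IH // expfzDr // (linZ _ _ (step_lin m (s m))) scalerA mulrC.
congr (_ *: step m _ _); rewrite /Defs.shift (_ : m == g = false) ?mul0r ?addr0 //.
by rewrite eq_sym; exact: negPf.
Qed.

(** Follows from [p_states] at the raised charge: [q g (s g)] kills that state, so applying it after
    [p g (s g)] gives the state back. *)
Lemma q_states l s g : pairwise (fun i j : 'I_N => (i < j)%N) l -> g \in l ->
  q g (s g) (states l s w0) =
  (-1) ^ (\sum_(mu <- l | (g < mu)%N) s mu) *: states l (Defs.shift s 1 g) w0.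
Proof.
move=> pl gl; pose s' := Defs.shift s 1 g.
have s'K : Defs.shift s' (-1) g = s.
  by apply/funext => mu; rewrite /s' /Defs.shift; case: (mu == g); lia.
have s'g : s' g = s g + 1 by rewrite /s' /Defs.shift eqxx mul1r.
have ss' : \sum_(mu <- l | (g < mu)%N) s' mu = \sum_(mu <- l | (g < mu)%N) s mu.
  apply: eq_bigr => mu gmu; rewrite /s' /Defs.shift (_ : mu == g = false) ?mul0r ?addr0 //.
  by apply/negbTE; apply: contraTneq gmu => ->; rewrite ltnn.
have := p_states s' pl gl; rewrite s'K s'g addrK ss' -/s'.
set e := _ ^ _; have ee : e * e = 1 by rewrite /e signz -expr2 sqrr_sign.
move=> /(congr1 (fun w => e *: q g (s g) w)).
rewrite (linZ _ _ (fq_lin H _ _)) scalerA ee scale1r => <-; congr (_ *: _).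
have ul : uniq l by apply: pairwise_uniq pl => i; rewrite ltnn.
have [pw qw] := level_states s' g ul; rewrite gl s'g in pw qw.
have := fpq H g g (s g) (s g) (states l s' w0); rewrite !eqxx mulr1n qw; last lia.
by rewrite (lin0 (fp_lin H _ _)) addr0.
Qed.

End States.

(** * Charged states and their leading modes *)

Section BraKet.
Context {R : realType} {N : nat} (F : clifford_fock R N).
Local Notation C := R[i].
Local Notation Bp := (@bpsi R N F).
Local Notation Bq := (@bpsis R N F).
Local Notation Kp := (@kpsis R N F).
Local Notation Kq := (@kpsi R N F).

Lemma ract_Psi a n (u : dual F) : ract u (Psi F a n) = step Bp Bq a n u.
Proof.
case: n => k; rewrite /step /Psi.
  elim: k => [|k IH]; first by rewrite big_ord0 ract1.
  by rewrite big_ord_recr ractM IH.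
elim: (k.+1) => [|j IH]; first by rewrite big_ord0 ract1.
by rewrite big_ord_recr ractM IH.
Qed.

Lemma lact_Psis a n (v : fock F) : lact (Psis F a n) v = step Kp Kq a n v.
Proof.
case: n => k; rewrite /step /Psis.
  elim: k => [|k IH]; first by rewrite big_ord0 lact1.
  rewrite big_ord_recl lactM /= -IH /kpsi; congr (lact (psi F a _) (lact _ v)); first lia.
  by apply: eq_bigr => i _; congr (psi F a _); rewrite /bump /=; lia.
rewrite NegzE; elim: (k.+1) => [|j IH]; first by rewrite big_ord0 lact1.
rewrite big_ord_recl lactM /= -IH /kpsis; congr (lact (psis F a _) (lact _ v)); first lia.
by apply: eq_bigr => i _; congr (psis F a _); rewrite /bump /=; lia.
Qed.

Lemma index_enum_ord : index_enum ('I_N : finType) = enum 'I_N.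
Proof. by rewrite enumT. Qed.

Lemma bra_states s : bra F s = states Bp Bq (enum 'I_N) s (dvac F).
Proof.
rewrite /bra /states index_enum_ord; elim/last_ind: (enum 'I_N) => [|l m IH].
  by rewrite big_nil ract1.
by rewrite big_rcons foldl_rcons -IH ractM ract_Psi.
Qed.

Lemma map_rev_ord : [seq rev_ord i | i <- enum 'I_N] = rev (enum 'I_N).
Proof.
apply: (inj_map val_inj); rewrite -map_comp map_rev val_enum_ord.
apply: (@eq_from_nth _ 0%N); first by rewrite size_map size_rev size_iota size_enum_ord.
move=> i; rewrite size_map size_enum_ord => iN.
rewrite (nth_map (Ordinal iN)) ?size_enum_ord // nth_rev ?size_iota //.
by rewrite nth_iota ?add0n /= ?nth_enum_ord //; lia.
Qed.

Lemma ket_states s : ket F s = states Kp Kq (enum 'I_N) s (vac F).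
Proof.
rewrite /ket index_enum_ord -(big_map (@rev_ord N) xpredT (fun mu => Psis F mu (s mu))) map_rev_ord.
rewrite /states -(revK (enum 'I_N)) foldl_rev revK.
elim: (rev (enum 'I_N)) => [|m l IH]; first by rewrite big_nil lact1.
by rewrite big_cons lactM IH lact_Psis.
Qed.

Lemma enum_ord_pairwise : pairwise (fun i j : 'I_N => (i < j)%N) (enum 'I_N).
Proof.
transitivity (pairwise ltn [seq val i | i <- enum 'I_N]); first by rewrite pairwise_map.
by rewrite val_enum_ord -sorted_pairwise; [exact: iota_ltn_sorted|exact: ltn_trans].
Qed.

Lemma dvac_level g : at_level Bp Bq g 0 (dvac F).
Proof. by split=> j; [exact: dvac_psi|exact: dvac_psis]. Qed.

Lemma vac_level g : at_level Kp Kq g 0 (vac F).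
Proof. by split=> j; [exact: psis_vac|exact: psi_vac]. Qed.

(* [p g _] and [q g _] pass the factors [mu > g] of a state, which gives the sign
   [(-1)^(right_sum g s)]. *)
Definition right_sum (g : 'I_N) (s : 'I_N -> int) : int := \sum_(mu < N | (g < mu)%N) s mu.

Lemma right_sumE (g : 'I_N) (s : 'I_N -> int) : \sum_(mu <- enum 'I_N | (g < mu)%N) s mu = right_sum g s.
Proof. by rewrite /right_sum index_enum_ord. Qed.

Lemma bra_level g s : at_level Bp Bq g (s g) (bra F s).
Proof.
rewrite bra_states; have := level_states (bra_rep F) dvac_level s g (enum_uniq 'I_N).
by rewrite mem_enum.
Qed.

Lemma ket_level g s : at_level Kp Kq g (s g) (ket F s).
Proof.
rewrite ket_states; have := level_states (ket_rep F) vac_level s g (enum_uniq 'I_N).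
by rewrite mem_enum.
Qed.

Lemma bra_psi g s : bpsi g (s g - 1) (bra F s) = (-1) ^ right_sum g s *: bra F (Defs.shift s (-1) g).
Proof.
by rewrite !bra_states (p_states (bra_rep F) dvac_level s enum_ord_pairwise) ?mem_enum // right_sumE.
Qed.

Lemma bra_psis g s : bpsis g (s g) (bra F s) = (-1) ^ right_sum g s *: bra F (Defs.shift s 1 g).
Proof.
by rewrite !bra_states (q_states (bra_rep F) dvac_level s enum_ord_pairwise) ?mem_enum // right_sumE.
Qed.

Lemma ket_psis g s : kpsis g (s g - 1) (ket F s) = (-1) ^ right_sum g s *: ket F (Defs.shift s (-1) g).
Proof.
by rewrite !ket_states (p_states (ket_rep F) vac_level s enum_ord_pairwise) ?mem_enum // right_sumE.
Qed.

Lemma ket_psi g s : kpsi g (s g) (ket F s) = (-1) ^ right_sum g s *: ket F (Defs.shift s 1 g).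
Proof.
by rewrite !ket_states (q_states (ket_rep F) vac_level s enum_ord_pairwise) ?mem_enum // right_sumE.
Qed.

Lemma JrE a k u : Jr a k u = cur Bp Bq a k u.
Proof. by apply: eq_fsbigr => j _; rewrite ractM. Qed.

Lemma JlE a k v : Jl a (- k) v = cur Kp Kq a k v.
Proof.
rewrite /Jl (reindex_fsbigT (fun j => j + k)) /=; last by exists (fun j => j - k) => j; lia.
by apply: eq_fsbigr => j _; rewrite addrK lactM.
Qed.

End BraKet.

(** * Tau series of arbitrary vectors *)

Section TauSeries.
Context {R : realType} {N : nat} (F : clifford_fock R N).
Local Notation C := R[i].
Local Notation U := (tidx N).
Local Notation Bp := (@bpsi R N F).
Local Notation Bq := (@bpsis R N F).
Local Notation Kp := (@kpsis R N F).
Local Notation Kq := (@kpsi R N F).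
Variable A : 'I_N -> 'I_N -> int -> int -> C.
Hypothesis hg : g_defined F A.
Implicit Types (z : dual F * fock F) (g : 'I_N) (u : U).

Definition LB u (x : dual F) : dual F := Jr u.1 u.2.+1%:Z x.
Definition LK u (y : fock F) : fock F := - Jl u.1 (- u.2.+1%:Z) y.

(** A tau-function with arbitrary vectors for the charged states. This class, unlike that of the
    tau-functions, is stable under time derivatives. *)
Definition tser z (m1 m2 : {mset U}%mset) : C := g_mx A (braJ z.1 m1) (Jket z.2 m2).

Definition Lz (b : bool) u z : dual F * fock F := if b then (z.1, LK u z.2) else (LB u z.1, z.2).

Lemma LBE u x : LB u x = cur Bp Bq u.1 u.2.+1%:Z x.
Proof. exact: JrE. Qed.
Lemma LKE u y : LK u y = - cur Kp Kq u.1 u.2.+1%:Z y.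
Proof. by rewrite /LK JlE. Qed.

Lemma LB_lin u : linear (LB u).
Proof. by move=> c x y; rewrite !LBE (cur_lin (bra_rep F)). Qed.
Lemma LK_lin u : linear (LK u).
Proof. by move=> c x y; rewrite !LKE (cur_lin (ket_rep F)) // opprD scalerN. Qed.
Lemma LB_comm u u' x : LB u (LB u' x) = LB u' (LB u x).
Proof. by rewrite !LBE (cur_comm (bra_rep F)). Qed.
Lemma LK_comm u u' y : LK u (LK u' y) = LK u' (LK u y).
Proof.
rewrite !LKE !(linN _ (cur_lin (ket_rep F) _ _)) // !opprK.
by rewrite (cur_comm (ket_rep F)).
Qed.

Lemma braJ_lin m : linear (@braJ R N F ^~ m).
Proof. exact: (expact_lin LB_lin LB_comm). Qed.
Lemma Jket_lin m : linear (@Jket R N F ^~ m).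
Proof. exact: (expact_lin LK_lin LK_comm). Qed.

Lemma tser_linl c x x' y m1 m2 :
  tser (c *: x + x', y) m1 m2 = c * tser (x, y) m1 m2 + tser (x', y) m1 m2.
Proof. by rewrite /tser /= braJ_lin g_linl. Qed.

Lemma tser_linr x c y y' m1 m2 :
  tser (x, c *: y + y') m1 m2 = c * tser (x, y) m1 m2 + tser (x, y') m1 m2.
Proof. by rewrite /tser /= Jket_lin g_linr. Qed.

Lemma tser_const z : tser z mset0 mset0 = g_mx A z.1 z.2.
Proof. 
have e1 : braJ z.1 mset0 = z.1 by exact: (expact0 LB_lin LB_comm).
have e2 : Jket z.2 mset0 = z.2 by exact: (expact0 LK_lin LK_comm).
by rewrite /tser e1 e2.
Qed.

Lemma tser_dser b u z m1 m2 : dser b u (tser z) m1 m2 = tser (Lz b u z) m1 m2.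
Proof.
have g0l (v : fock F) : g_mx A (0 : dual F) v = 0.
  by have := g_linl hg v (-1) 0 0; rewrite scaler0 addr0 mulN1r addNr.
have g0r (w : dual F) : g_mx A w (0 : fock F) = 0.
  by have := g_linr hg w (-1) 0 0; rewrite scaler0 addr0 mulN1r addNr.
have gZl c (w : dual F) (v : fock F) : g_mx A (c *: w) v = c * g_mx A w v.
  by rewrite -[c *: w]addr0 (g_linl hg) g0l addr0.
have gZr c (w : dual F) (v : fock F) : g_mx A w (c *: v) = c * g_mx A w v.
  by rewrite -[c *: v]addr0 (g_linr hg) g0r addr0.
case: b; rewrite /tser /=.
  have e : Jket (LK u z.2) m2 = (m2 u).+1%:R *: Jket z.2 ([mset u] `+` m2)%mset.
    by rewrite /Jket (expactD1 LK_lin LK_comm).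
  by rewrite e gZr.
have e : braJ (LB u z.1) m1 = (m1 u).+1%:R *: braJ z.1 ([mset u] `+` m1)%mset.
  by rewrite /braJ (expactD1 LB_lin LB_comm).
by rewrite e gZl.
Qed.

End TauSeries.

(** * Modes of the fermionic fields *)

Section FermionFields.
Context {R : realType} {N : nat} (F : clifford_fock R N).
Local Notation C := R[i].
Local Notation U := (tidx N).
Variable A : 'I_N -> 'I_N -> int -> int -> C.
Hypothesis hg : g_defined F A.
Implicit Types (z : dual F * fock F) (g : 'I_N) (u : U).
Local Notation T := (@tser R N F A).
Local Notation L := (@Lz R N F).

Lemma tser0l (y : fock F) m1 m2 : T (0, y) m1 m2 = 0.
Proof.
have := tser_linl hg (-1) 0 0 y m1 m2.
by rewrite scaler0 addr0 mulN1r addNr.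
Qed.

Lemma tser0r (x : dual F) m1 m2 : T (x, 0) m1 m2 = 0.
Proof.
have := tser_linr hg x (-1) 0 0 m1 m2.
by rewrite scaler0 addr0 mulN1r addNr.
Qed.

Lemma tserZl c (x : dual F) (y : fock F) m1 m2 : T (c *: x, y) m1 m2 = c * T (x, y) m1 m2.
Proof. by rewrite -[c *: x]addr0 (tser_linl hg) tser0l addr0. Qed.

Lemma tserZr c (x : dual F) (y : fock F) m1 m2 : T (x, c *: y) m1 m2 = c * T (x, y) m1 m2.
Proof. by rewrite -[c *: y]addr0 (tser_linr hg) tser0r addr0. Qed.

Lemma tserDl (x x' : dual F) (y : fock F) m1 m2 : T (x + x', y) m1 m2 = T (x, y) m1 m2 + T (x', y) m1 m2.
Proof. by have := tser_linl hg 1 x x' y m1 m2; rewrite scale1r mul1r. Qed.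

Lemma tserDr (x : dual F) (y y' : fock F) m1 m2 : T (x, y + y') m1 m2 = T (x, y) m1 m2 + T (x, y') m1 m2.
Proof. by have := tser_linr hg x 1 y y' m1 m2; rewrite scale1r mul1r. Qed.

Lemma tser_suml n (f : 'I_n -> dual F) (y : fock F) m1 m2 :
  T (\sum_i f i, y) m1 m2 = \sum_i T (f i, y) m1 m2.
Proof.
exact: (big_morph (fun x => T (x, y) m1 m2) (fun x x' => tserDl x x' y m1 m2) (tser0l y m1 m2)).
Qed.

Lemma tser_sumr n (x : dual F) (f : 'I_n -> fock F) m1 m2 :
  T (x, \sum_i f i) m1 m2 = \sum_i T (x, f i) m1 m2.
Proof.
exact: (big_morph (fun y => T (x, y) m1 m2) (fun y y' => tserDr x y y' m1 m2) (tser0r x m1 m2)).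
Qed.

(** Left of [g] the mode [psi_n] goes with [z^n] and [psis_n] with [z^-n]; right of [g] the variable
    is inverted. With this choice all four families vanish for large [n], so each gives a series
    bounded above in [z]. *)
Definition rL1 g (n : int) z : dual F * fock F := (bpsi g n z.1, z.2).
Definition rL2 g (n : int) z : dual F * fock F := (bpsis g (- n) z.1, z.2).
Definition rR1 g (n : int) z : dual F * fock F := (z.1, kpsi g (- n) z.2).
Definition rR2 g (n : int) z : dual F * fock F := (z.1, kpsis g n z.2).

Lemma LB_bpsi u g n (x : dual F) : LB u (bpsi g n x) =
  (- (u.1 == g)%:R) *: bpsi g (n - u.2.+1%:Z) x + bpsi g n (LB u x) :> dual F.
Proof.
rewrite !LBE (p_cur (bra_rep F)) // addrC scaleNr scaler_nat.
by have [->|_] := eqVneq u.1 g; rewrite ?mulr1n ?mulr0n ?subr0 ?addr0 // addrK.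
Qed.

Lemma LB_bpsis u g n (x : dual F) : LB u (bpsis g n x) =
  (u.1 == g)%:R *: bpsis g (n + u.2.+1%:Z) x + bpsis g n (LB u x) :> dual F.
Proof.
rewrite !LBE (q_cur (bra_rep F)) // scaler_nat.
by have [->|_] := eqVneq u.1 g; rewrite ?mulr1n ?mulr0n ?subr0 ?add0r // addrC subrK.
Qed.

Lemma LK_kpsi u g n (y : fock F) : LK u (kpsi g n y) =
  (- (u.1 == g)%:R) *: kpsi g (n + u.2.+1%:Z) y + kpsi g n (LK u y) :> fock F.
Proof.
rewrite !LKE (linN _ (kpsi_lin g n)) (q_cur (ket_rep F)) // scaleNr scaler_nat.
have [->|_] := eqVneq u.1 g; rewrite ?mulr1n ?mulr0n.
  by rewrite opprB addKr.
by rewrite oppr0 add0r addr0.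
Qed.

Lemma LK_kpsis u g n (y : fock F) : LK u (kpsis g n y) =
  (u.1 == g)%:R *: kpsis g (n - u.2.+1%:Z) y + kpsis g n (LK u y) :> fock F.
Proof.
rewrite !LKE (linN _ (kpsis_lin g n)) (p_cur (ket_rep F)) // scaler_nat.
have [->|_] := eqVneq u.1 g; rewrite ?mulr1n ?mulr0n.
  by rewrite opprD addrCA addrN addr0.
by rewrite add0r addr0.
Qed.

Lemma vertex_L1 g : vertex T L false g 1 (rL1 g).
Proof.
split=> [[] u n z m1 m2|[x y]]; rewrite /rL1 /Lz /=.
- by rewrite mul0r subr0.
- by rewrite LB_bpsi (tser_linl hg) addrC mulNr mul1r.
have [M [hM _]] := bfin_all x; exists M%:Z => n hn m1 m2.
by rewrite hM; [exact: tser0l|lia].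
Qed.

Lemma vertex_L2 g : vertex T L false g (-1) (rL2 g).
Proof.
split=> [[] u n z m1 m2|[x y]]; rewrite /rL2 /Lz /=.
- by rewrite mul0r subr0.
- have -> : - (n - u.2.+1%:Z) = - n + u.2.+1%:Z by lia.
  by rewrite LB_bpsis (tser_linl hg) addrC mulN1r mulrN opprK.
have [M [_ hM]] := bfin_all x; exists M%:Z => n hn m1 m2.
by rewrite hM; [exact: tser0l|lia].
Qed.

Lemma vertex_R1 g : vertex T L true g 1 (rR1 g).
Proof.
split=> [[] u n z m1 m2|[x y]]; rewrite /rR1 /Lz /=.
- have -> : - (n - u.2.+1%:Z) = - n + u.2.+1%:Z by lia.
  by rewrite LK_kpsi (tser_linr hg) addrC mulNr mul1r.
- by rewrite mul0r subr0.
have [M [_ hM]] := kfin_all y; exists M%:Z => n hn m1 m2.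
by rewrite hM; [exact: tser0r|lia].
Qed.

Lemma vertex_R2 g : vertex T L true g (-1) (rR2 g).
Proof.
split=> [[] u n z m1 m2|[x y]]; rewrite /rR2 /Lz /=.
- by rewrite LK_kpsis (tser_linr hg) addrC mulN1r mulrN opprK.
- by rewrite mul0r subr0.
have [M [hM _]] := kfin_all y; exists M%:Z => n hn m1 m2.
by rewrite hM; [exact: tser0r|lia].
Qed.

Lemma vprod_base z1 z2 :
  \sum_g vprod (vertex_L1 g) (vertex_L2 g) z1 z2 (mset0, 0) =
  \sum_g vprod (vertex_R1 g) (vertex_R2 g) z1 z2 (mset0, 0).
Proof.
have [B0 h0] := bilinear_g hg z1.1 z1.2 z2.1 z2.2.
have [f1 h1] := choice (fun g => vprod_const (vertex_L1 g) (vertex_L2 g) z1 z2).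
have [f2 h2] := choice (fun g => vprod_const (vertex_R1 g) (vertex_R2 g) z1 z2).
pose B := (B0 + \sum_g (f1 g + f2 g))%N.
have fB g : (f1 g + f2 g <= B)%N.
  by rewrite /B (bigD1 g) //=; lia.
have := h0 B (leq_addr _ _); set l := LHS; set r := RHS => e.
transitivity l; [|rewrite e]; apply: eq_bigr => g _; have := fB g => hB.
  rewrite (h1 g B); last lia.
  apply: eq_bigr => i _; rewrite !tser_const /rL1 /rL2 /=.
  by rewrite opprB.
rewrite (h2 g B); last lia.
(* The variable is inverted right of [g], so the window is read backwards. *)
rewrite /wsum (reindex_inj rev_ord_inj) /=; apply: eq_bigr => i _.
rewrite !tser_const /rR1 /rR2 /=; have := ltn_ord i => hi.
have e1 : (B.*2.+1 - i.+1)%N%:Z - B%:Z = B%:Z - i%:Z by lia.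
by rewrite opprB e1.
Qed.

Lemma vprod_LR z1 z2 m :
  \sum_g vprod (vertex_L1 g) (vertex_L2 g) z1 z2 (m, 0) =
  \sum_g vprod (vertex_R1 g) (vertex_R2 g) z1 z2 (m, 0).
Proof. exact: (vprod_eq (tser_dser hg) vprod_base). Qed.

Lemma bsbstZ p c1 c2 g c (G : {mset U}%mset -> {mset U}%mset -> C) G' :
  (forall m1 m2, G m1 m2 = c * G' m1 m2) ->
  bsbst p c1 c2 g G = bcz c 0 * bsbst p c1 c2 g G'.
Proof.
move=> e; apply: bser_eqP => -[m n]; rewrite bczE /= subr0 -sbstZ.
exact: eq_sbst.
Qed.

(** The highest mode of [psi] that survives on the state is [S g - 1]. It gives the power of [z] and
    the neighbouring state, up to the sign of passing the factors beyond [g]. The other three fields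
    are alike, with leading mode [S g - 1] or [S g]. *)
Lemma vser_L1 p g S (y : fock F) : vser p g (vertex_L1 g).2 (bra F S, y) =
  bz (S g - 1) * (bcz ((-1) ^ right_sum g S) 0 *
    bsbst p (-1) 0 g (T (bra F (Defs.shift S (-1) g), y))).
Proof.
have [hp hq] := bra_level F g S.
rewrite (@vser_shift _ _ _ _ L _ p false g 1 (tser_dser hg) _ _ (S g - 1)).
- congr (_ * _); apply: bsbstZ => m1 m2; by rewrite /rL1 /= bra_psi tserZl.
- by move=> n hn m1 m2; rewrite /rL1 /= hp ?tser0l //; lia.
- move=> j m1 m2; rewrite mulN1r -tserZl (p_newton (bra_rep F) hp hq) -scaleN1r tserZl mulN1r.
  by rewrite tser_suml; congr (- _); apply: eq_bigr => k _; rewrite /Lz /rL1 /= LBE.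
Qed.

Lemma vser_L2 p g S (y : fock F) : vser p g (vertex_L2 g).2 (bra F S, y) =
  bz (- S g) * (bcz ((-1) ^ right_sum g S) 0 *
    bsbst p 1 0 g (T (bra F (Defs.shift S 1 g), y))).
Proof.
have [hp hq] := bra_level F g S.
rewrite (@vser_shift _ _ _ _ L _ p false g (-1) (tser_dser hg) _ _ (- S g)) ?opprK.
- congr (_ * _); apply: bsbstZ => m1 m2; by rewrite /rL2 /= opprK bra_psis tserZl.
- by move=> n hn m1 m2; rewrite /rL2 /= hq ?tser0l //; lia.
- move=> j m1 m2; have e (i : int) : - (- S g - i) = S g + i by lia.
  rewrite mul1r -tserZl e (q_newton (bra_rep F) hp hq).
  by rewrite tser_suml; apply: eq_bigr => k _; rewrite /Lz /rL2 /= LBE e.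
Qed.

Lemma vser_R1 p g S (x : dual F) : vser p g (vertex_R1 g).2 (x, ket F S) =
  bz (- S g) * (bcz ((-1) ^ right_sum g S) 0 *
    bsbst p 0 (-1) g (T (x, ket F (Defs.shift S 1 g)))).
Proof.
have [hp hq] := ket_level F g S.
rewrite (@vser_shift _ _ _ _ L _ p true g 1 (tser_dser hg) _ _ (- S g)).
- congr (_ * _); apply: bsbstZ => m1 m2; by rewrite /rR1 /= opprK ket_psi tserZr.
- by move=> n hn m1 m2; rewrite /rR1 /= hq ?tser0r //; lia.
- move=> j m1 m2; have e (i : int) : - (- S g - i) = S g + i by lia.
  rewrite mulN1r -tserZr e (q_newton (ket_rep F) hp hq).
  rewrite tser_sumr -sumrN; apply: eq_bigr => k _; rewrite /Lz /rR1 /= LKE e.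
  by rewrite -scaleN1r tserZr mulN1r opprK.
Qed.

Lemma vser_R2 p g S (x : dual F) : vser p g (vertex_R2 g).2 (x, ket F S) =
  bz (S g - 1) * (bcz ((-1) ^ right_sum g S) 0 *
    bsbst p 0 1 g (T (x, ket F (Defs.shift S (-1) g)))).
Proof.
have [hp hq] := ket_level F g S.
rewrite (@vser_shift _ _ _ _ L _ p true g (-1) (tser_dser hg) _ _ (S g - 1)) ?opprK.
- congr (_ * _); apply: bsbstZ => m1 m2; by rewrite /rR2 /= ket_psis tserZr.
- by move=> n hn m1 m2; rewrite /rR2 /= hp ?tser0r //; lia.
- move=> j m1 m2; rewrite mul1r -tserZr (p_newton (ket_rep F) hp hq) -sumrN.
  by rewrite tser_sumr; apply: eq_bigr => k _; rewrite /Lz /rR2 /= LKE.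
Qed.

End FermionFields.

(** * Phases as signs *)

Section Signs.
Context {R : realType} {N : nat}.
Local Notation C := R[i].
Implicit Types (a b g : 'I_N) (s : 'I_N -> int).

Lemma signzD (m n : int) : (-1) ^ (m + n) = (-1) ^ m * (-1) ^ n :> C.
Proof. by rewrite expfzDr // oppr_eq0 oner_eq0. Qed.

Lemma signz_sqr (n : int) : (-1) ^ n * (-1) ^ n = 1 :> C.
Proof. by rewrite signz -expr2 sqrr_sign. Qed.

Lemma signzV (n : int) : ((-1) ^ n)^-1 = (-1) ^ n :> C.
Proof. by rewrite signz -signr_odd; case: odd; rewrite ?expr0 ?invr1 // expr1 invrN1. Qed.

Lemma signzN (n : int) : (-1) ^ (- n) = (-1) ^ n :> C.
Proof. by rewrite -invr_expz signzV. Qed.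

Lemma expi_pi (n : int) : expi (pi * n%:~R) = (-1) ^ n :> C.
Proof.
have pos (k : nat) : expi (pi * k%:R) = (-1) ^+ k :> C.
  elim: k => [|k IH]; first by rewrite mulr0 /expi cos0 sin0 expr0.
  rewrite exprS -IH mulN1r -natr1 mulrDr mulr1 /expi cosDpi sinDpi.
  by apply/eqP; rewrite eq_complex /= !eqxx.
have neg (x : R) : expi (- x) = (expi x)^* :> C.
  by rewrite /expi cosN sinN.
case: n => k; first exact: pos.
rewrite NegzE mulrNz mulrN neg pos signz rmorphXn rmorphN1; congr (_ ^+ _); lia.
Qed.

Lemma eps0N_sign s : eps0N s = (-1) ^ (\sum_(mu < N) s mu) :> C.
Proof. by rewrite /eps0N -mulrN -mulrNz expi_pi signzN. Qed.

Lemma eps_sqr a g : eps a g * eps a g = 1 :> C.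
Proof. by rewrite /eps; case: ifP => _; rewrite ?mulrNN mulr1. Qed.

Lemma eps_sign a g : eps a g = (-1) ^ ((g < a)%N : nat)%:Z :> C.
Proof. by rewrite /eps leqNgt; case: (g < a)%N. Qed.

Lemma right_sum_split a g s : (a <= g)%N ->
  right_sum a s = \sum_(mu < N | (a < mu <= g)%N) s mu + right_sum g s.
Proof.
move=> ag; rewrite /right_sum (bigID (fun mu : 'I_N => (mu <= g)%N)) /=; congr (_ + _).
by apply: eq_bigl => mu; apply/idP/idP; lia.
Qed.

(** A sum of charges between [a] and [g] is a difference of two right sums, and modulo two a
    difference is a sum. Apart from [eps a g] the indices are thus separated, in the form in which
    fermionic reordering produces signs. *)
Lemma eps_sE a g s : eps_s a g s = eps a g * (-1) ^ (right_sum a s + right_sum g s) :> C.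
Proof.
rewrite /eps_s /eps; case: leqP => ag.
  rewrite -mulrN -mulrNz expi_pi mul1r (right_sum_split s ag) signzN.
  by rewrite !signzD -mulrA signz_sqr mulr1.
rewrite expi_pi mulN1r (right_sum_split s (ltnW ag)).
by rewrite !signzD mulrCA signz_sqr mulr1.
Qed.

Lemma right_sum_shift g s c a :
  right_sum g (Defs.shift s c a) = right_sum g s + ((g < a)%N : nat)%:Z * c.
Proof.
rewrite /right_sum /Defs.shift big_split /=; congr (_ + _).
rewrite big_mkcond (bigD1 a) //= eqxx big1 ?addr0; last first.
  by move=> mu /negPf->; rewrite mul0r; case: ifP.
by case: ifP => _; rewrite ?mul1r ?mul0r.
Qed.

(* the sign in front of [tau] *)
Definition pref (n : int) : C := (-1) ^ (n * (n - 1) %/ 2)%Z.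

Lemma prefS n : pref (n + 1) = pref n * (-1) ^ n.
Proof.
rewrite /pref -signzD; congr (_ ^ _).
have -> : (n + 1) * (n + 1 - 1) = n * 2 + n * (n - 1) by ring.
by rewrite divzMDl // addrC.
Qed.

(** The minus sign, absent from [prefS], is the one in front of the right side of the hierarchy. *)
Lemma prefP n : pref (n - 1) = - (pref n * (-1) ^ n).
Proof.
have := prefS (n - 1); rewrite subrK => ->.
rewrite -mulrA -signzD (_ : n - 1 + n = n + n + (-1)); last lia.
by rewrite !signzD signz_sqr mul1r signzN expr1z mulrN1 opprK.
Qed.

Lemma sum_shift s c g : \sum_(mu < N) Defs.shift s c g mu = \sum_(mu < N) s mu + c.
Proof.
rewrite /Defs.shift big_split /=; congr (_ + _).
rewrite (bigD1 g) //= eqxx mul1r big1 ?addr0 // => mu /negPf->; by rewrite mul0r.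
Qed.

Lemma shiftC s c g c' g' : Defs.shift (Defs.shift s c g) c' g' = Defs.shift (Defs.shift s c' g') c g.
Proof. by apply/funext => mu; rewrite /Defs.shift addrAC. Qed.

Lemma shiftK s c g : Defs.shift (Defs.shift s c g) (- c) g = s.
Proof. by apply/funext => mu; rewrite /Defs.shift mulrN addrK. Qed.

End Signs.

(** * Terms of the hierarchy as products of fields *)

Section TodaTerms.
Context {R : realType} {N : nat} (F : clifford_fock R N).
Local Notation C := R[i].
Local Notation U := (tidx N).
Variable A : 'I_N -> 'I_N -> int -> int -> C.
Hypothesis hg : g_defined F A.
Implicit Types (g : 'I_N) (s : 'I_N -> int).
Local Notation T := (@tser R N F A).
Local Notation V := (@tvar N).
Local Notation bs := (@bser C V).

Lemma fsubst_sbst p c1 c2 g (f1 f2 : U -> fser C V) (G : {mset U}%mset -> {mset U}%mset -> C) :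
  (forall u x, f1 u x = tshift p false c1 g u x) ->
  (forall u x, f2 u x = tshift p true c2 g u x) ->
  fsubst f1 f2 G = sbst p c1 c2 g G.
Proof.
move=> e1 e2; rewrite /sbst.
have -> : f1 = (fun u => bser_val (ph p c1 c2 g false u)).
  by apply/funext => u; apply/funext => x; exact: e1.
suff -> : f2 = (fun u => bser_val (ph p c1 c2 g true u)) by [].
by apply/funext => u; apply/funext => x; exact: e2.
Qed.

Lemma times_tshift p b g u x : times p b u x = tshift p b (0 : C) g u x.
Proof. by rewrite tshiftE !mul0r addr0. Qed.

Lemma fsubst_left p (c : C) g G :
  fsubst (times_shift p false c g) (@times R N p true) G = sbst p c 0 g G.
Proof.
have e u x : times_shift p false c g u x = tshift p false c g u x by [].
exact: (@fsubst_sbst p c 0 g (times_shift p false c g) (@times R N p true) G e (times_tshift p true g)).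
Qed.

Lemma fsubst_right p (c : C) g G :
  fsubst (@times R N p false) (times_shift p true c g) G = sbst p 0 c g G.
Proof.
have e u x : times_shift p true c g u x = tshift p true c g u x by [].
exact: (@fsubst_sbst p 0 c g (@times R N p false) (times_shift p true c g) G (times_tshift p false g) e).
Qed.

Lemma bcz_const c (f : bs) x : (bcz c 0 * f) x = c * f x.
Proof. by case: x => m n; rewrite bczE /= subr0. Qed.

(** The integral reads the coefficient of [z^-1], the product of fields is taken at [z^0]; hence
    [n1 + n2 = k + 1]. The signs [e1], [e2] of the neighbouring states are their own inverses and
    can be moved to the other side. *)
Lemma oint_scale k b g (G1 G2 G1' G2' : {mset U}%mset -> {mset U}%mset -> C) (d1 d2 : C)
    (c1 c2 c3 c4 e1 e2 : C) (n1 n2 : int) (f : bs) (X1 X2 : fser C V) m :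
  X1 = sbst false c1 c2 g G1' -> X2 = sbst true c3 c4 g G2' ->
  (forall m1 m2, G1' m1 m2 = d1 * G1 m1 m2) -> (forall m1 m2, G2' m1 m2 = d2 * G2 m1 m2) ->
  e1 * e1 = 1 -> e2 * e2 = 1 -> n1 + n2 = k + 1 ->
  f = bexp_xi b g * ((bz n1 * (bcz e1 0 * bsbst false c1 c2 g G1)) *
                     (bz n2 * (bcz e2 0 * bsbst true c3 c4 g G2))) ->
  oint (fmul (fz k) (fmul (fexp (xi_diff b g)) (fmul X1 X2))) m =
  (0 +i* (2 * pi))%C * (d1 * d2 * (e1 * e2) * f (m, 0)).
Proof.
move=> -> -> h1 h2 ee1 ee2 nk ->; rewrite /oint; congr (_ * _).
set S1 := bsbst false c1 c2 g G1; set S2 := bsbst true c3 c4 g G2.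
transitivity ((bz k * (bexp_xi b g * (bsbst false c1 c2 g G1' * bsbst true c3 c4 g G2'))) (m, -1)).
  by [].
rewrite (bsbstZ _ _ _ _ h1) (bsbstZ _ _ _ _ h2) -/S1 -/S2.
transitivity ((bcz d1 0 * (bcz d2 0 * (bz k * (bexp_xi b g * (S1 * S2))))) (m, -1)).
  by congr (bser_val _ _); ring.
transitivity (d1 * d2 * (e1 * e2) *
    (bcz e1 0 * (bcz e2 0 * (bz (n1 + n2) * (bexp_xi b g * (S1 * S2))))) (m, 0)); last first.
  by congr (_ * _); rewrite bzD; congr (bser_val _ _); ring.
move: (bexp_xi b g * (S1 * S2)) => W.
have eL : (bcz d1 0 * (bcz d2 0 * (bz k * W))) (m, -1) = d1 * (d2 * W (m, -1 - k)).
  exact: etrans (bcz_const d1 _ _) (congr1 _ (etrans (bcz_const d2 _ _) (congr1 _ (bzE k W _)))).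
have eR : (bcz e1 0 * (bcz e2 0 * (bz (n1 + n2) * W))) (m, 0) = e1 * (e2 * W (m, 0 - (n1 + n2))).
  exact: etrans (bcz_const e1 _ _) (congr1 _ (etrans (bcz_const e2 _ _) (congr1 _ (bzE (n1 + n2) W _)))).
rewrite eL eR nk.
have -> : -1 - k = 0 - (k + 1) by lia.
move: (bser_val W _) => w; transitivity (d1 * d2 * (e1 * e1) * (e2 * e2) * w); last by ring.
by rewrite ee1 ee2 !mulr1 mulrA.
Qed.

(** The fields turn [<s + 1_a|] and [<s' - 1_b|] into the dual states of [tau a g s] and
    [tau g b s']. Every sign depending on [g] occurs twice, from the [eps_s] and from the states, so
    the remaining factor is common to all [g]. *)
Lemma left_term (a b g : 'I_N) s s' m :
  let z1 := (bra F (Defs.shift s 1 a), ket F s) in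
  let z2 := (bra F (Defs.shift s' (-1) b), ket F s') in
  eps_s a g s * (eps_s b g s')^-1 *
    oint (fmul (fz (s g - s' g + (a == g)%:R + (b == g)%:R - 2))
         (fmul (fexp (xi_diff false g))
         (fmul (fsubst (times_shift false false (-1) g) (times false true) (tau F A a g s))
               (fsubst (times_shift true false 1 g) (times true true) (tau F A g b s'))))) m =
  (0 +i* (2 * pi))%C * ((-1) ^ (right_sum a s + right_sum b s') *
    (pref (\sum_(mu < N) s mu) * pref (\sum_(mu < N) s' mu)) *
  vprod (vertex_L1 hg g) (vertex_L2 hg g) z1 z2 (m, 0)).
Proof.
move=> z1 z2; set f := vprod _ _ z1 z2.
apply: (etrans (congr1 (GRing.mul _) (@oint_scale _ false g
  (T (bra F (Defs.shift (Defs.shift s 1 a) (-1) g), ket F s))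
  (T (bra F (Defs.shift (Defs.shift s' (-1) b) 1 g), ket F s'))
  (tau F A a g s) (tau F A g b s') (pref (\sum_(mu < N) s mu)) (pref (\sum_(mu < N) s' mu))
  (-1) 0 1 0 ((-1) ^ right_sum g (Defs.shift s 1 a)) ((-1) ^ right_sum g (Defs.shift s' (-1) b))
  (Defs.shift s 1 a g - 1) (- Defs.shift s' (-1) b g) f _ _ m (fsubst_left _ _ _ _) (fsubst_left _ _ _ _) _ _ _ _ _ _))); first last.
all: cycle 1.
- by rewrite /f /vprod (vser_L1 hg) (vser_L2 hg).
- rewrite /Defs.shift (eq_sym g) (eq_sym g).
  case: (a == g); case: (b == g); lia.
- exact: signz_sqr.
- exact: signz_sqr.
- by move=> m1 m2; rewrite [in RHS]shiftC.
- by [].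
rewrite !right_sum_shift !eps_sE mulr1 mulrN1 !signzD -!eps_sign signzN -eps_sign.
rewrite !invfM !signzV.
have -> : (eps b g)^-1 = eps b g :> C by rewrite eps_sign signzV.
have ea : eps a g * eps a g = 1 :> C := eps_sqr a g.
have eb : eps b g * eps b g = 1 :> C := eps_sqr b g.
have e1 := @signz_sqr R (right_sum g s); have e2 := @signz_sqr R (right_sum g s').
move: ea eb e1 e2.
move: (eps a g : C) (eps b g : C) ((-1) ^ right_sum g s : C) ((-1) ^ right_sum g s' : C).
move: ((-1) ^ right_sum a s : C) ((-1) ^ right_sum b s' : C) (pref _ : C) (pref _ : C) (f _) => x1 x2 x3 x4 x5 y1 y2 y3 y4 h1 h2 h3 h4.
move: (0 +i* _)%C => x0.
transitivity ((y1 * y1) * (y2 * y2) * (y3 * y3) * (y4 * y4) * (x0 * (x1 * x2 * (x3 * x4) * x5))); first by ring.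
rewrite h1 h2 h3 h4 !mul1r; ring.
Qed.

(** Now the kets change: raising [s] at [g] keeps the dual state of [tau a g] at [<s + 1_a|], and
    lowering [s'] keeps the other at [<s' - 1_b|]. The factors [eps0N] compensate the change of
    [pref] up to the sign from [prefP], leaving the factor of [left_term] negated. *)
Lemma right_term (a b g : 'I_N) s s' m :
  let z1 := (bra F (Defs.shift s 1 a), ket F s) in
  let z2 := (bra F (Defs.shift s' (-1) b), ket F s') in
  eps a g * eps b g * eps_s a g s * eps0N s * (eps_s b g s')^-1 * (eps0N s')^-1 *
    oint (fmul (fz (s' g - s g - 2))
         (fmul (fexp (xi_diff true g))
         (fmul (fsubst (times false false) (times_shift false true (-1) g)
                  (tau F A a g (Defs.shift s 1 g)))
               (fsubst (times true false) (times_shift true true 1 g)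
                  (tau F A g b (Defs.shift s' (-1) g)))))) m =
  - ((0 +i* (2 * pi))%C * ((-1) ^ (right_sum a s + right_sum b s') *
    (pref (\sum_(mu < N) s mu) * pref (\sum_(mu < N) s' mu)) *
  vprod (vertex_R1 hg g) (vertex_R2 hg g) z1 z2 (m, 0))).
Proof.
move=> z1 z2; set f := vprod _ _ z1 z2.
apply: (etrans (congr1 (GRing.mul _) (@oint_scale _ true g
  (T (bra F (Defs.shift s 1 a), ket F (Defs.shift s 1 g)))
  (T (bra F (Defs.shift s' (-1) b), ket F (Defs.shift s' (-1) g)))
  (tau F A a g (Defs.shift s 1 g)) (tau F A g b (Defs.shift s' (-1) g))
  (pref (\sum_(mu < N) s mu + 1)) (pref (\sum_(mu < N) s' mu - 1))
  0 (-1) 0 1 ((-1) ^ right_sum g s) ((-1) ^ right_sum g s')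
  (- s g) (s' g - 1) f _ _ m (fsubst_right _ _ _ _) (fsubst_right _ _ _ _) _ _ _ _ _ _))); first last.
all: cycle 1.
- by rewrite /f /vprod (vser_R1 hg) (vser_R2 hg).
- by lia.
- exact: signz_sqr.
- exact: signz_sqr.
- move=> m1 m2; rewrite /tau sum_shift.
  by have := shiftK s' (-1) g; rewrite opprK => ->.
- by move=> m1 m2; rewrite /tau sum_shift (shiftC s) shiftK.
rewrite prefS prefP !eps0N_sign !eps_sE !signzD !invfM !signzV.
have -> : (eps b g)^-1 = eps b g :> C by rewrite eps_sign signzV.
have ea : eps a g * eps a g = 1 :> C := eps_sqr a g.
have eb : eps b g * eps b g = 1 :> C := eps_sqr b g.
have e1 := @signz_sqr R (right_sum g s); have e2 := @signz_sqr R (right_sum g s').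
have e3 := @signz_sqr R (\sum_(mu < N) s mu); have e4 := @signz_sqr R (\sum_(mu < N) s' mu).
move: ea eb e1 e2 e3 e4.
move: (eps a g : C) (eps b g : C) ((-1) ^ right_sum g s : C) ((-1) ^ right_sum g s' : C).
move: ((-1) ^ (\sum_(mu < N) s mu) : C) ((-1) ^ (\sum_(mu < N) s' mu) : C).
move: ((-1) ^ right_sum a s : C) ((-1) ^ right_sum b s' : C) (pref _ : C) (pref _ : C) (f _) => x1 x2 x3 x4 x5 y5 y6 y1 y2 y3 y4 h1 h2 h3 h4 h5 h6.
move: (0 +i* _)%C => x0.
transitivity (- ((y1 * y1) * (y2 * y2) * (y3 * y3) * (y4 * y4) * (y5 * y5) * (y6 * y6) * (x0 * (x1 * x2 * (x3 * x4) * x5)))); first by ring.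
rewrite h1 h2 h3 h4 h5 h6 !mul1r; ring.
Qed.

End TodaTerms.

Theorem theorem7p1 (R : realType) (N : nat) (hN : (1 <= N)%N)
    (F : clifford_fock R N)
    (A : 'I_N -> 'I_N -> int -> int -> R[i]) (hg : g_defined F A) :
  toda_tau (tau F A).
Proof.
move=> a b s s' m.
have e (l r : 'I_N -> R[i]) (c d : R[i]) : \sum_g l g = \sum_g r g ->
    \sum_g c * (d * l g) = - \sum_g - (c * (d * r g)).
  by move=> lr; rewrite sumrN opprK -!mulr_sumr lr.
apply: (etrans (eq_bigr _ (fun g _ => left_term hg a b g s s' m))).
apply: esym; apply: (etrans (congr1 -%R (eq_bigr _ (fun g _ => right_term hg a b g s s' m)))).
by apply/esym/e; exact: vprod_LR.
Qed.
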